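(* Let $n\ge 2$ and $1<\rho<n$, and let $\widetilde\rho=\frac{\rho n}{\rho n+\rho-n}$. Suppose that $\Omega\in L^\rho(\mathbb S^{n-1})$ with $\int_{\mathbb S^{n-1}}\Omega\,d\sigma=0$, and let $\widetilde\rho\le p<n$. Then there is a constant $c(n,p,\rho)$, depending only on $n,p,\rho$, such that for every $f\in C_c^\infty(\mathbb R^n)$ there exist sparse families $\mathcal S_t\subseteq\mathcal D^t$, $t\in\{0,\frac13\}^n$, depending on $f$, such that $$T^\ast_\Omega f(x)\le c(n,p,\rho)\,\|\Omega\|_{L^\rho(\mathbb S^{n-1})}\sum_{t\in\{0,1/3\}^n} I^{\mathcal S_t}_{1,L^p}(|\nabla f|)(x),\qquad x\in\mathbb R^n.$$ In particular, the same bound holds for $|T_\Omega f(x)|$.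
   Context: Cubes have sides parallel to the axes and $\ell(Q)$ is the side length of $Q$. For $f\in C_c^\infty(\mathbb R^n)$ define $$T_\Omega f(x)=\mathrm{p.v.}\int_{\mathbb R^n}\frac{\Omega(y/|y|)}{|y|^n}f(x-y)\,dy,\qquad T^\ast_\Omega f(x)=\sup_{\varepsilon>0}\Bigl|\int_{|y|>\varepsilon}\frac{\Omega(y/|y|)}{|y|^n}f(x-y)\,dy\Bigr|$$ (for such $f$ the principal value exists at every point). Shifted dyadic grids: for $t\in\{0,\frac13\}^n$, $\mathcal D^t=\{2^k([0,1)^n+m+(-1)^kt):k\in\mathbb Z,\ m\in\mathbb Z^n\}$. A subcollection $\mathcal S$ of a dyadic grid is sparse if for every $Q\in\mathcal S$ there is a measurable set $E_Q\subseteq Q$ with $|Q|\le 2|E_Q|$ and the sets $\{E_Q\}_{Q\in\mathcal S}$ are pairwise disjoint. For a sparse family $\mathcal S$ and $1\le p<n$, $$I^{\mathcal S}_{1,L^p}g=\sum_{Q\in\mathcal S}\ell(Q)\Bigl(\frac1{|Q|}\int_Q|g|^p\Bigr)^{1/p}\mathbf 1_Q.$$ *)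

(* Defs.v *)
From HB Require Import structures.
From mathcomp Require Import all_boot all_order all_algebra.
From mathcomp Require Import all_classical all_reals all_analysis.
From mathcomp Require Import measurable_realfun.

Set Implicit Arguments.
Unset Strict Implicit.
Unset Printing Implicit Defensive.

Import Order.TTheory GRing.Theory Num.Theory.
Import numFieldNormedType.Exports.

Local Open Scope classical_set_scope.
Local Open Scope ring_scope.

(* The product sigma-algebra on R^n, generated by the coordinate maps; it is
   the Borel sigma-algebra. *)
Section measurable_rV.
Context {R : realType} (n : nat).

Let coord (i : 'I_n) (v : 'rV[R]_n) : measurableTypeR R := v ord0 i.

Let rV_set0 : g_sigma_preimage coord set0.
Proof. exact: sigma_algebra0. Qed.

Let rV_setC A : g_sigma_preimage coord A -> g_sigma_preimage coord (~` A).
Proof. exact: sigma_algebraC. Qed.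

Let rV_bigcup (F : _^nat) : (forall i, g_sigma_preimage coord (F i)) ->
  g_sigma_preimage coord (\bigcup_i (F i)).
Proof. exact: sigma_algebra_bigcup. Qed.

HB.instance Definition _ := @isMeasurable.Build default_measure_display
  'rV[R]_n (g_sigma_preimage coord) rV_set0 rV_setC rV_bigcup.

Lemma measurable_coord (i : 'I_n) :
  measurable_fun [set: 'rV[R]_n] (fun v => v ord0 i).
Proof.
move=> _ Y mY; rewrite setTI; apply: sub_sigma_algebra => /=.
rewrite -bigcup_seq/=; exists i => /=; first by rewrite mem_index_enum.
by exists Y => //; rewrite setTI.
Qed.

Lemma measurable_fun_rVP d (T : measurableType d) (f : T -> 'rV[R]_n) :
  measurable_fun setT f <->
  forall i, measurable_fun setT (fun x => f x ord0 i).
Proof.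
split=> [mf i|mf].
  exact: (measurableT_comp (measurable_coord i) mf).
move=> _; have -> : measurable = g_sigma_preimage coord by [].
rewrite /g_sigma_preimage.
set G := \big[setU/set0]_(i < n) _.
move=> Y GY; rewrite setTI.
suff : preimage_set_system setT f <<s G>> `<=` measurable.
  by apply; exists Y => //; rewrite setTI.
rewrite -g_sigma_preimageE; apply: smallest_sub.
  exact: sigma_algebra_measurable.
move=> _ [B GB <-]; move: GB; rewrite /G -bigcup_seq => -[i _ [C mC <-]].
rewrite !setTI; have := mf i _ C mC; rewrite setTI; exact.
Qed.

End measurable_rV.

Section lebesgue_rV.
Context {R : realType}.

Definition cons_rV (n : nat) (p : measurableTypeR R * 'rV[R]_n) : 'rV[R]_n.+1 :=
  \row_i (if unlift ord0 i is Some j then p.2 ord0 j else p.1).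

Definition uncons_rV (n : nat) (v : 'rV[R]_n.+1) : measurableTypeR R * 'rV[R]_n :=
  (v ord0 ord0, \row_j v ord0 (lift ord0 j)).

Lemma uncons_rVK n : cancel (@uncons_rV n) (@cons_rV n).
Proof.
by move=> v; apply/rowP => i; rewrite mxE/=; case: unliftP => [j|] ->//; rewrite mxE.
Qed.

Lemma cons_rVK n : cancel (@cons_rV n) (@uncons_rV n).
Proof.
move=> [x v]; congr pair; first by rewrite mxE/= unlift_none.
by apply/rowP => i; rewrite !mxE/= liftK.
Qed.

Lemma measurable_cons_rV n : measurable_fun setT (@cons_rV n).
Proof.
apply/measurable_fun_rVP => i; case: (unliftP ord0 i) => [j|] ->.
  rewrite (_ : (fun _ => _) = (fun v : 'rV[R]_n => v ord0 j) \o snd).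
    exact: (measurableT_comp (measurable_coord j) measurable_snd).
  by apply/funext => p; rewrite mxE/= liftK.
rewrite (_ : (fun _ => _) = fst); first exact: measurable_fst.
by apply/funext => p; rewrite mxE/= unlift_none.
Qed.

Lemma measurable_uncons_rV n : measurable_fun setT (@uncons_rV n).
Proof.
apply: measurable_fun_pair; first exact: measurable_coord.
apply/measurable_fun_rVP => i.
rewrite (_ : (fun _ => _) = (fun v : 'rV[R]_n.+1 => v ord0 (lift ord0 i))).
  exact: measurable_coord.
by apply/funext => v; rewrite mxE.
Qed.

Section lebesgue_cons.
Context (n : nat) (m : {sigma_finite_measure set 'rV[R]_n -> \bar R}).

Definition lebesgue_cons : set 'rV[R]_n.+1 -> \bar R :=
  pushforward (lebesgue_measure \x m)%E (@cons_rV n).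

Let mcons := @measurable_cons_rV n.

Let lebesgue_cons0 : lebesgue_cons set0 = 0%E.
Proof. exact: measure0. Qed.

Let lebesgue_cons_ge0 A : (0 <= lebesgue_cons A)%E.
Proof. exact: measure_ge0. Qed.

Let lebesgue_cons_sigma_additive : semi_sigma_additive lebesgue_cons.
Proof. exact: measure_semi_sigma_additive. Qed.

HB.instance Definition _ := isMeasure.Build _ _ _ lebesgue_cons
  lebesgue_cons0 lebesgue_cons_ge0 lebesgue_cons_sigma_additive.

Let lebesgue_cons_sigma_finite : sigma_finite setT lebesgue_cons.
Proof.
have [F TF Foo] := sigma_finiteT (@lebesgue_measure R).
have [G TG Goo] := sigma_finiteT m.
pose A k l := @uncons_rV n @^-1` (F k `*` G l).
have mA k l : measurable (A k l).
  rewrite -[X in measurable X]setTI; apply: measurable_uncons_rV => //.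
  by apply: measurableX; [exact: (Foo k).1|exact: (Goo l).1].
have Aoo k l : (lebesgue_cons (A k l) < +oo)%E.
  rewrite /lebesgue_cons /pushforward -comp_preimage.
  rewrite (_ : _ \o _ = id) ?preimage_id; last first.
    by apply/funext => p /=; exact: cons_rVK.
  have [mF Fk] := Foo k; have [mG Gl] := Goo l.
  by rewrite product_measure1E// lte_mul_pinfty// ge0_fin_numE.
pose dec (k : nat) : nat * nat := odflt (0, 0)%N (unpickle k).
exists (fun k => A (dec k).1 (dec k).2) => [|k]; last by [].
rewrite predeqE => v; split=> // _.
have [k _ Fk] : (\bigcup_i F i) (uncons_rV v).1 by rewrite -TF.
have [l _ Gl] : (\bigcup_i G i) (uncons_rV v).2 by rewrite -TG.
by exists (pickle (k, l)) => //; rewrite /dec pickleK.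
Qed.

HB.instance Definition _ := @Measure_isSigmaFinite.Build _ _ _ lebesgue_cons
  lebesgue_cons_sigma_finite.

End lebesgue_cons.

(* Lebesgue measure on (the Borel subsets of) R^n, as the n-fold product of the
   Lebesgue measure on R. *)
Fixpoint lebesgue_rV (n : nat) : {sigma_finite_measure set 'rV[R]_n -> \bar R} :=
  if n is n'.+1 then lebesgue_cons (lebesgue_rV n')
  else \d_(0 : 'rV[R]_0).

End lebesgue_rV.

Section euclidean.
Context {R : realType} (n : nat).
Implicit Types x y : 'rV[R]_n.

(* The library norm on 'rV[R]_n is the sup norm. *)
Definition enorm x : R := Num.sqrt (\sum_i x ord0 i ^+ 2).

Lemma measurable_enorm : measurable_fun setT enorm.
Proof.
rewrite (_ : enorm = (@powR R ^~ 2^-1) \o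
                     (fun x => \sum_(i < n) x ord0 i ^+ 2)).
  apply: measurableT_comp => //.
  apply: measurable_sum => i.
  exact: (measurable_funX 2 (measurable_coord i)).
apply/funext => x /=; rewrite powR12_sqrt//.
by apply: sumr_ge0 => i _; exact: sqr_ge0.
Qed.

Definition sphere : set 'rV[R]_n := [set x | enorm x = 1].

Lemma measurable_sphere : measurable sphere.
Proof.
by rewrite -[X in measurable X]setTI; exact: (measurable_enorm _ (measurable_set1 1)).
Qed.

Definition edir x : 'rV[R]_n := (enorm x)^-1 *: x.

Lemma measurable_edir : measurable_fun setT edir.
Proof.
apply/measurable_fun_rVP => i.
rewrite (_ : (fun _ => _) = (fun x => enorm x `^ (-1) * x ord0 i)).
  apply: measurable_funM; last exact: measurable_coord.
  apply: (@measurableT_comp _ _ _ _ _ _ (@powR R ^~ (-1))) => //.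
  exact: measurable_enorm.
by apply/funext => x; rewrite !mxE powR_inv1// sqrtr_ge0.
Qed.

Definition punctured_ball : set 'rV[R]_n := [set x | 0 < enorm x <= 1].

Lemma measurable_punctured_ball : measurable punctured_ball.
Proof.
rewrite (_ : punctured_ball = setT `&` enorm @^-1` `]0, 1]%classic).
  by apply: measurable_enorm => //; exact: measurable_itv.
by apply/seteqP; split => x /=; rewrite in_itv/= => // -[].
Qed.

(* The surface measure of the sphere, defined through polar coordinates:
   sigma(A) = n |{x : 0 < |x| <= 1, x/|x| \in A}|. As a measure on R^n it is
   carried by the sphere. *)
Definition sphere_measure : set 'rV[R]_n -> \bar R := fun A =>
  (n%:R%:E * lebesgue_rV n (edir @^-1` A `&` punctured_ball))%E.

Let cone_measure : set 'rV[R]_n -> \bar R :=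
  pushforward (mrestr (lebesgue_rV n) measurable_punctured_ball) edir.

Let medir := measurable_edir.

Let cone_measure0 : cone_measure set0 = 0%E.
Proof. exact: measure0. Qed.

Let cone_measure_ge0 A : (0 <= cone_measure A)%E.
Proof. exact: measure_ge0. Qed.

Let cone_measure_sigma_additive : semi_sigma_additive cone_measure.
Proof. exact: measure_semi_sigma_additive. Qed.

HB.instance Definition _ := isMeasure.Build _ _ _ cone_measure
  cone_measure0 cone_measure_ge0 cone_measure_sigma_additive.

Let sphere_measureE : sphere_measure = mscale (n%:R%:nng) cone_measure.
Proof. by []. Qed.

Let sphere_measure0 : sphere_measure set0 = 0%E.
Proof. by rewrite sphere_measureE measure0. Qed.

Let sphere_measure_ge0 A : (0 <= sphere_measure A)%E.
Proof. by rewrite sphere_measureE measure_ge0. Qed.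

Let sphere_measure_sigma_additive : semi_sigma_additive sphere_measure.
Proof. rewrite sphere_measureE; exact: measure_semi_sigma_additive. Qed.

HB.instance Definition _ := isMeasure.Build _ _ _ sphere_measure
  sphere_measure0 sphere_measure_ge0 sphere_measure_sigma_additive.

End euclidean.
Arguments sphere R n : clear implicits.
Arguments sphere_measure R n : clear implicits.

Section smooth_functions.
Context {R : realType} (n : nat).
Implicit Types f : 'rV[R]_n -> R.

Definition partial (i : 'I_n) f : 'rV[R]_n -> R :=
  fun x => 'D_(delta_mx ord0 i) f x.

(* C^oo: all the iterated partial derivatives exist and are continuous. *)
Definition smooth f := forall s : seq 'I_n,
  continuous (foldr partial f s) /\
  forall i x, derivable (foldr partial f s) x (delta_mx ord0 i).

Definition smooth_compact_support f :=
  smooth f /\ compact (closure [set x | f x != 0]).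

Definition gradient f x : 'rV[R]_n := \row_i partial i f x.

End smooth_functions.

Section rough_operators.
Context {R : realType} (n : nat).
Implicit Types (Om f : 'rV[R]_n -> R) (x : 'rV[R]_n).

(* A function on the sphere is represented by a function on R^n, of which only
   the values on the sphere are used. *)
Definition sphere_Lnorm (rho : R) Om : \bar R :=
  ('N[sphere_measure R n]_(rho%:E)[EFin \o (Om \_ (sphere R n))])%E.

Definition sphere_Lp (rho : R) Om :=
  measurable_fun (sphere R n) Om /\ (sphere_Lnorm rho Om < +oo)%E.

Definition truncated Om f (eps : R) x : \bar R :=
  (\int[lebesgue_rV n]_(y in [set y | (eps < enorm y)%R])
     (Om (edir y) / enorm y ^+ n * f (x - y))%:E)%E.

Definition rough_pv_exists Om f x :=
  cvg (truncated Om f eps x @[eps --> 0^'+]).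

Definition rough_op Om f x : \bar R :=
  lim (truncated Om f eps x @[eps --> 0^'+]).

Definition rough_max_op Om f x : \bar R :=
  ereal_sup [set `|truncated Om f eps x|%E | eps in [set eps | 0 < eps]].

End rough_operators.

Section sparse_families.
Context {R : realType} (n : nat).
Implicit Types (Q : 'rV[R]_n * R) (S : set ('rV[R]_n * R)) (t : 'rV[R]_n).

(* The pair (a, l) stands for the cube \prod_i [a_i, a_i + l), of side l. *)
Definition cube Q : set 'rV[R]_n :=
  [set x | forall i, Q.1 ord0 i <= x ord0 i < Q.1 ord0 i + Q.2].

Definition dyadic_cube t (k : int) (m : 'rV[int]_n) : 'rV[R]_n * R :=
  (2 ^ k *: (map_mx intr m + (-1) ^ k *: t), 2 ^ k).

Lemma cube_dyadic_cube t (k : int) (m : 'rV[int]_n) :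
  cube (dyadic_cube t k m) =
  [set 2 ^ k *: (u + map_mx intr m + (-1) ^ k *: t) |
    u in [set u : 'rV[R]_n | forall i, 0 <= u ord0 i < 1]].
Proof.
have k0 : 0 < (2 : R) ^ k by exact: exprz_gt0.
apply/seteqP; split=> [x Qx|_ [u u01 <-] i] /=.
  exists ((2 ^ k)^-1 *: x - (map_mx intr m + (-1) ^ k *: t)) => /=; last first.
    by rewrite -addrA subrK scalerA mulfV ?gt_eqF// scale1r.
  move=> i; have /andP[] := Qx i; rewrite /= !mxE => ax xa.
  set w := intr (m ord0 i) + _ in ax xa *.
  rewrite subr_ge0 ltrBlDr mulrC ler_pdivlMr// ltr_pdivrMr//.
  by rewrite mulrC ax/= mulrDl mul1r mulrC addrC.
have /andP[u0 u1] := u01 i.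
rewrite !mxE -addrA; set w := intr (m ord0 i) + _.
by rewrite ler_pM2l// lerDr u0/= mulrDr addrC ltrD2l gtr_pMr.
Qed.

Definition dyadic_grid t : set ('rV[R]_n * R) :=
  [set dyadic_cube t k m | k in [set: int] & m in [set: 'rV[int]_n]].

(* The elements of {0, 1/3}^n are indexed by {ffun 'I_n -> bool}. *)
Definition shift_of (b : {ffun 'I_n -> bool}) : 'rV[R]_n :=
  \row_i (if b i then 3^-1 else 0).

Definition sparse S := exists E : 'rV[R]_n * R -> set 'rV[R]_n,
  (forall Q, S Q ->
    [/\ measurable (E Q), E Q `<=` cube Q &
        (lebesgue_rV n (cube Q) <= 2%:E * lebesgue_rV n (E Q))%E]) /\
  trivIset S E.

Definition average Q (g : 'rV[R]_n -> R) : \bar R :=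
  ((\int[lebesgue_rV n]_(y in cube Q) (g y)%:E) / lebesgue_rV n (cube Q))%E.

Definition sparse_frac_op S (p : R) (g : 'rV[R]_n -> R) (x : 'rV[R]_n) : \bar R :=
  \esum_(Q in S) (Q.2%:E * (average Q (fun y => (`|g y| `^ p)%R)) `^ p^-1 *
                  (\1_(cube Q) x)%:E)%E.

End sparse_families.

(* Main.v *)
From HB Require Import structures.
Require Import Defs.
From mathcomp Require Import all_boot all_order all_algebra.
From mathcomp Require Import all_classical all_reals all_analysis.
From mathcomp Require Import measurable_realfun zify ring lra.

Set Implicit Arguments.
Unset Strict Implicit.
Unset Printing Implicit Defensive.

Import Order.TTheory GRing.Theory Num.Theory.
Import numFieldNormedType.Exports.

Local Open Scope classical_set_scope.
Local Open Scope ring_scope.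

(** The idea of the proof. Fix [x], put [F y := f (x - y)], and cut the truncated
    integral of [K * F], where [K] is the kernel [Om (y / |y|) / |y| ^+ n], into the
    dyadic annuli [r < |y| <= 2 r].

    One annulus. As [Om] has mean zero, [K] integrates to zero over the annulus, and
    [F] may be replaced by [F - F z]; averaging over [z] in a cube of side
    comparable to [r] bounds the integral by a double integral of
    [|Om (y / |y|)| * |F y - F z|]. The difference is bounded by integrating the
    gradient of [F] along the segment from [y] to [z = y + h], which leaves, for
    each [t] in [(0, 1]], the double integral in [y] and [h] of
    [|Om (y / |y|)| * |gradient F (y + t h)|]. It is estimated by Hoelder's
    inequality with the three factors [|Om| ^ rho], [|gradient F| ^ p] and their
    product, the last with exponent [1 / n], so that the first two have the
    exponents [1 / rho - 1 / n] and [1 / p - 1 / n]; the lower bound on [p] says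
    that the exponents add up to at most [1]. The gain comes from the product: for
    a fixed value of [w = y + t h], the point [y] is confined to a box of size
    [t r] around [w], which meets the annulus in a part of a shell of thickness
    [t r], and there a function of the direction has mass [O(t r ^+ n)] rather than
    [O(r ^+ n)] ([integral_shell_box]). Thus the factor [t ^- n] of the change of
    variables from [h] to [w] is improved to [t ^- (n - 1)], and its [n]-th root is
    integrable on [(0, 1]]; with [t = u ^+ n] it is cancelled exactly by the
    Jacobian ([averaging_estimate], [annulus_double_integral]). The result is that
    the annulus contributes at most a constant times the norm of [Om] times [r]
    times the [L^p] mean of the gradient of [f] over the box of radius [6 r] about
    [x] ([annulus_bound]).

    All annuli. Such a box lies in a cube of comparable side of one of the shifted
    grids ([box_in_dyadic]), so that in each grid it remains to sum the side times
    the [L^p] mean over cubes containing [x], one of each generation. Let [g] be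
    the [p]-th power of the norm of the gradient of [f] and call principal, for all
    powers of [a = 2 ^+ n.+1], the maximal cubes on which the mean of [g] exceeds
    that power. Every
    cube with a positive mean is contained in a principal cube whose mean is at
    least [1 / a] times as large, and the sides of the cubes below a given one form
    a geometric series: the sum over all generations is at most [2 a] times the sum
    over the principal cubes ([sum_le_principal]). Principal cubes form a sparse
    family, by the weak type inequality for the dyadic maximal function
    ([principal_sparse]). They depend neither on [x] nor on the truncation, which
    gives the bound of the maximal operator.

    The principal value. As [F] is Lipschitz, the same cancellation bounds the
    contribution of the region [e < |y| <= d] by a multiple of [d]
    ([shell_part_small]). Hence the truncations form a Cauchy family, and their
    limit is bounded by the maximal operator. *)

(** * Affine changes of variables and volumes of cubes *)

Section affine_change_of_variables.
Context {R : realType}.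
Local Open Scope ereal_scope.

(** Lebesgue measure on the line is determined by its values on half-open
    intervals, and the image measure, suitably scaled, has the same ones. *)
Lemma integral_affine_line (phi : R -> \bar R) (a s : R) : (0 < s)%R ->
  measurable_fun setT phi -> (forall x, 0 <= phi x) ->
  \int[lebesgue_measure]_x phi x =
  s%:E * \int[lebesgue_measure]_x phi (a + s * x)%R.
Proof.
move=> s0 mphi phi0.
have s0' : (0 <= s)%R by exact: ltW.
pose T : R -> measurableTypeR R := fun x => (a + s * x)%R.
have mT : measurable_fun setT T.
  apply: measurable_funD; first exact: measurable_cst.
  by apply: measurable_funM; [exact: measurable_cst|exact: measurable_id].
pose pm : {measure set (measurableTypeR R) -> \bar R} :=
  measure_function_pushforward__canonical__measure_function_Measure
    (@lebesgue_measure R) mT.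
pose m := mscale (NngNum s0') pm.
rewrite (eq_measure_integral [the measure _ _ of m]); last first.
  move=> A mA _.
  apply: lebesgue_measure_unique => // _ [[u v] _ <-].
  have eT : T @^-1` `]u, v] = `]((u - a) / s)%R, ((v - a) / s)%R]%classic.
    apply/seteqP; split=> x; rewrite /T /= !in_itv/= ltr_pdivrMr// ler_pdivlMr//;
    by rewrite ltrBlDl lerBrDl (mulrC x).
  transitivity (s%:E * lebesgue_measure (T @^-1` `]u, v]))%E; last by [].
  rewrite eT.
  rewrite !lebesgue_measure_itv/= !lte_fin ltr_pM2r ?invr_gt0// ltrD2r.
  case: ifP => uv; last by rewrite mule0.
  by rewrite -EFinM; congr (_%:E); rewrite /=; field; rewrite gt_eqF.
rewrite ge0_integral_mscale//=; congr (_ * _).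
by rewrite ge0_integral_pushforward.
Qed.

End affine_change_of_variables.

Section lebesgue_rV_affine.
Context {R : realType}.
Local Open Scope ereal_scope.

Lemma integral_lebesgue_rVS n (phi : 'rV[R]_n.+1 -> \bar R) :
  measurable_fun setT phi -> (forall x, 0 <= phi x) ->
  \int[lebesgue_rV n.+1]_x phi x =
  \int[lebesgue_measure]_x \int[lebesgue_rV n]_v phi (cons_rV (x, v)).
Proof.
move=> mphi phi0.
have mc : measurable_fun setT (@cons_rV R n) by exact: measurable_cons_rV.
rewrite /= ge0_integral_pushforward//.
rewrite fubini_tonelli1//; first exact: measurableT_comp.
by move=> x /=.
Qed.

Lemma measurable_affine_rV n (a : 'rV[R]_n) (s : R) :
  measurable_fun setT (fun x : 'rV[R]_n => a + s *: x)%R.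
Proof.
apply/measurable_fun_rVP => i.
rewrite (_ : (fun _ => _) = (fun x : 'rV[R]_n => a ord0 i + s * x ord0 i)%R).
  apply: measurable_funD; first exact: measurable_cst.
  by apply: measurable_funM; [exact: measurable_cst|exact: measurable_coord].
by apply/funext => x; rewrite !mxE.
Qed.

Lemma integral_affine_rV n (phi : 'rV[R]_n -> \bar R) (a : 'rV[R]_n) (s : R) :
  (0 < s)%R -> measurable_fun setT phi -> (forall x, 0 <= phi x) ->
  \int[lebesgue_rV n]_x phi x =
  (s ^+ n)%:E * \int[lebesgue_rV n]_x phi (a + s *: x)%R.
Proof.
move=> s0; elim: n phi a => [|n IH] phi a mphi phi0.
  rewrite expr0 mul1e; apply: eq_integral => x _; congr phi.
  by apply/rowP; case.
have mphi' (x : R) : measurable_fun setT (fun v => phi (cons_rV (x, v))).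
  apply: measurableT_comp => //.
  exact: (measurable_fun_pair2 _ (@measurable_cons_rV R n)).
have mphia : measurable_fun setT (fun x : 'rV[R]_n.+1 => phi (a + s *: x)%R).
  by apply: measurableT_comp => //; exact: measurable_affine_rV.
rewrite !integral_lebesgue_rVS//.
rewrite (integral_affine_line (a ord0 ord0) s0); last 2 first.
- apply: (@measurable_fun_fubini_tonelli_F _ _ _ _ _ (lebesgue_rV n)
    (phi \o @cons_rV R n)) => [|x]; last exact: phi0.
  by apply: measurableT_comp => //; exact: measurable_cons_rV.
- by move=> x /=; apply: integral_ge0 => v _.
pose a' : 'rV[R]_n := (\row_j a ord0 (lift ord0 j))%R.
under eq_integral do rewrite (IH _ a')//.
rewrite ge0_integralZl//; last 3 first.
- apply: (@measurable_fun_fubini_tonelli_F _ _ _ _ _ (lebesgue_rV n)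
    (fun p : measurableTypeR R * 'rV[R]_n =>
       phi (cons_rV (a ord0 ord0 + s * p.1, a' + s *: p.2)%R))) => [|x]; last exact: phi0.
  apply: measurableT_comp => //; apply: measurableT_comp => /=.
    exact: measurable_cons_rV.
  apply: measurable_fun_pair => /=.
    apply: measurable_funD; first exact: measurable_cst.
    by apply: measurable_funM; [exact: measurable_cst|exact: measurable_fst].
  by apply: (measurableT_comp (measurable_affine_rV a' s)); exact: measurable_snd.
- by move=> x _ /=; apply: integral_ge0 => v _.
- by rewrite lee_fin exprn_ge0// ltW.
rewrite muleA -EFinM -exprS; congr (_ * _).
apply: eq_integral => x _; apply: eq_integral => v _; congr phi.
apply/rowP => i; rewrite !mxE/=; case: unliftP => [j|] -> //=.
by rewrite !mxE.
Qed.

Lemma cube_cons n (a : 'rV[R]_n.+1) (l : R) :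
  @cons_rV R n @^-1` cube (a, l) =
  `[a ord0 ord0, (a ord0 ord0 + l)%R[%classic `*`
    cube (\row_j a ord0 (lift ord0 j), l)%R.
Proof.
apply/seteqP; split=> [[x v] h|[x v] [/= h1 h2] i].
- split => /=.
    by have := h ord0; rewrite mxE unlift_none/= in_itv.
  by move=> j /=; have := h (lift ord0 j); rewrite !mxE liftK/=.
- rewrite /= !mxE; case: unliftP => [j|] -> /=.
    by have := h2 j; rewrite /= !mxE.
  by move: h1; rewrite in_itv.
Qed.

Lemma measurable_cube n (Q : 'rV[R]_n * R) : measurable (cube Q).
Proof.
rewrite (_ : cube Q = \bigcap_(i in [set: 'I_n])
    ((fun v : 'rV[R]_n => v ord0 i) @^-1`
       `[Q.1 ord0 i, (Q.1 ord0 i + Q.2)%R[%classic)).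
  apply: fin_bigcap_measurable => // i _.
  by rewrite -[X in measurable X]setTI; apply: measurable_coord.
apply/seteqP; split=> x h i => [_|] /=; first by rewrite in_itv/=; exact: h.
by have := h i I; rewrite /= in_itv.
Qed.

Lemma lebesgue_rV_cube n (a : 'rV[R]_n) (l : R) : (0 < l)%R ->
  lebesgue_rV n (cube (a, l)) = (l ^+ n)%:E.
Proof.
move=> l0; elim: n a => [|n IH] a.
  by rewrite /= diracE expr0 mem_set//= => -[].
rewrite /= /lebesgue_cons /pushforward cube_cons.
have mi : measurable (`[a ord0 ord0, (a ord0 ord0 + l)%R[%classic : set R).
  exact: measurable_itv.
rewrite product_measure1E//; last exact: measurable_cube.
rewrite exprS EFinM; congr (_ * _); last exact: IH.
transitivity (lebesgue_measure (`[a ord0 ord0, (a ord0 ord0 + l)%R[%classic : set R)).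
  by [].
by rewrite lebesgue_measure_itv/= lte_fin ltrDl l0 -EFinB addrAC subrr add0r.
Qed.

End lebesgue_rV_affine.

(** * The Euclidean norm *)

Section euclidean_norm.
Context {R : realType} {n : nat}.
Implicit Types x y : 'rV[R]_n.

Lemma enorm_ge0 x : 0 <= enorm x.
Proof. exact: sqrtr_ge0. Qed.

Lemma enormE x : enorm x ^+ 2 = \sum_i x ord0 i ^+ 2.
Proof. by rewrite sqr_sqrtr// sumr_ge0// => i _; rewrite sqr_ge0. Qed.

Lemma enorm0 : enorm (0 : 'rV[R]_n) = 0.
Proof.
by rewrite /enorm big1 ?sqrtr0// => i _; rewrite mxE expr0n.
Qed.

Lemma enormZ (s : R) x : enorm (s *: x) = `|s| * enorm x.
Proof.
rewrite /enorm -sqrtr_sqr -sqrtrM ?sqr_ge0//; congr Num.sqrt.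
by rewrite mulr_sumr; apply: eq_bigr => i _; rewrite mxE exprMn.
Qed.

Lemma enormN x : enorm (- x) = enorm x.
Proof. by rewrite -scaleN1r enormZ normrN1 mul1r. Qed.

Lemma edirZ (s : R) x : 0 < s -> edir (s *: x) = edir x.
Proof.
move=> s0; rewrite /edir enormZ gtr0_norm// scalerA; congr (_ *: _).
by rewrite invfM mulrAC mulVf ?mul1r// gt_eqF.
Qed.

Lemma enorm_edir x : 0 < enorm x -> enorm (edir x) = 1.
Proof.
move=> x0; rewrite /edir enormZ gtr0_norm ?invr_gt0// mulVf// gt_eqF//.
Qed.

Lemma cauchy_schwarz x y :
  `|\sum_i x ord0 i * y ord0 i| <= enorm x * enorm y.
Proof.
rewrite -(@ler_pXn2r _ 2)// ?nnegrE ?mulr_ge0 ?enorm_ge0//.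
rewrite exprMn !enormE -normrX ger0_norm ?sqr_ge0//.
have : 0 <= \sum_i \sum_j (x ord0 i * y ord0 j - x ord0 j * y ord0 i) ^+ 2.
  by apply: sumr_ge0 => i _; apply: sumr_ge0 => j _; exact: sqr_ge0.
have -> : \sum_i \sum_j (x ord0 i * y ord0 j - x ord0 j * y ord0 i) ^+ 2 =
  \sum_i \sum_j (x ord0 i ^+ 2 * y ord0 j ^+ 2) +
  (\sum_i \sum_j (x ord0 j ^+ 2 * y ord0 i ^+ 2)) -
  \sum_i \sum_j (2 * (x ord0 i * y ord0 i) * (x ord0 j * y ord0 j)).
  rewrite -big_split/= -sumrB; apply: eq_bigr => i _.
  rewrite -big_split/= -sumrB; apply: eq_bigr => j _; ring.
rewrite (exchange_big _ _ _ _ _ (fun i j => x ord0 j ^+ 2 * _))/=.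
set a := \sum_i _; set b := \sum_i \sum_j (2 * _ * _).
have -> : a = (\sum_i x ord0 i ^+ 2) * (\sum_i y ord0 i ^+ 2).
  by rewrite mulr_suml; apply: eq_bigr => i _; rewrite mulr_sumr.
have -> : b = 2 * (\sum_i x ord0 i * y ord0 i) ^+ 2.
  rewrite expr2 mulrA [2 * _]mulr_sumr mulr_suml; apply: eq_bigr => i _.
  by rewrite mulr_sumr.
by move=> h; lra.
Qed.

Lemma enormD x y : enorm (x + y) <= enorm x + enorm y.
Proof.
rewrite -(@ler_pXn2r _ 2)// ?nnegrE ?addr_ge0 ?enorm_ge0//.
rewrite sqrrD !enormE.
have -> : \sum_i (x + y) ord0 i ^+ 2 =
  \sum_i x ord0 i ^+ 2 + (\sum_i x ord0 i * y ord0 i) *+ 2 +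
  \sum_i y ord0 i ^+ 2.
  by rewrite -sumrMnl -!big_split/=; apply: eq_bigr => i _; rewrite !mxE sqrrD.
rewrite lerD2r lerD2l lerMn2r/=.
by apply: le_trans (cauchy_schwarz x y); exact: ler_norm.
Qed.

Lemma coord_le_enorm x i : `|x ord0 i| <= enorm x.
Proof.
rewrite -(@ler_pXn2r _ 2)// ?nnegrE ?enorm_ge0// enormE -normrX.
rewrite ger0_norm ?sqr_ge0// (bigD1 i)//= lerDl sumr_ge0// => j _.
exact: sqr_ge0.
Qed.

Lemma enorm_le x (s : R) : 0 <= s -> (forall i, `|x ord0 i| <= s) ->
  enorm x <= n%:R * s.
Proof.
move=> s0 xs; rewrite -(@ler_pXn2r _ 2)// ?nnegrE ?enorm_ge0 ?mulr_ge0//.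
rewrite enormE exprMn.
apply: (@le_trans _ _ (\sum_(i < n) s ^+ 2)).
  apply: ler_sum => i _; rewrite -real_normK ?num_real//.
  by rewrite ler_pXn2r// nnegrE.
rewrite sumr_const card_ord -[leLHS]mulr_natl ler_wpM2r ?sqr_ge0//.
by rewrite -natrX ler_nat; case: (n) => // m; rewrite leq_pmulr.
Qed.

End euclidean_norm.

(** * Functions of the direction on shells *)

Section homogeneous_functions_on_shells.
Context {R : realType} {n : nat}.
Implicit Types h : 'rV[R]_n -> \bar R.
Local Notation mu := (@lebesgue_rV R n).
Local Open Scope ereal_scope.

Definition shell (s1 s2 : R) : set 'rV[R]_n := [set y | (s1 < enorm y <= s2)%R].

Lemma measurable_shell s1 s2 : measurable (shell s1 s2).
Proof.
rewrite (_ : shell s1 s2 = setT `&` (@enorm R n) @^-1` `]s1, s2]%classic).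
  by apply: measurable_enorm => //; exact: measurable_itv.
by apply/seteqP; split => x /=; rewrite in_itv/= => // -[].
Qed.

(** The closed ball of the sup norm. *)
Definition box (w : 'rV[R]_n) (s : R) : set 'rV[R]_n :=
  [set y | forall i, (`|(y - w) ord0 i| <= s)%R].

Lemma measurable_box w s : measurable (box w s).
Proof.
rewrite (_ : box w s = \bigcap_(i in [set: 'I_n])
  ((fun v : 'rV[R]_n => v ord0 i) @^-1`
     `[(w ord0 i - s)%R, (w ord0 i + s)%R]%classic)).
  apply: fin_bigcap_measurable => // i _.
  by rewrite -[X in measurable X]setTI; apply: measurable_coord.
apply/seteqP; split=> x hx i => [_|] /=.
  by rewrite in_itv/=; have := hx i; rewrite !mxE ler_distl.
by have := hx i I; rewrite /= in_itv/= !mxE ler_distl.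
Qed.

(** Away from the origin, functions of this kind are the pull-backs by [edir] of
    functions on the sphere. *)
Definition homogeneous0 h := [/\ measurable_fun setT h, forall y, 0 <= h y &
  forall (s : R) y, (0 < s)%R -> h (s *: y)%R = h y].

Definition ball_mass h : \bar R := \int[mu]_(y in shell 0 1) h y.

Lemma integral_shell0 h (s : R) : homogeneous0 h -> (0 < s)%R ->
  \int[mu]_(y in shell 0 s) h y = (s ^+ n)%:E * ball_mass h.
Proof.
move=> [mh h0 hs] s0; rewrite /ball_mass integral_mkcond [in RHS]integral_mkcond.
rewrite (integral_affine_rV 0 s0).
- congr (_ * _); apply: eq_integral => y _.
  rewrite /patch add0r hs//; congr (if _ then _ else _).
  by apply/idP/idP; rewrite !inE /shell/= enormZ gtr0_norm// pmulr_rgt0//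
    ger_pMr.
- apply/(measurable_restrictT _ _).1; first exact: measurable_shell.
  exact: measurable_funTS.
- by move=> y; apply: erestrict_ge0.
Qed.

Lemma integral_shell h (s1 s2 : R) : homogeneous0 h -> ball_mass h < +oo ->
  (0 < s1)%R -> (s1 <= s2)%R ->
  \int[mu]_(y in shell s1 s2) h y = (s2 ^+ n - s1 ^+ n)%:E * ball_mass h.
Proof.
move=> hh hoo s10 s12; have s20 := lt_le_trans s10 s12.
have [mh h0 _] := hh.
have m0 : 0 <= ball_mass h by apply: integral_ge0.
have fm : ball_mass h \is a fin_num by rewrite ge0_fin_numE.
have := integral_shell0 hh s20.
have -> : shell 0 s2 = shell 0 s1 `|` shell s1 s2.
  apply/seteqP; split=> y; rewrite /shell/=.
    move=> /andP[y0 ys]; case: (leP (enorm y) s1) => ys1; [left|right].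
      by rewrite y0.
    by [].
  move=> [/andP[-> ys]|/andP[ys ->]]/=.
    exact: le_trans s12.
  by rewrite (lt_trans s10).
rewrite ge0_integral_setU//=; last 4 first.
- exact: measurable_shell.
- exact: measurable_shell.
- exact: measurable_funTS.
- apply/disj_set2P; rewrite -subset0 => y [] /andP[_ ys] /andP[+ _].
  by rewrite ltNge ys.
rewrite integral_shell0// => e.
have fs : \int[mu]_(y in shell s1 s2) h y \is a fin_num.
  rewrite ge0_fin_numE ?integral_ge0//.
  apply: (@le_lt_trans _ _ ((s2 ^+ n)%:E * ball_mass h)).
    by rewrite -e leeDr// mule_ge0// lee_fin exprn_ge0// ltW.
  by rewrite lte_mul_pinfty// lee_fin exprn_ge0// ltW.
rewrite EFinB muleBl// -e addeAC subee ?add0e// fin_numM//.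
Qed.

Lemma powB_le (a b : R) m : (0 <= a)%R -> (a <= b)%R ->
  (b ^+ m - a ^+ m <= (b - a) * (m%:R * b ^+ m.-1))%R.
Proof.
move=> a0 ab; rewrite subrXX ler_wpM2l ?subr_ge0//.
apply: (@le_trans _ _ (\sum_(i < m) b ^+ m.-1)%R); last first.
  by rewrite sumr_const card_ord mulr_natl.
apply: ler_sum => i _; have b0 := le_trans a0 ab.
apply: (@le_trans _ _ (b ^+ (m.-1 - i) * b ^+ i)%R).
  rewrite ler_wpM2l ?exprn_ge0//.
  by apply: lerXn2r => //; rewrite nnegrE.
rewrite -exprD subnK//; case: m i => [[]//|m i] /=; rewrite -ltnS ltn_ord//.
Qed.

(** The part of an annulus of radius [r] within distance [s] of a point lies in
    a shell of thickness comparable to [s]: a function depending only on the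
    direction has mass of order [s] there, instead of the order [s ^+ n] that
    would hold for a bounded function. *)
Lemma integral_shell_box h (r s : R) (w : 'rV[R]_n) : homogeneous0 h ->
  ball_mass h < +oo -> (0 < r)%R -> (0 < s)%R ->
  \int[mu]_(y in shell r (2 * r) `&` box w s) h y <=
  (2 * n.+1%:R * s * (n%:R * (2 * r) ^+ n.-1))%:E * ball_mass h.
Proof.
move=> hh hoo r0 s0; have [mh h0 _] := hh.
have m0 : 0 <= ball_mass h by apply: integral_ge0.
pose a := (Num.max r (enorm w - n.+1%:R * s))%R.
pose b := (Num.min (2 * r) (enorm w + n.+1%:R * s))%R.
have sub : shell r (2 * r) `&` box w s `<=` shell a b.
  move=> y [/andP[y1 y2] /= yw]; rewrite /shell/= gt_max le_min y1 y2/=.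
  have ns : (n%:R * s < n.+1%:R * s)%R by rewrite ltr_pM2r// ltr_nat.
  have := enorm_le (ltW s0) yw => yws.
  have e1 : (enorm w <= enorm y + enorm (y - w))%R.
    rewrite -(enormN (y - w)) opprB.
    by have := enormD y (w - y); rewrite addrC subrK.
  have e2 : (enorm y <= enorm w + enorm (y - w))%R.
    by have := enormD w (y - w); rewrite addrC subrK.
  by apply/andP; split; lra.
apply: (@le_trans _ _ (\int[mu]_(y in shell a b) h y)).
  apply: ge0_subset_integral => //.
  - by apply: measurableI; [exact: measurable_shell|exact: measurable_box].
  - exact: measurable_shell.
  - exact: measurable_funTS.
have a0 : (0 < a)%R by rewrite /a lt_max r0.
case: (leP a b) => ab; last first.
  rewrite (_ : shell a b = set0) ?integral_set0.
    rewrite mule_ge0// lee_fin !mulr_ge0// ?(ltW s0)//.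
    by rewrite exprn_ge0// mulr_ge0// ltW.
  by rewrite -subset0 => y /andP[] /lt_le_trans/[apply]; rewrite ltNge (ltW ab).
rewrite integral_shell// lee_wpmul2r// lee_fin.
apply: (le_trans (powB_le _ (ltW a0) ab)).
have ba : (b - a <= 2 * n.+1%:R * s)%R.
  have : (enorm w - n.+1%:R * s <= a)%R by rewrite /a le_max lexx orbT.
  have : (b <= enorm w + n.+1%:R * s)%R by rewrite /b ge_min lexx orbT.
  by lra.
apply: ler_pM => //; first by rewrite subr_ge0.
  by rewrite mulr_ge0// exprn_ge0// (le_trans (ltW a0)).
rewrite ler_wpM2l//; apply: lerXn2r; rewrite ?nnegrE.
- by rewrite (le_trans (ltW a0)).
- by rewrite mulr_ge0// ltW.
- by rewrite /b ge_min lexx.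
Qed.

End homogeneous_functions_on_shells.

(** * Polar coordinates *)

Section spherical_functions.
Context {R : realType} {n : nat}.
Implicit Types (Om : 'rV[R]_n -> R) (h : 'rV[R]_n -> \bar R).
Local Notation mu := (@lebesgue_rV R n).
Local Open Scope ereal_scope.

Lemma le_exp_root (t e : R) : (0 < n)%N -> (0 < t)%R -> (0 < e)%R ->
  (t <= e ^- n)%R = (e <= t `^ (- n%:R^-1))%R.
Proof.
move=> n0 t0 e0; have q0 : (0 < t `^ n%:R^-1)%R by exact: powR_gt0.
rewrite powRN -[t in LHS](_ : ((t `^ n%:R^-1) ^+ n)%R = t); last first.
  by rewrite -powR_mulrn ?ltW// -powRrM mulVf ?pnatr_eq0 -?lt0n// powRr1// ltW.
rewrite -exprVn ler_pXn2r// ?nnegrE ?invr_ge0 ?(ltW e0) ?(ltW q0)//.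
by rewrite -[leLHS]invrK lef_pV2// posrE ?invr_gt0.
Qed.

(** The weight [enorm y ^- n] is a superposition of indicators of balls, so its
    integral against a function of the direction depends on that function only
    through its mass. *)
Lemma eq_integral_shell_weight h1 h2 (r s : R) : (0 < n)%N ->
  homogeneous0 h1 -> homogeneous0 h2 -> ball_mass h1 = ball_mass h2 ->
  ball_mass h1 < +oo -> (0 < r)%R ->
  \int[mu]_(y in shell r s) (h1 y * (enorm y ^- n)%:E) =
  \int[mu]_(y in shell r s) (h2 y * (enorm y ^- n)%:E).
Proof.
move=> n0 hh1 hh2 h12 hoo r0.
pose w (y : 'rV[R]_n) : R := (enorm y `^ (- n%:R))%R.
have mw : measurable_fun setT w.
  apply: (@measurableT_comp _ _ _ _ _ _ (@powR R ^~ (- n%:R)%R)) => //.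
  exact: measurable_enorm.
pose E : set ('rV[R]_n * measurableTypeR R) :=
  [set p | (0 < p.2)%R] `&` [set p | (p.2 <= w p.1)%R].
have mE : measurable E.
  apply: measurableI.
    have := @measurable_fun_ltr _ _ _ setT (cst 0%R)
      (fun p : 'rV[R]_n * measurableTypeR R => p.2 : R).
    move=> /(_ (measurable_cst _) (@measurable_snd _ _ _ _)).
    by move=> /(_ measurableT [set true] I); rewrite setTI.
  have := @measurable_fun_ler _ _ _ setT
    (fun p : 'rV[R]_n * measurableTypeR R => p.2 : R) (w \o fst).
  move=> /(_ (@measurable_snd _ _ _ _) (measurableT_comp mw (@measurable_fst _ _ _ _))).
  by move=> /(_ measurableT [set true] I); rewrite setTI.
have layer h : homogeneous0 h -> \int[mu]_(y in shell r s) (h y * (enorm y ^- n)%:E) =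
    \int[lebesgue_measure]_t \int[mu]_y ((h \_ (shell r s)) y * (\1_E (y, t))%:E).
  move=> [mh h0 _].
  pose f (p : 'rV[R]_n * measurableTypeR R) : \bar R :=
    (h \_ (shell r s)) p.1 * (\1_E p)%:E.
  have hs0 y : 0 <= (h \_ (shell r s)) y by apply: erestrict_ge0.
  have mhs : measurable_fun setT (h \_ (shell r s)).
    apply/(measurable_restrictT _ _).1; first exact: measurable_shell.
    exact: measurable_funTS.
  have mf : measurable_fun setT f.
    apply: emeasurable_funM.
      by apply: measurableT_comp => //; exact: measurable_fst.
    by apply/measurable_EFinP; exact: measurable_indic.
  have f0 p : 0 <= f p by rewrite /f mule_ge0// lee_fin.
  rewrite -(@fubini_tonelli _ _ _ _ _ mu lebesgue_measure f mf f0).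
  rewrite integral_mkcond; apply: eq_integral => y _.
  rewrite /f /= ge0_integralZl//; last first.
    apply/measurable_EFinP.
    exact: (measurable_fun_pair2 y (measurable_indic mE)).
  rewrite /patch; case: ifPn => ys; last by rewrite mul0e.
  congr (_ * _).
  have y0 : (0 < enorm y)%R.
    by move: ys; rewrite inE => /andP[+ _]; exact: lt_trans.
  rewrite (_ : (fun t => _) = EFin \o \1_(`]0%R, w y]%classic : set R)); last first.
    apply/funext => t /=; rewrite !indicE; congr (_%:R%:E); congr nat_of_bool.
    by apply/idP/idP; rewrite !inE /E/= in_itv/= => /andP.
  rewrite integral_indic// setIT.
  transitivity (lebesgue_measure (`]0%R, w y]%classic : set R)); last by [].
  rewrite lebesgue_measure_itv/= lte_fin powR_gt0// -EFinB subr0.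
  by rewrite /w powR_invn// enorm_ge0.
have Et (t : R) h : homogeneous0 h ->
  \int[mu]_y ((h \_ (shell r s)) y * (\1_E (y, t))%:E) =
  if (0 < t)%R then
    \int[mu]_(y in shell r (Num.min s (t `^ (- n%:R^-1))%R)) h y else 0.
  move=> [mh h0 _]; case: ifPn => t0; last first.
    rewrite [LHS](eq_integral (cst 0)) ?integral0// => y _.
    by rewrite indicE memNset ?mule0//= => -[/=]; rewrite (negbTE t0).
  rewrite [RHS]integral_mkcond; apply: eq_integral => y _.
  rewrite /patch; case: ifPn => ys; last first.
    rewrite mul0e memNset// => /andP[y1 y2].
    move/negP: ys; apply; rewrite inE /shell/= y1/=.
    by rewrite (le_trans y2)// ge_min lexx.
  move: ys; rewrite inE => /andP[y1 y2].
  have y0 : (0 < enorm y)%R by exact: lt_trans y1.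
  rewrite indicE.
  have -> : ((y, t) \in E) = (y \in shell r (Num.min s (t `^ (- n%:R^-1))%R))%R.
    have wt : (t <= w y)%R = (enorm y <= t `^ (- n%:R^-1))%R.
      by rewrite /w powR_invn ?enorm_ge0// le_exp_root.
    apply/idP/idP; rewrite !inE /E /shell/= wt y1/= le_min y2/=; first by case.
    by move=> ->.
  by case: ifPn; rewrite ?mule1 ?mule0.
rewrite (layer _ hh1) (layer _ hh2); apply: eq_integral => t _.
rewrite !Et//; case: ifPn => // t0.
set b := Num.min _ _; case: (leP r b) => rb.
  by rewrite !integral_shell -?h12.
rewrite (_ : shell r b = set0) ?integral_set0//.
by rewrite -subset0 => y /andP[] /lt_le_trans/[apply]; rewrite ltNge (ltW rb).
Qed.

(** [sphere_measure] is [n] times the image by [edir] of Lebesgue measure on the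
    punctured ball. *)
Lemma integral_sphere_measure (Phi : 'rV[R]_n -> \bar R) :
  measurable_fun setT Phi -> (forall y, 0 <= Phi y) ->
  \int[sphere_measure R n]_y Phi y =
  n%:R%:E * \int[mu]_(y in shell 0 1) Phi (edir y).
Proof.
move=> mPhi Phi0.
have mpb := measurable_punctured_ball (R := R) (n := n).
pose m0 := mrestr mu mpb.
pose m1 : {measure set 'rV[R]_n -> \bar R} :=
  measure_function_pushforward__canonical__measure_function_Measure m0
    (@measurable_edir R n).
rewrite (eq_measure_integral (mscale (n%:R%:nng)%R m1)) => [|//].
rewrite ge0_integral_mscale//=; congr (_ * _).
rewrite ge0_integral_pushforward//; last exact: measurable_edir.
rewrite preimage_setT.
have mPe : measurable_fun setT (Phi \o @edir R n).
  exact: measurableT_comp mPhi (@measurable_edir R n).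
rewrite -(setUv (shell 0 1)) ge0_integral_setU//=; last 3 first.
- by apply: measurableC; exact: measurable_shell.
- exact: measurable_funTS.
- by apply/disj_set2P; rewrite setICr.
rewrite [X in _ + X](_ : _ = 0) ?adde0.
  apply: eq_measure_integral => A mA AS.
  by change (mu (A `&` shell 0 1) = mu A); rewrite setIidl.
rewrite (eq_measure_integral mzero) ?integral_measure_zero// => A mA AS.
rewrite /mzero -[RHS](measure0 mu).
change (mu (A `&` shell 0 1) = mu set0); congr (mu _).
by rewrite -subset0 => y [/AS].
Qed.

(** [edir] sends the origin to itself, off the sphere: the restriction to the
    sphere gives the extension the value [0] there. *)
Definition radial_extension Om (y : 'rV[R]_n) : R :=
  (Om \_ (sphere R n)) (edir y).

Lemma measurable_radial_extension Om : measurable_fun (sphere R n) Om ->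
  measurable_fun setT (radial_extension Om).
Proof.
move=> mOm; apply: measurableT_comp (@measurable_edir R n).
by apply/(measurable_restrictT _ _).1 => //; exact: measurable_sphere.
Qed.

Lemma radial_extensionE Om y : (0 < enorm y)%R ->
  radial_extension Om y = Om (edir y).
Proof.
by move=> y0; rewrite /radial_extension patchE mem_set//; exact: enorm_edir.
Qed.

Lemma homogeneous0_radial_extension Om (phi : R -> R) :
  measurable_fun (sphere R n) Om -> measurable_fun setT phi ->
  (forall x, 0 <= phi x)%R ->
  homogeneous0 (fun y => (phi (radial_extension Om y))%:E).
Proof.
move=> mOm mphi phi0; split=> [|y|s y s0].
- apply/measurable_EFinP; apply: measurableT_comp => //.
  exact: measurable_radial_extension.
- by rewrite lee_fin.
- by rewrite /radial_extension edirZ.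
Qed.

Lemma integral_sphere Om (phi : R -> R) :
  measurable_fun (sphere R n) Om -> measurable_fun setT phi ->
  (forall x, 0 <= phi x)%R ->
  \int[sphere_measure R n]_y (phi ((Om \_ (sphere R n)) y))%:E =
  n%:R%:E * ball_mass (fun y => (phi (radial_extension Om y))%:E).
Proof.
move=> mOm mphi phi0; apply: integral_sphere_measure => [|y].
  apply/measurable_EFinP; apply: measurableT_comp => //.
  by apply/(measurable_restrictT _ _).1 => //; exact: measurable_sphere.
by rewrite lee_fin.
Qed.

End spherical_functions.

(** * Continuously differentiable functions *)

Section functions_on_rV.
Context {R : realType} {n : nat}.
Implicit Types (g f : 'rV[R]_n -> R) (x y h : 'rV[R]_n).

Lemma continuous_rV_eps g x (e : R) : continuous g -> 0 < e ->
  exists2 d : R, 0 < d &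
    forall y, (forall i, `|(y - x) ord0 i| < d) -> `|g y - g x| < e.
Proof.
move=> cg e0; have /cvgrPdist_lt/(_ _ e0) := cg x.
move=> /nbhs_ballP[d /= d0 hd]; exists d => // y yx.
rewrite distrC; apply: hd; split => // i j.
by rewrite (ord1 i) /ball/= distrC; have := yx j; rewrite !mxE.
Qed.

Lemma cvg_rV_seq g x (u : nat -> 'rV[R]_n) (d : nat -> R) : continuous g ->
  (forall k i, `|(u k - x) ord0 i| <= d k) -> d k @[k --> \oo] --> 0 ->
  g (u k) @[k --> \oo] --> g x.
Proof.
move=> cg ud d0; apply/cvgrPdist_lt => e e0.
have [r r0 hr] := continuous_rV_eps x cg e0.
move/cvgrPdist_lt : d0 => /(_ _ r0) d0; near=> k.
rewrite distrC; apply: hr => i; apply: le_lt_trans (ud k i) _.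
have : `|0 - d k| < r by near: k.
by rewrite sub0r normrN; apply: le_lt_trans; exact: ler_norm.
Unshelve. all: by end_near. Qed.

(** A continuous function is the limit of its values at the corners of the
    dyadic cubes of side [2 ^- k], which form a countable partition. *)
Lemma continuous_measurable_rV g : continuous g -> measurable_fun setT g.
Proof.
move=> cg.
pose c k (m : 'rV[int]_n) : 'rV[R]_n := (2 ^- k) *: map_mx intr m.
pose m k x : 'rV[int]_n := \row_i Num.floor (2 ^+ k * x ord0 i).
have mx_cube k x : cube (c k (m k x), 2 ^- k) x.
  move=> i; rewrite /= !mxE.
  have k0 : 0 < (2 : R) ^+ k by rewrite exprn_gt0.
  rewrite -[X in _ < _ + X]mulr1 -mulrDr ler_pdivrMl// ltr_pdivlMl//.
  by have := real_floor_itv (num_real (2 ^+ k * x ord0 i)); rewrite intrD.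
have cube_m k x j : cube (c k j, 2 ^- k) x -> m k x = j.
  move=> xj; apply/rowP => i; rewrite mxE; have := xj i; rewrite /= !mxE.
  have k0 : 0 < (2 : R) ^+ k by rewrite exprn_gt0.
  rewrite -[X in _ < _ + X]mulr1 -mulrDr ler_pdivrMl// ltr_pdivlMl// => hj.
  by apply/floor_def; rewrite intrD.
apply: (@measurable_fun_cvg _ _ _ _ (fun k x => g (c k (m k x)))) => [k|x _].
  move=> _ Y mY; rewrite setTI.
  rewrite (_ : _ @^-1` Y = \bigcup_(j in [set j | Y (g (c k j))]) cube (c k j, 2 ^- k)).
    rewrite bigcup_mkcond; apply: countable_bigcupT_measurable => [|j].
      exact: countableP.
    by case: ifPn => // _; exact: measurable_cube.
  apply/seteqP; split=> [x Yx|x [j /= Yj /cube_m xj]]; last by rewrite /= xj.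
  by exists (m k x) => //.
apply: (@cvg_rV_seq g x (fun k => c k (m k x)) (fun k => 2 ^- k)) => //.
  move=> k i; have := mx_cube k x i; rewrite /= !mxE => /andP[h1 h2].
  by rewrite distrC ger0_norm ?subr_ge0// lerBlDl ltW.
rewrite (_ : (fun k => 2 ^- k) = (fun k => (2^-1) ^+ k)).
  by apply: cvg_expr; rewrite ger0_norm ?invr_ge0// invf_lt1 ?ltr1n.
by apply/funext => k; rewrite exprVn.
Qed.

Lemma is_derive_line f x h (s : R) : derivable f (x + s *: h) h ->
  is_derive s 1 (fun t => f (x + t *: h)) ('D_h f (x + s *: h)).
Proof.
have e : (fun e => e^-1 *: (((fun t => f (x + t *: h)) \o shift s) (e *: 1) -
      f (x + s *: h))) =
    (fun e => e^-1 *: ((f \o shift (x + s *: h)) (e *: h) - f (x + s *: h))).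
  apply/funext => t /=; congr (_ *: (f _ - _)).
  by rewrite [X in (X + s) *: _]mulr1 scalerDl addrCA.
by move=> df; apply: DeriveDef; rewrite /derivable /derive e.
Qed.

Lemma mvt_line f x h (t : R) : (forall y, derivable f y h) ->
  exists2 s, `|s| <= `|t| & f (x + t *: h) - f x = t * 'D_h f (x + s *: h).
Proof.
move=> df; pose phi t := f (x + t *: h).
have dphi (s : R) : is_derive s 1 phi ('D_h f (x + s *: h)) by exact: is_derive_line.
have cphi : continuous phi.
  move=> s; apply/differentiable_continuous/derivable1_diffP.
  by have [] := dphi s.
have phi0 : phi 0 = f x by rewrite /phi scale0r addr0.
case: (leP 0 t) => t0.
  have [s] := MVT_segment t0 (fun s _ => dphi s) (continuous_subspaceT cphi).
  rewrite in_itv/= phi0 subr0 => /andP[s0 st] e; exists s.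
    by rewrite !ger0_norm.
  by rewrite -[f _]/(phi t) e mulrC.
have [s] := MVT_segment (ltW t0) (fun s _ => dphi s) (continuous_subspaceT cphi).
rewrite in_itv/= phi0 sub0r => /andP[st s0] e; exists s.
  by rewrite ler0_norm// ltr0_norm// lerN2.
by rewrite -[f _]/(phi t) -opprB e mulrN opprK mulrC.
Qed.

Definition continuously_differentiable f :=
  (forall i x, derivable f x (delta_mx ord0 i)) /\
  (forall i, continuous (partial i f)).

(** The increment is telescoped along a path that changes one coordinate at a
    time; the mean value theorem applies to each step, and the continuity of the
    partial derivatives to the sum. *)
Lemma is_derive_gradient f x h : continuously_differentiable f ->
  is_derive x h f (\sum_i h ord0 i * partial i f x).
Proof.
move=> [df cf].
pose p (e : R) (k : nat) : 'rV[R]_n :=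
  x + e *: \row_i (if (i < k)%N then h ord0 i else 0).
have p0 e : p e 0%N = x.
  rewrite /p (_ : \row_i _ = 0) ?scaler0 ?addr0//.
  by apply/rowP => i; rewrite !mxE.
have pn e : p e n = x + e *: h.
  by congr (_ + _ *: _); apply/rowP => i; rewrite !mxE ltn_ord.
have pS e (i : 'I_n) : p e i.+1 = p e i + (e * h ord0 i) *: delta_mx ord0 i.
  rewrite /p -addrA; congr (_ + _); apply/rowP => j; rewrite !mxE/= ltnS.
  rewrite -val_eqE/=; case: ltngtP => ji; rewrite ?mulr0 ?addr0 ?add0r//.
  by rewrite mulr1 (val_inj ji).
have lim : e^-1 *: ((f \o shift x) (e *: h) - f x) @[e --> 0^'] -->
    \sum_i h ord0 i * partial i f x.
  apply/cvgrPdist_le => eps eps0.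
  pose D := n.+1%:R * (enorm h + 1).
  have D0 : 0 < D by rewrite mulr_gt0// ltr_wpDl// enorm_ge0.
  have H i : exists di : R, 0 < di /\ forall y,
      (forall j, `|(y - x) ord0 j| < di) ->
      `|partial i f y - partial i f x| < eps / D.
    have [di di0 hdi] := continuous_rV_eps x (cf i) (divr_gt0 eps0 D0).
    by exists di.
  have [d hd] := choice H.
  near=> e.
  have e0 : e != 0 by near: e; exact: nbhs_dnbhs_neq.
  have ed i : `|e| * (enorm h + 1) < d i.
    rewrite -ltr_pdivlMr ?ltr_wpDl ?enorm_ge0//; move: i; near: e.
    apply: filter_forall => i; apply: dnbhs0_lt.
    by rewrite divr_gt0 ?(hd i).1// ltr_wpDl ?enorm_ge0.
  have -> : (f \o shift x) (e *: h) - f x =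
      \sum_(i < n) (f (p e i.+1) - f (p e i)).
    rewrite -(big_mkord xpredT (fun i => f (p e i.+1) - f (p e i))).
    by rewrite telescope_sumr// p0 pn /= [e *: h + x]addrC.
  rewrite scaler_sumr -sumrB.
  apply: le_trans (ler_norm_sum _ _ _) _.
  apply: (@le_trans _ _ (\sum_(i < n) (eps / n.+1%:R))); last first.
    rewrite sumr_const card_ord -[leLHS]mulr_natl mulrCA.
    by rewrite ger_pMr// ler_pdivrMr// mul1r ler_nat.
  apply: ler_sum => i _.
  rewrite pS; have [s sle ->] := mvt_line (p e i) (e * h ord0 i) (df i).
  rewrite [_ *: (_ * _)]mulrA mulKf// -mulrBr normrM distrC.
  have hh1 j : `|h ord0 j| <= enorm h + 1.
    by rewrite (le_trans (coord_le_enorm h j))// lerDl.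
  have /(hd i).2/ltW hs : forall j, `|(p e i + s *: delta_mx ord0 i - x) ord0 j| < d i.
    move=> j; apply: le_lt_trans (ed i).
    rewrite /p !mxE/= addrAC [x ord0 j + _]addrC addrK.
    rewrite -val_eqE/=; case: ltngtP => ji; rewrite ?mulr0 ?addr0 ?add0r ?mulr1.
    - by rewrite normrM ler_wpM2l.
    - by rewrite normr0 mulr_ge0// addr_ge0// enorm_ge0.
    - by rewrite (le_trans sle)// normrM ler_wpM2l.
  apply: le_trans (ler_wpM2l _ hs) _ => //.
  have -> : eps / D = eps / n.+1%:R * (enorm h + 1)^-1 by rewrite /D invfM mulrA.
  rewrite mulrCA ger_pMr ?divr_gt0//.
  by rewrite ler_pdivrMr ?mul1r ?hh1// ltr_wpDl ?enorm_ge0.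
by apply: DeriveDef; [apply/cvg_ex; eexists; exact: lim|exact: cvg_lim].
Unshelve. all: by end_near.
Qed.

Lemma cvg_sumr (T : Type) (F : set_system T) (u : 'I_n -> T -> R)
    (l : 'I_n -> R) : Filter F -> (forall i, u i @ F --> l i) ->
  \sum_i u i z @[z --> F] --> \sum_i l i.
Proof.
by move=> FF ul; apply: cvg_big => //; exact: add_continuous.
Qed.

Lemma continuous_enorm_gradient f : continuously_differentiable f ->
  continuous (fun x => enorm (gradient f x)).
Proof.
move=> [_ cf] x; rewrite /enorm.
have c : (\sum_i gradient f z ord0 i ^+ 2) @[z --> x] -->
    \sum_i gradient f x ord0 i ^+ 2.
  apply: (@cvg_sumr _ (nbhs x) (fun i z => gradient f z ord0 i ^+ 2)) => i.
  rewrite (_ : (fun z => _) = (fun z => partial i f z ^+ 2)); last first.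
    by apply/funext => z; rewrite mxE.
  rewrite mxE; apply: (@continuous_cvg _ _ _ _ _ (partial i f) (fun t => t ^+ 2)); last exact: cf.
  exact: exprn_continuous.
by apply: continuous_cvg c; exact: sqrt_continuous.
Qed.

(** Parametrising the segment by [u ^+ n] instead of [u] gives the derivative
    the factor [u ^+ n.-1], which is exactly what absorbs the singularity at
    [u = 0] of the estimate of the averages of the gradient. *)
Lemma le_integral_gradient f y h : (0 < n)%N -> continuously_differentiable f ->
  (`|f (y + h) - f y|%:E <= \int[lebesgue_measure]_(u in `[0%R, 1%R])
    (n%:R * u ^+ n.-1 * (enorm h * enorm (gradient f (y + u ^+ n *: h))))%R%:E)%E.
Proof.
move=> n0 df; have cG := continuous_enorm_gradient df.
pose psi t := f (y + t *: h).
pose dpsi t := \sum_i h ord0 i * partial i f (y + t *: h).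
have dpsiP (t : R) : is_derive t 1 psi (dpsi t).
  have [e1 e2] := is_derive_gradient (y + t *: h) h df.
  by rewrite /dpsi -e2; exact: is_derive_line.
have cline : continuous (fun u : R => y + u ^+ n *: h).
  move=> u; apply: cvgD; first exact: cvg_cst.
  by apply: cvgZr_tmp; exact: exprn_continuous.
pose phi u := psi (u ^+ n).
pose dphi (u : R) := dpsi (u ^+ n) * (n%:R * u ^+ n.-1).
have phiP (u : R) : is_derive u 1 phi (dphi u).
  apply: is_derive1_comp => //.
  apply: DeriveDef; first exact: exprn_derivable.
  by rewrite exp_derive /GRing.scale/= mulr1.
have cphi : continuous phi.
  move=> u; apply/differentiable_continuous/derivable1_diffP.
  by have [] := phiP u.
have cdphi : continuous dphi.
  move=> u; apply: cvgM.
    apply: (@cvg_sumr _ (nbhs u)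
      (fun i z => h ord0 i * partial i f (y + z ^+ n *: h))) => i.
    apply: cvgMl_tmp.
    apply: (@continuous_cvg _ _ _ _ _ (fun u : R => y + u ^+ n *: h) (partial i f)).
      exact: df.2.
    exact: cline.
  by apply: cvgMl_tmp; exact: exprn_continuous.
have := @continuous_FTC2 R dphi phi 0 1 ltr01 (continuous_subspaceT cdphi).
move=> H; have {H} : (\int[lebesgue_measure]_(u in `[0%R, 1%R]) (dphi u)%:E =
    (phi 1)%:E - (phi 0)%:E)%E.
  apply: H.
    split.
    - by move=> u _; have [] := phiP u.
    - by apply: cvg_at_right_filter; exact: cphi.
    - by apply: cvg_at_left_filter; exact: cphi.
  by move=> u _; rewrite derive1E; have [] := phiP u.
rewrite /phi /psi expr1n expr0n gtn_eqF//= scale1r scale0r addr0 => e.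
have mdphi : measurable_fun setT dphi by exact: continuous_measurable_fun.
rewrite -[X in (X <= _)%E]/(`|(f (y + h) - f y)%:E|)%E EFinB -e.
apply: le_trans (le_abse_integral _ _ _) _ => //.
  by apply/measurable_EFinP; exact: measurable_funTS.
apply: ge0_le_integral => //.
- apply/measurable_EFinP; apply: measurableT_comp => //; exact: measurable_funTS.
- apply/measurable_EFinP; apply: measurable_funTS.
  apply: continuous_measurable_fun => u; apply: cvgM.
    by apply: cvgMl_tmp; exact: exprn_continuous.
  apply: cvgMl_tmp.
  exact: (continuous_comp (cline u) (cG _)).
- move=> u; rewrite /= in_itv => /andP[u0 _].
  rewrite lee_fin /dphi normrM mulrC ger0_norm ?mulr_ge0 ?exprn_ge0//.
  rewrite ler_wpM2l ?mulr_ge0 ?exprn_ge0//.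
  rewrite /dpsi (eq_bigr (fun i => h ord0 i * gradient f (y + u ^+ n *: h) ord0 i)).
    exact: cauchy_schwarz.
  by move=> i _; rewrite mxE.
Qed.

End functions_on_rV.

(** * Hoelder's inequality with three factors *)

Section hoelder_three_factors.
Context {R : realType}.

(** The concave function [ln] lies below its tangent at the left-hand side; the
    weights [a], [b], [c], [e] average this inequality over the points [x], [y],
    [z] and [1]. *)
Lemma weighted_amgm (x y z a b c e : R) : 0 <= x -> 0 <= y -> 0 <= z ->
  0 < a -> 0 < b -> 0 < c -> 0 <= e -> a + b + c + e = 1 ->
  x `^ a * y `^ b * z `^ c <= a * x + b * y + c * z + e.
Proof.
move=> x0 y0 z0 a0 b0 c0 e0 abce.
have rhs0 : 0 <= a * x + b * y + c * z + e.
  by rewrite !addr_ge0// mulr_ge0// ltW.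
have [xE|xn0] := eqVneq x 0; first by rewrite {1}xE powR0 ?gt_eqF// !mul0r.
have [yE|yn0] := eqVneq y 0; first by rewrite {1}yE powR0 ?gt_eqF// mulr0 mul0r.
have [zE|zn0] := eqVneq z 0; first by rewrite {1}zE powR0 ?gt_eqF// mulr0.
have {xn0}x0 : 0 < x by rewrite lt_neqAle eq_sym xn0.
have {yn0}y0 : 0 < y by rewrite lt_neqAle eq_sym yn0.
have {zn0}z0 : 0 < z by rewrite lt_neqAle eq_sym zn0.
set P := _ * z `^ c.
have P0 : 0 < P by rewrite !mulr_gt0// powR_gt0.
have lnP : ln P = a * ln x + b * ln y + c * ln z.
  by rewrite /P !lnM ?posrE ?mulr_gt0 ?powR_gt0// !ln_powR.
have tangent t : 0 < t -> ln t - ln P <= t / P - 1.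
  move=> t0; rewrite -ln_div ?posrE//.
  have := @le_ln1Dx _ (t / P - 1); rewrite [1 + _]addrC subrK; apply.
  by rewrite ltrBrDl subrr divr_gt0.
have ix := ler_wpM2l (ltW a0) (tangent _ x0).
have iy := ler_wpM2l (ltW b0) (tangent _ y0).
have iz := ler_wpM2l (ltW c0) (tangent _ z0).
have i1 := ler_wpM2l e0 (tangent _ ltr01).
have : 1 <= (a * x + b * y + c * z + e) / P.
  rewrite ln1 in i1.
  have -> : (a * x + b * y + c * z + e) / P =
    a * (x / P) + b * (y / P) + c * (z / P) + e * (1 / P) by field; rewrite gt_eqF.
  set lP := ln P in lnP ix iy iz i1 *.
  have l1 : lP = lP * (a + b + c + e) by rewrite abce mulr1.
  nra.
by rewrite ler_pdivlMr// mul1r.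
Qed.

(** The part [e] of the exponents that is missing to reach [1] is given to the
    indicator of [D], of integral at most [M]. *)
Lemma hoelder3 d (T : measurableType d) (mu : {measure set T -> \bar R})
  (D : set T) (f g h : T -> R) (A B C M a b c e : R) :
  measurable D -> (mu D <= M%:E)%E -> 0 < M ->
  measurable_fun setT f -> measurable_fun setT g -> measurable_fun setT h ->
  (forall x, 0 <= f x) -> (forall x, 0 <= g x) -> (forall x, 0 <= h x) ->
  (forall x, ~ D x -> f x = 0) ->
  (\int[mu]_x (f x)%:E <= A%:E)%E -> (\int[mu]_x (g x)%:E <= B%:E)%E ->
  (\int[mu]_x (h x)%:E <= C%:E)%E ->
  0 < a -> 0 < b -> 0 < c -> 0 <= e -> a + b + c + e = 1 ->
  (\int[mu]_x (f x `^ a * g x `^ b * h x `^ c)%:E <=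
    (A `^ a * B `^ b * C `^ c * M `^ e)%:E)%E.
Proof.
move=> mD DM M0 mf mg mh f0 g0 h0 fD fA gB hC a0 b0 c0 e0 abce.
have mpow (u : T -> R) s : measurable_fun setT u ->
    measurable_fun setT (fun x => u x `^ s).
  move=> mu_; exact: (@measurableT_comp _ _ _ _ _ _ (@powR R ^~ s)).
have mF : measurable_fun setT (fun x => f x `^ a * g x `^ b * h x `^ c).
  by apply: measurable_funM; [apply: measurable_funM|]; exact: mpow.
have F0 x : 0 <= f x `^ a * g x `^ b * h x `^ c by rewrite !mulr_ge0 ?powR_ge0.
(* The pointwise inequality divides by the three bounds. If one of them vanishes,
   so does the integrand, almost everywhere. *)
have zero (u : T -> R) (U s : R) : measurable_fun setT u -> (forall x, 0 <= u x) ->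
    (\int[mu]_x (u x)%:E <= U%:E)%E -> (forall x, u x = 0 -> f x `^ a * g x `^ b * h x `^ c = 0) ->
    U <= 0 -> (\int[mu]_x (f x `^ a * g x `^ b * h x `^ c)%:E = 0)%E.
  move=> mu_ u0 uU uF U0.
  have e0' : (\int[mu]_x `|(u x)%:E| = 0)%E.
    apply/eqP; rewrite eq_le integral_ge0// andbT.
    under eq_integral do rewrite gee0_abs ?lee_fin//.
    by apply: le_trans uU _; rewrite lee_fin.
  have mEu : measurable_fun setT (EFin \o u) by exact/measurable_EFinP.
  have := (ae_eq_integral_abs mu measurableT mEu).1 e0'.
  move=> uae.
  rewrite -[RHS](integral0 mu setT); apply: ae_eq_integral => //.
    exact/measurable_EFinP.
  apply: filterS uae => x /(_ I) [ux] _; congr _%:E; exact: uF.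
have U0 (u : T -> R) U : (forall x, 0 <= u x) -> (\int[mu]_x (u x)%:E <= U%:E)%E -> 0 <= U.
  by move=> u0 /(le_trans (integral_ge0 _ _)) h1; rewrite -lee_fin; apply: h1 => x _; rewrite lee_fin.
have R0 : 0 <= A `^ a * B `^ b * C `^ c * M `^ e by rewrite !mulr_ge0 ?powR_ge0.
case: (leP A 0) => [A0|A0].
  by rewrite (zero f A a) ?lee_fin// => x ->; rewrite powR0 ?gt_eqF// !mul0r.
case: (leP B 0) => [B0|B0].
  by rewrite (zero g B b) ?lee_fin// => x ->; rewrite powR0 ?gt_eqF// mulr0 mul0r.
case: (leP C 0) => [C0|C0].
  by rewrite (zero h C c) ?lee_fin// => x ->; rewrite powR0 ?gt_eqF// mulr0.
pose K := A `^ a * B `^ b * C `^ c * M `^ (e - 1).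
have K0 : 0 <= K by rewrite !mulr_ge0 ?powR_ge0.
pose phi x := K * (a * (M / A) * f x + b * (M / B) * g x + c * (M / C) * h x +
   e * \1_D x).
have powD (u s t : R) : 0 < u -> u `^ (s + t) = u `^ s * u `^ t.
  by move=> u0; rewrite powRD// (gt_eqF u0) implybT.
have Fphi x : f x `^ a * g x `^ b * h x `^ c <= phi x.
  have [Dx|/fD fx0] := pselect (D x); last first.
    rewrite fx0 powR0 ?gt_eqF// !mul0r mulr_ge0// !addr_ge0// !mulr_ge0//;
    by rewrite ?invr_ge0 ?ler0n ?f0 ?g0 ?h0 ?ltW.
  have := @weighted_amgm (M / A * f x) (M / B * g x) (M / C * h x) a b c e.
  rewrite !mulr_ge0 ?invr_ge0 ?(ltW M0) ?(ltW A0) ?(ltW B0) ?(ltW C0)//.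
  move=> /(_ isT isT isT a0 b0 c0 e0 abce) /(ler_wpM2l K0).
  rewrite /phi indicE mem_set//= mulr1 !mulrA; apply: le_trans.
  rewrite !powRM ?mulr_ge0 ?invr_ge0 ?(ltW M0) ?(ltW A0) ?(ltW B0) ?(ltW C0)//.
  rewrite -!powR_inv1 ?(ltW M0) ?(ltW A0) ?(ltW B0) ?(ltW C0)//.
  rewrite -!powRrM !mulN1r /K.
  have eM : M `^ (e - 1) * M `^ a * M `^ b * M `^ c = 1.
    rewrite -!powD// (_ : e - 1 + a + b + c = 0) ?powRr0//.
    by move: abce; lra.
  have eA (s t : R) : 0 < s -> s `^ t * s `^ (- t) = 1.
    by move=> s0; rewrite -powD// subrr powRr0.
  move: eM (eA A a A0) (eA B b B0) (eA C c C0).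
  set x1 := A `^ a; set x2 := B `^ b; set x3 := C `^ c; set x4 := M `^ (e - 1).
  set x5 := M `^ a; set x6 := M `^ b; set x7 := M `^ c.
  set y1 := A `^ _; set y2 := B `^ _; set y3 := C `^ _.
  set z1 := f x `^ a; set z2 := g x `^ b; set z3 := h x `^ c => eM e1 e2 e3.
  suff -> : x1 * x2 * x3 * x4 * (x5 * y1 * z1) * (x6 * y2 * z2) * (x7 * y3 * z3) =
    (x4 * x5 * x6 * x7) * (x1 * y1) * (x2 * y2) * (x3 * y3) * (z1 * z2 * z3).
    by rewrite eM e1 e2 e3 !mul1r.
  by ring.
have meas s (u : T -> R) : measurable_fun setT u ->
    measurable_fun setT (fun x => (s * u x)%:E).
  move=> mu_; apply/measurable_EFinP; exact: measurable_funM.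
have scale s (u : T -> R) (U : R) : measurable_fun setT u -> (forall x, 0 <= u x) ->
    0 <= s -> (\int[mu]_x (u x)%:E <= U%:E)%E ->
    (\int[mu]_x (s * u x)%:E <= (s * U)%:E)%E.
  move=> mu_ u0 s0 uU; under eq_integral do rewrite EFinM.
  rewrite ge0_integralZl_EFin//=; last exact/measurable_EFinP.
    by rewrite EFinM lee_wpmul2l// lee_fin.
  by move=> x _; rewrite lee_fin.
apply: (@le_trans _ _ (\int[mu]_x (phi x)%:E)%E).
  apply: ge0_le_integral => //.
  - by move=> x _; rewrite lee_fin.
  - exact/measurable_EFinP.
  - apply: meas; repeat apply: measurable_funD; repeat apply: measurable_funM => //.
  - by move=> x _; rewrite lee_fin.
have pos1 : 0 <= a * (M / A) by rewrite mulr_ge0 ?divr_ge0 ?ltW.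
have pos2 : 0 <= b * (M / B) by rewrite mulr_ge0 ?divr_ge0 ?ltW.
have pos3 : 0 <= c * (M / C) by rewrite mulr_ge0 ?divr_ge0 ?ltW.
have M0' := ltW M0.
have -> : A `^ a * B `^ b * C `^ c * M `^ e =
    K * (a * (M / A) * A + b * (M / B) * B + c * (M / C) * C + e * M).
  rewrite (_ : a * (M / A) * A + b * (M / B) * B + c * (M / C) * C + e * M = M); last first.
    rewrite -!mulrA !mulVf ?gt_eqF// !mulr1 -!mulrDl.
    by rewrite abce mul1r.
  rewrite /K -!mulrA -[in X in _ = _ * (_ * (_ * (_ * X)))](powRr1 M0') -powD//.
  by rewrite subrK.
have mD1 : measurable_fun setT (\1_D : T -> R) by exact: measurable_indic.
apply: (scale) => //.
- repeat apply: measurable_funD; repeat apply: measurable_funM => //.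
- move=> x; do 3 (apply: addr_ge0; last exact: mulr_ge0).
  exact: mulr_ge0.
have ge0E s (u : T -> R) : 0 <= s -> (forall x, 0 <= u x) ->
    forall x, setT x -> (0 <= (s * u x)%:E)%E.
  by move=> s0 u0 x _; rewrite lee_fin mulr_ge0.
under eq_integral do rewrite !EFinD.
have mf' := meas (a * (M / A)) f mf; have f0' := ge0E _ _ pos1 f0.
have mg' := meas (b * (M / B)) g mg; have g0' := ge0E _ _ pos2 g0.
have mh' := meas (c * (M / C)) h mh; have h0' := ge0E _ _ pos3 h0.
have mD' := meas e _ mD1.
have D0' : forall x, setT x -> (0 <= (e * \1_D x)%:E)%E.
  by apply: (ge0E) => // x; rewrite indicE.
rewrite !EFinD ge0_integralD//; last 2 first.
- by move=> x _; rewrite !adde_ge0 ?f0' ?g0' ?h0'.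
- by apply: emeasurable_funD => //; exact: emeasurable_funD.
rewrite ge0_integralD//; last 2 first.
- by move=> x _; rewrite adde_ge0 ?f0' ?g0'.
- exact: emeasurable_funD.
rewrite ge0_integralD//.
apply: leeD; last first.
  apply: (scale) => //.
  by rewrite integral_indic// setIT.
by apply: leeD; [apply: leeD|]; apply: (scale).
Qed.

End hoelder_three_factors.

Section exponents.
Context {R : realType}.

Let powD (u s1 s2 : R) : s1 + s2 != 0 -> u `^ (s1 + s2) = u `^ s1 * u `^ s2.
Proof. by move=> s12; rewrite powRD// (negbTE s12). Qed.

(** How an integrand [x * y] is distributed over the three factors [x ^ rho],
    [y ^ p] and their product. *)
Lemma powR_split3 (x y rho p a b c : R) : 0 <= x -> 0 <= y ->
  rho != 0 -> p != 0 -> a + c = rho^-1 -> b + c = p^-1 ->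
  (x `^ rho) `^ a * (y `^ p) `^ b * (x `^ rho * y `^ p) `^ c = x * y.
Proof.
move=> x0 y0 rho0 p0 ac bc; rewrite powRM ?powR_ge0// mulrACA.
have e1 : (x `^ rho) `^ a * (x `^ rho) `^ c = x.
  by rewrite -powD ac ?invr_neq0// -powRrM mulfV// powRr1.
have e2 : (y `^ p) `^ b * (y `^ p) `^ c = y.
  by rewrite -powD bc ?invr_neq0// -powRrM mulfV// powRr1.
by congr (_ * _); [exact: e1|exact: e2].
Qed.

(** The powers of [N] and of [V], which bound the factors [x ^ rho] and [y ^ p],
    recombine in the same way on the other side of Hoelder's inequality; those of
    the volume [W] have the total exponent [1 + (a + e) = 2 - p^-1]. *)
Lemma hoelder3_boundE (W N V k s rho p a b c e : R) :
  0 < W -> 0 <= N -> 0 <= V -> 0 <= k -> 0 <= s ->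
  rho != 0 -> p != 0 -> a + c = rho^-1 -> b + c = p^-1 -> a + b + c + e = 1 ->
  (W * W * N `^ rho) `^ a * (W * V) `^ b *
    (s * (k * W) * V * N `^ rho) `^ c * (W * W) `^ e =
  N * V `^ p^-1 * k `^ c * s `^ c * W `^ (2 - p^-1).
Proof.
move=> W0 N0 V0 k0 s0 rho0 p0 ac bc abce.
have W0' := ltW W0; have Nr0 : 0 <= N `^ rho by exact: powR_ge0.
rewrite !powRM ?mulr_ge0//.
have NE : (N `^ rho) `^ a * (N `^ rho) `^ c = N.
  by rewrite -powD ac ?invr_neq0// -powRrM mulfV// powRr1.
have VE : V `^ b * V `^ c = V `^ p^-1 by rewrite -powD bc// invr_neq0.
have WE : W `^ a * W `^ a * W `^ b * W `^ c * (W `^ e * W `^ e) = W `^ (2 - p^-1).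
  have powDW s1 s2 : W `^ (s1 + s2) = W `^ s1 * W `^ s2.
    by rewrite powRD// (gt_eqF W0) implybT.
  rewrite -!powDW; congr (_ `^ _).
  by rewrite -bc (_ : e = 1 - a - b - c); [ring|rewrite -abce; ring].
rewrite -[in RHS]NE -VE -WE.
set w1 := W `^ a; set w2 := W `^ b; set w3 := W `^ c; set w4 := W `^ e.
set v1 := V `^ b; set v2 := V `^ c; set u1 := (N `^ rho) `^ a.
set u2 := (N `^ rho) `^ c; set tt := s `^ c; set kk := k `^ c.
ring.
Qed.

End exponents.

(** * Averages of the gradient along segments *)

Section averaging_estimate.
Context {R : realType} {n : nat}.
Local Notation mu := (@lebesgue_rV R n).

Definition ccube (s : R) : set 'rV[R]_n := cube (const_mx (- s), 2 * s).

Lemma ccubeP s (x : 'rV[R]_n) : ccube s x <-> forall i, - s <= x ord0 i < s.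
Proof.
have e : - s + 2 * s = s by ring.
by split=> h i; have := h i; rewrite /= mxE e.
Qed.

Lemma lebesgue_ccube s : 0 < s -> mu (ccube s) = ((2 * s) ^+ n)%:E.
Proof. by move=> s0; rewrite lebesgue_rV_cube// mulr_gt0. Qed.

Lemma measurable_lincomb (t : R) : measurable_fun setT
  (fun q : 'rV[R]_n * 'rV[R]_n => q.1 + t *: q.2).
Proof.
apply/measurable_fun_rVP => i.
rewrite (_ : (fun _ => _) =
    (fun q : 'rV[R]_n * 'rV[R]_n => q.1 ord0 i + t * q.2 ord0 i)); last first.
  by apply/funext => q; rewrite !mxE.
apply: measurable_funD.
  exact: (measurableT_comp (measurable_coord i) measurable_fst).
apply: measurable_funM; first exact: measurable_cst.
exact: (measurableT_comp (measurable_coord i) measurable_snd).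
Qed.

Lemma ge0_integralM (u : 'rV[R]_n -> R) (k : R) : measurable_fun setT u ->
  (forall x, 0 <= u x) -> 0 <= k ->
  (\int[mu]_x (k * u x)%:E = k%:E * \int[mu]_x (u x)%:E)%E.
Proof.
move=> mu_ u0 k0; under eq_integral do rewrite EFinM.
rewrite ge0_integralZl_EFin//; last exact/measurable_EFinP.
by move=> x _; rewrite lee_fin.
Qed.

Lemma integral_indicM (D : set 'rV[R]_n) (u : 'rV[R]_n -> R) : measurable D ->
  (\int[mu]_x (\1_D x * u x)%:E = \int[mu]_(x in D) (u x)%:E)%E.
Proof.
move=> mD; rewrite [RHS]integral_mkcond; apply: eq_integral => x _.
by rewrite patchE indicE; case: ifPn => _ /=; rewrite ?mul1r ?mul0r.
Qed.

Variables (k G : 'rV[R]_n -> R) (rho p N V r t : R).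
Hypotheses (n2 : (2 <= n)%N) (mk : measurable_fun setT k) (k0 : forall y, 0 <= k y).
Hypotheses (mG : measurable_fun setT G) (G0 : forall y, 0 <= G y).
Let K y := k y `^ rho.
Hypotheses (hK : homogeneous0 (fun y => (K y)%:E))
  (KN : (ball_mass (fun y => (K y)%:E) <= (N `^ rho)%:E)%E).
Let g y := \1_(box 0 (6 * r)) y * G y `^ p.
Hypotheses (gV : (\int[mu]_y (g y)%:E <= V%:E)%E) (N0 : 0 <= N).
Hypotheses (r0 : 0 < r) (t0 : 0 < t) (t1 : t <= 1).

Let A : set 'rV[R]_n := shell r (2 * r).
Let H : set 'rV[R]_n := ccube (4 * r).
Let W : R := (8 * r) ^+ n.
Let cn : R := 2 * n.+1%:R * 4 * n%:R * 2 ^+ n.-1.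

Let mA : measurable A. Proof. exact: measurable_shell. Qed.
Let mH : measurable H. Proof. exact: measurable_cube. Qed.
Let mI (D : set 'rV[R]_n) : measurable D -> measurable_fun setT (\1_D : 'rV[R]_n -> R).
Proof. by move=> mD; exact: measurable_indic. Qed.
Let mK : measurable_fun setT K.
Proof. exact: (@measurableT_comp _ _ _ _ _ _ (@powR R ^~ rho)). Qed.
Let mg : measurable_fun setT g.
Proof.
apply: measurable_funM; first by apply: mI; exact: measurable_box.
exact: (@measurableT_comp _ _ _ _ _ _ (@powR R ^~ p)).
Qed.
Let K0 y : 0 <= K y. Proof. exact: powR_ge0. Qed.
Let g0 y : 0 <= g y. Proof. by rewrite mulr_ge0 ?powR_ge0// indicE. Qed.
Let I0 (D : set 'rV[R]_n) x : 0 <= (\1_D x : R). Proof. by rewrite indicE. Qed.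
Let W0 : 0 < W. Proof. by rewrite exprn_gt0// mulr_gt0. Qed.
Let muH : mu H = W%:E.
Proof. by rewrite lebesgue_ccube ?mulr_gt0// mulrA -natrM. Qed.

Let int_H : (\int[mu]_h (\1_H h)%:E = W%:E)%E.
Proof. by rewrite integral_indic// setIT; exact: muH. Qed.

Let m1 (u : 'rV[R]_n -> R) : measurable_fun setT u ->
  measurable_fun setT (fun q : 'rV[R]_n * 'rV[R]_n => u q.1).
Proof. by move=> mu_; exact: (measurableT_comp mu_ measurable_fst). Qed.
Let m2 (u : 'rV[R]_n -> R) : measurable_fun setT u ->
  measurable_fun setT (fun q : 'rV[R]_n * 'rV[R]_n => u q.2).
Proof. by move=> mu_; exact: (measurableT_comp mu_ measurable_snd). Qed.
Let mt (u : 'rV[R]_n -> R) : measurable_fun setT u ->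
  measurable_fun setT (fun q : 'rV[R]_n * 'rV[R]_n => u (q.1 + t *: q.2)).
Proof. by move=> mu_; exact: (measurableT_comp mu_ (measurable_lincomb t)). Qed.

Let AH_box6 y h : A y -> H h -> box 0 (6 * r) (y + t *: h).
Proof.
move=> /andP[_ yr] /ccubeP hh i; rewrite subr0 !mxE.
have := le_trans (coord_le_enorm y i) yr; have /andP[h1 h2] := hh i.
have : `|h ord0 i| <= 4 * r by rewrite ler_norml h1 ltW.
move=> h3 y2; apply: le_trans (ler_normD _ _) _.
rewrite normrM (gtr0_norm t0).
have : t * `|h ord0 i| <= 1 * (4 * r) by apply: ler_pM => //; exact: ltW.
by lra.
Qed.

Let int_K : (\int[mu]_y (\1_A y * K y)%:E <= (W * N `^ rho)%:E)%E.
Proof.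
rewrite integral_indicM//.
apply: (@le_trans _ _ (\int[mu]_(y in shell 0 (2 * r)) (K y)%:E)%E).
  apply: ge0_subset_integral => //.
  - exact: measurable_shell.
  - by apply/measurable_EFinP; exact: measurable_funTS.
  - by move=> y _; rewrite lee_fin.
  - move=> y /andP[h1 h2]; rewrite /shell/= h2 andbT.
    exact: lt_trans h1.
rewrite integral_shell0 ?mulr_gt0//.
apply: le_trans (lee_wpmul2l _ KN) _; first by rewrite lee_fin exprn_ge0// mulr_ge0// ltW.
rewrite -EFinM lee_fin ler_wpM2r ?powR_ge0// /W; apply: lerXn2r; rewrite ?nnegrE.
- by rewrite mulr_ge0// ltW.
- by rewrite mulr_ge0// ltW.
- by rewrite ler_wpM2r ?ltW// ltr_nat.
Qed.

Let int_a : (\int[mu \x mu]_q (\1_A q.1 * K q.1 * \1_H q.2)%:E <=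
  (W * W * N `^ rho)%:E)%E.
Proof.
rewrite fubini_tonelli1; last 2 first.
- apply/measurable_EFinP; apply: measurable_funM; last by apply: m2; exact: mI.
  by apply: measurable_funM; apply: m1 => //; exact: mI.
- by move=> q; rewrite lee_fin !mulr_ge0.
rewrite /fubini_F /=.
under eq_integral => y _.
  rewrite ge0_integralM//; last by rewrite mulr_ge0.
  rewrite int_H -EFinM mulrC.
  over.
rewrite ge0_integralM//; last 3 first.
- by apply: measurable_funM => //; exact: mI.
- by move=> y; rewrite mulr_ge0.
- exact: ltW.
by rewrite -mulrA [leRHS]EFinM lee_wpmul2l// lee_fin ltW.
Qed.

Let int_b : (\int[mu \x mu]_q (\1_A q.1 * \1_H q.2 * g (q.1 + t *: q.2))%:E <=
  (W * V)%:E)%E.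
Proof.
rewrite fubini_tonelli2; last 2 first.
- apply/measurable_EFinP; apply: measurable_funM; last exact: mt.
  by apply: measurable_funM; [apply: m1|apply: m2]; exact: mI.
- by move=> q; rewrite lee_fin (mulr_ge0 _ (g0 _))// mulr_ge0.
rewrite /fubini_G /=.
apply: (@le_trans _ _ (\int[mu]_h (V * \1_H h)%:E)%E).
  apply: ge0_le_integral.
  - exact: measurableT.
  - by move=> h _; apply: integral_ge0 => y _; rewrite lee_fin (mulr_ge0 _ (g0 _))// mulr_ge0.
  - apply: (@measurable_fun_fubini_tonelli_G _ _ _ _ _ mu
     (fun q => (\1_A q.1 * \1_H q.2 * g (q.1 + t *: q.2))%:E)).
      apply/measurable_EFinP; apply: measurable_funM; last exact: mt.
      by apply: measurable_funM; [apply: m1|apply: m2]; exact: mI.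
    by move=> q; rewrite lee_fin (mulr_ge0 _ (g0 _))// mulr_ge0.
  - by apply/measurable_EFinP; apply: measurable_funM => //; exact: mI.
  - move=> h _.
    apply: (@le_trans _ _ (\int[mu]_y (\1_H h * g (t *: h + 1 *: y))%:E)%E).
      apply: ge0_le_integral => //.
      + by move=> y _; rewrite lee_fin (mulr_ge0 _ (g0 _))// mulr_ge0.
      + apply/measurable_EFinP; apply: measurable_funM.
          by apply: measurable_funM => //; exact: mI.
        exact: (measurable_fun_pair1 h (mt mg)).
      + apply/measurable_EFinP; apply: measurable_funM => //.
        exact: (measurableT_comp mg (measurable_affine_rV _ _)).
      + move=> y _; rewrite lee_fin scale1r [t *: h + y]addrC ler_wpM2r//.
        by rewrite ler_piMl// indicE lern1 leq_b1.
    rewrite ge0_integralM//; last first.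
      exact: (measurableT_comp mg (measurable_affine_rV _ _)).
    rewrite EFinM muleC; apply: lee_wpmul2r; first by rewrite lee_fin; exact: I0.
    have := @integral_affine_rV R n (fun y => (g y)%:E) (t *: h) 1 ltr01.
    rewrite expr1n mul1e => <- //; exact/measurable_EFinP.
have V0 : 0 <= V.
  rewrite -lee_fin; apply: le_trans gV; apply: integral_ge0 => y _.
  by rewrite lee_fin.
by rewrite ge0_integralM// int_H -EFinM mulrC.
Qed.

Let c0 y h w : 0 <= (\1_A y * K y * \1_H h) * (\1_A y * \1_H h * g w).
Proof.
by apply: mulr_ge0; (apply: mulr_ge0; last by []); apply: mulr_ge0.
Qed.

(** Substitute [w = y + t *: h] for [h], which costs [t ^- n], and integrate in [y]
    first: [y] runs over the part of the annulus in a box of size comparable to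
    [t * r] around [w], where the mass of [K] is of order [t * r ^+ n]. *)
Let int_c : (\int[mu \x mu]_q
    ((\1_A q.1 * K q.1 * \1_H q.2) * (\1_A q.1 * \1_H q.2 * g (q.1 + t *: q.2)))%:E <=
  (t ^- n * t * (cn * W) * V * N `^ rho)%:E)%E.
Proof.
pose s := 4 * r * t.
have s0 : 0 < s by rewrite !mulr_gt0.
pose near : set ('rV[R]_n * 'rV[R]_n) :=
  (fun q => q.1 + (-1) *: q.2) @^-1` box 0 s.
have mnear : measurable near.
  rewrite -[X in measurable X]setTI; apply: (measurable_lincomb (-1)) => //.
  exact: measurable_box.
have nearP y w : ((y, w) \in near) = (y \in box w s).
  by apply/idP/idP; rewrite !inE /near /box/= => h i; have := h i;
    rewrite !mxE mulN1r subr0.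
pose f (q : 'rV[R]_n * 'rV[R]_n) := \1_A q.1 * K q.1 * (\1_near q * g q.2).
have mf : measurable_fun setT f.
  apply: measurable_funM.
    by apply: measurable_funM; apply: m1 => //; exact: mI.
  by apply: measurable_funM; [exact: measurable_indic|exact: m2].
have f0 q : 0 <= f q.
  by apply: mulr_ge0; apply: mulr_ge0 => //; rewrite indicE.
rewrite fubini_tonelli1; last 2 first.
- apply/measurable_EFinP; apply: measurable_funM.
    apply: measurable_funM; last by apply: m2; exact: mI.
    by apply: measurable_funM; apply: m1 => //; exact: mI.
  apply: measurable_funM; last exact: mt.
  by apply: measurable_funM; [apply: m1|apply: m2]; exact: mI.
- by move=> q; rewrite lee_fin; exact: c0.
rewrite /fubini_F /=.
have tn0 : 0 < t ^- n by rewrite invr_gt0 exprn_gt0.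
have inner y : (\int[mu]_h ((\1_A y * K y * \1_H h) *
      (\1_A y * \1_H h * g (y + t *: h)))%:E <=
    (t ^- n)%:E * \int[mu]_w (f (y, w))%:E)%E.
  have mfy : measurable_fun setT (fun w => (f (y, w))%:E).
    by apply/measurable_EFinP; exact: (measurable_fun_pair2 y mf).
  have fy0 w : (0 <= (f (y, w))%:E)%E by rewrite lee_fin.
  rewrite (integral_affine_rV y t0 mfy fy0) muleA -EFinM mulVf ?mul1e; last first.
    by rewrite gt_eqF// exprn_gt0.
  apply: ge0_le_integral => //.
  - by move=> h _; rewrite lee_fin; exact: c0.
  - apply/measurable_EFinP; apply: measurable_funM.
      by apply: measurable_funM => //; exact: mI.
    apply: measurable_funM; last exact: (measurable_fun_pair2 y (mt mg)).
    by apply: measurable_funM => //; exact: mI.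
  - exact: (measurableT_comp mfy (measurable_affine_rV _ _)).
  - move=> h _; rewrite lee_fin /f /=.
    have [yA|yA] := boolP (y \in A); last first.
      by rewrite [\1_A y]indicE (negbTE yA) !mul0r.
    have [hH|hH] := boolP (h \in H); last first.
      by rewrite [\1_H h]indicE (negbTE hH) !(mulr0, mul0r) (f0 (_, _)).
    rewrite [\1_A y]indicE [\1_H h]indicE yA hH !(mul1r, mulr1).
    rewrite indicE nearP mem_set ?mul1r// => i.
    rewrite !mxE opprD addNKr normrN normrM (gtr0_norm t0) /s mulrC.
    apply: ler_wpM2r; first exact: ltW.
    move: hH; rewrite inE => /ccubeP/(_ i)/andP[h1 h2].
    by rewrite ler_norml h1 ltW.
have mEf : measurable_fun setT (EFin \o f) by exact/measurable_EFinP.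
have Ef0 q : (0 <= (EFin \o f) q)%E by rewrite /= lee_fin.
have mF1 : measurable_fun setT (fun y => \int[mu]_w (f (y, w))%:E)%E.
  exact: (@measurable_fun_fubini_tonelli_F _ _ _ _ _ mu _ mEf Ef0).
have mF2 : measurable_fun setT (fun w => \int[mu]_y (f (y, w))%:E)%E.
  exact: (@measurable_fun_fubini_tonelli_G _ _ _ _ _ mu _ mEf Ef0).
apply: (@le_trans _ _ (\int[mu]_y ((t ^- n)%:E * \int[mu]_w (f (y, w))%:E))%E).
  apply: ge0_le_integral.
  - exact: measurableT.
  - move=> y _; apply: integral_ge0 => h _; rewrite lee_fin; exact: c0.
  - apply: (@measurable_fun_fubini_tonelli_F _ _ _ _ _ mu (fun q : 'rV[R]_n * 'rV[R]_n =>
      ((\1_A q.1 * K q.1 * \1_H q.2) *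
       (\1_A q.1 * \1_H q.2 * g (q.1 + t *: q.2)))%:E)).
      apply/measurable_EFinP; apply: measurable_funM.
        apply: measurable_funM; last by apply: m2; exact: mI.
        by apply: measurable_funM; apply: m1 => //; exact: mI.
      apply: measurable_funM; last exact: mt.
      by apply: measurable_funM; [apply: m1|apply: m2]; exact: mI.
    by move=> q; rewrite lee_fin; exact: c0.
  - exact: (measurable_funeM (t ^- n)%:E mF1).
  - by move=> y _; exact: inner.
have F10 y : setT y -> (0 <= \int[mu]_w (f (y, w))%:E)%E.
  by move=> _; apply: integral_ge0 => w _; rewrite lee_fin.
have tnE : (0 <= (t ^- n)%:E)%E by rewrite lee_fin ltW.
rewrite (@ge0_integralZl _ _ _ mu _ measurableT _ mF1 _ F10 tnE).
rewrite (@fubini_tonelli _ _ _ _ _ mu mu _ mEf Ef0)/=.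
have hoo : (ball_mass (fun y => (K y)%:E) < +oo)%E.
  by apply: le_lt_trans KN _; rewrite ltry.
have outer w : (\int[mu]_y (f (y, w))%:E <=
    ((t * (cn * W) * N `^ rho) * g w)%:E)%E.
  apply: (@le_trans _ _ (\int[mu]_y (g w *
      (\1_(shell r (2 * r) `&` box w s) y * K y))%:E)%E).
    rewrite le_eqVlt; apply/orP; left; apply/eqP; apply: eq_integral => y _.
    congr _%:E; rewrite /f /= -mulrA [in RHS]mulrC [\1_near _]indicE nearP.
    have -> : \1_(shell r (2 * r) `&` box w s) y = \1_A y * (y \in box w s)%:R :> R.
      by rewrite indicI/= [\1_(box _ _) y]indicE.
    by ring.
  rewrite ge0_integralM//; last 2 first.
  - apply: measurable_funM => //; apply: mI.
    by apply: measurableI => //; exact: measurable_box.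
  - by move=> y; exact: mulr_ge0.
  rewrite integral_indicM; last by apply: measurableI => //; exact: measurable_box.
  apply: le_trans (lee_wpmul2l _ (integral_shell_box w hK hoo r0 s0)) _.
    by rewrite lee_fin.
  rewrite muleA; apply: le_trans (lee_wpmul2l _ KN) _.
    rewrite lee_fin; apply: mulr_ge0; first exact: g0.
    apply: mulr_ge0; first by apply: mulr_ge0; [|exact: ltW].
    by apply: mulr_ge0 => //; rewrite exprn_ge0// mulr_ge0// ltW.
  rewrite -!EFinM lee_fin.
  have -> : g w * (2 * n.+1%:R * s * (n%:R * (2 * r) ^+ n.-1)) * N `^ rho =
    t * (cn * r ^+ n) * N `^ rho * g w.
    rewrite /s /cn exprMn -[in r ^+ n](prednK (ltnW n2)) exprS; ring.
  apply: ler_wpM2r => //; apply: ler_wpM2r; first exact: powR_ge0.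
  apply: ler_wpM2l; first exact: ltW.
  apply: ler_wpM2l; first by rewrite /cn !mulr_ge0// exprn_ge0.
  apply: lerXn2r.
  - by rewrite nnegrE ltW.
  - by rewrite nnegrE mulr_ge0// ltW.
  - by move: r0 => ?; lra.
have cst0 : 0 <= t * (cn * W) * N `^ rho.
  apply: mulr_ge0; last exact: powR_ge0.
  apply: mulr_ge0; first exact: ltW.
  apply: mulr_ge0; last exact: ltW.
  by rewrite /cn !mulr_ge0// exprn_ge0.
apply: (@le_trans _ _ ((t ^- n)%:E *
    \int[mu]_w ((t * (cn * W) * N `^ rho) * g w)%:E)%E).
  apply: lee_wpmul2l; first by rewrite lee_fin ltW.
  apply: ge0_le_integral.
  - exact: measurableT.
  - by move=> w _; apply: integral_ge0 => y _; rewrite lee_fin.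
  - exact: mF2.
  - by apply/measurable_EFinP; apply: measurable_funM.
  - by move=> w _; exact: outer.
rewrite ge0_integralM// muleA -EFinM.
apply: le_trans (lee_wpmul2l _ gV) _.
  by rewrite lee_fin mulr_ge0// ltW.
by rewrite -EFinM lee_fin le_eqVlt; apply/orP; left; apply/eqP; ring.
Qed.

Hypotheses (rho_n : 1 < rho < n%:R)
  (p_n : rho * n%:R / (rho * n%:R + rho - n%:R) <= p < n%:R).

(** Hoelder's inequality is used with the factors [K], [G ^ p] and their product
    [K * G ^ p], the last one with exponent [1 / n]; the lower bound on [p] says
    that the exponents add up to at most [1]. *)
Lemma averaging_estimate :
  (\int[mu \x mu]_q (\1_A q.1 * \1_H q.2 * (k q.1 * G (q.1 + t *: q.2)))%:E <=
  (N * V `^ p^-1 * cn `^ n%:R^-1 * (t ^- n * t) `^ n%:R^-1 *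
   W `^ (2 - p^-1))%:E)%E.
Proof.
have n0 : 0 < n%:R :> R by rewrite ltr0n ltnW.
have [rho1 rhon] := andP rho_n; have [pl pn] := andP p_n.
have rho0 : 0 < rho by exact: lt_trans rho1.
have den0 : 0 < rho * n%:R + rho - n%:R.
  have : n%:R < rho * n%:R by rewrite ltr_pMl.
  by lra.
have p0 : 0 < p by apply: lt_le_trans pl; rewrite divr_gt0// mulr_gt0.
pose a := rho^-1 - n%:R^-1; pose b := p^-1 - n%:R^-1; pose c : R := n%:R^-1.
pose e := 1 - a - b - c.
have a0 : 0 < a by rewrite subr_gt0 ltf_pV2.
have b0 : 0 < b by rewrite subr_gt0 ltf_pV2.
have c0' : 0 < c by rewrite invr_gt0.
have e0 : 0 <= e.
  have : p^-1 <= (rho * n%:R + rho - n%:R) / (rho * n%:R).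
    by rewrite -[leRHS]invf_div lef_pV2// posrE divr_gt0// mulr_gt0.
  rewrite (_ : _ / (rho * n%:R) = 1 + n%:R^-1 - rho^-1).
    by rewrite /e /a /b /c; lra.
  by field; rewrite !gt_eqF.
have abce : a + b + c + e = 1 by rewrite /e; ring.
have mAH : measurable (A `*` H) by exact: measurableX.
have muAH : ((mu \x mu)%E (A `*` H) <= (W * W)%:E)%E.
  have muA : (mu A <= W%:E)%E.
    rewrite -muH; apply: le_measure; rewrite ?inE//.
    move=> y /andP[_ yr]; apply/ccubeP => i.
    have := le_trans (coord_le_enorm y i) yr; rewrite ler_norml => /andP[h1 h2].
    by move: r0 => ?; apply/andP; split; lra.
  rewrite product_measure1E// EFinM; apply: le_trans (lee_wpmul2r _ muA) _ => //.
  by rewrite -muH.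
have V0 : 0 <= V.
  rewrite -lee_fin; apply: le_trans gV; apply: integral_ge0 => y _.
  by rewrite lee_fin.
have mf : measurable_fun setT (fun q => \1_A q.1 * K q.1 * \1_H q.2).
  apply: measurable_funM; last by apply: m2; exact: mI.
  by apply: measurable_funM; apply: m1 => //; exact: mI.
have mh : measurable_fun setT (fun q => \1_A q.1 * \1_H q.2 * g (q.1 + t *: q.2)).
  apply: measurable_funM; last exact: mt.
  by apply: measurable_funM; [apply: m1|apply: m2]; exact: mI.
have f0 q : 0 <= \1_A q.1 * K q.1 * \1_H q.2.
  by apply: mulr_ge0 => //; apply: mulr_ge0.
have h0 q : 0 <= \1_A q.1 * \1_H q.2 * g (q.1 + t *: q.2).
  by apply: mulr_ge0 => //; apply: mulr_ge0.
have fD q : ~ (A `*` H) q -> \1_A q.1 * K q.1 * \1_H q.2 = 0 :> R.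
  move=> qAH; have [qA|qA] := boolP (q.1 \in A); last first.
    by rewrite [\1_A _]indicE (negbTE qA) !mul0r.
  have [qH|qH] := boolP (q.2 \in H); last first.
    by rewrite [\1_H _]indicE (negbTE qH) mulr0.
  by case: qAH; split; [exact: set_mem qA|exact: set_mem qH].
have main := @hoelder3 R _ _ (mu \x mu)%E (A `*` H) _ _ _ _ _ _ _ a b c e
  mAH muAH (mulr_gt0 W0 W0) mf mh (measurable_funM mf mh) f0 h0
  (fun q => mulr_ge0 (f0 q) (h0 q)) fD int_a int_b int_c a0 b0 c0' e0 abce.
have acE : a + c = rho^-1 by rewrite /a /c subrK.
have bcE : b + c = p^-1 by rewrite /b /c subrK.
have rhoN0 : rho != 0 by rewrite gt_eqF.
have pN0 : p != 0 by rewrite gt_eqF.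
have pointwise q : \1_A q.1 * \1_H q.2 * (k q.1 * G (q.1 + t *: q.2)) =
    (\1_A q.1 * K q.1 * \1_H q.2) `^ a *
    (\1_A q.1 * \1_H q.2 * g (q.1 + t *: q.2)) `^ b *
    ((\1_A q.1 * K q.1 * \1_H q.2) *
     (\1_A q.1 * \1_H q.2 * g (q.1 + t *: q.2))) `^ c.
  have [qA|qA] := boolP (q.1 \in A); last first.
    by rewrite [\1_A _]indicE (negbTE qA) !mul0r !powR0 ?gt_eqF// !mul0r.
  have [qH|qH] := boolP (q.2 \in H); last first.
    rewrite [\1_H _]indicE (negbTE qH) !mulr0 !mul0r !powR0 ?gt_eqF//.
    by rewrite !mul0r.
  have q6 := AH_box6 (set_mem qA) (set_mem qH).
  rewrite [\1_A _]indicE [\1_H _]indicE qA qH !mul1r !mulr1.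
  rewrite /g indicE mem_set// mul1r.
  by rewrite (powR_split3 (k0 _) (G0 _) rhoN0 pN0 acE bcE).
under eq_integral => q _ do rewrite pointwise.
apply: le_trans main _; rewrite lee_fin le_eqVlt; apply/orP; left; apply/eqP.
have tn0 : 0 <= t ^- n * t by rewrite mulr_ge0 ?(ltW t0)// invr_ge0 exprn_ge0// ltW.
have cn0 : 0 <= cn by rewrite /cn !mulr_ge0// exprn_ge0.
exact: (hoelder3_boundE W0 N0 V0 cn0 tn0 rhoN0 pN0 acE bcE abce).
Qed.

End averaging_estimate.

(** * Mean oscillation on an annulus *)

Section square_of_lebesgue_measure.
Context {R : realType}.
Local Notation mu := (@lebesgue_rV R).
Local Open Scope ereal_scope.

Let sigma_finite_product n : sigma_finite setT (mu n \x mu n).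
Proof.
have /sigma_finiteP[A [TA ndA Aoo]] := sigma_finiteT (mu n).
exists (fun k => A k `*` A k).
  rewrite -setXTT TA predeqE => -[x y]; split.
    move=> [/= [i _ Aix] [j _ Ajy]]; exists (maxn i j) => //; split.
    - by move: x Aix; exact/subsetPset/ndA/leq_maxl.
    - by move: y Ajy; exact/subsetPset/ndA/leq_maxr.
  by move=> [i _ [/= ? ?]]; split; exists i.
move=> k; have [mAk Ak] := Aoo k; split; first exact: measurableX.
by rewrite product_measure1E// lte_mul_pinfty// ge0_fin_numE.
Qed.

(** The product measure on pairs of vectors, as a sigma-finite measure, so that
    Tonelli's theorem applies to it in turn. *)
Definition lebesgue_rV2 n :
    {sigma_finite_measure set ('rV[R]_n * 'rV[R]_n)%type -> \bar R} :=
  HB.pack (mu n \x mu n)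
    (Measure_isSigmaFinite.Build _ _ _ (mu n \x mu n) (sigma_finite_product n)).

End square_of_lebesgue_measure.

Section annulus.
Context {R : realType} {n : nat}.
Local Notation mu := (@lebesgue_rV R n).
Variables (k F : 'rV[R]_n -> R) (rho p N V r : R).
Let G y := enorm (gradient F y).
Hypotheses (n2 : (2 <= n)%N) (mk : measurable_fun setT k) (k0 : forall y, 0 <= k y).
Hypotheses (F1 : continuously_differentiable F) (cF : continuous F).
Hypotheses (hK : homogeneous0 (fun y => (k y `^ rho)%:E))
  (KN : (ball_mass (fun y => (k y `^ rho)%:E) <= (N `^ rho)%:E)%E).
Hypotheses (gV : (\int[mu]_y (\1_(box 0 (6 * r)) y * G y `^ p)%:E <= V%:E)%E).
Hypotheses (N0 : 0 <= N) (r0 : 0 < r).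
Hypotheses (rho_n : 1 < rho < n%:R)
  (p_n : rho * n%:R / (rho * n%:R + rho - n%:R) <= p < n%:R).

Let A : set 'rV[R]_n := shell r (2 * r).
Let B : set 'rV[R]_n := ccube (2 * r).
Let H : set 'rV[R]_n := ccube (4 * r).
Let c1 : R := 4 * n%:R ^+ 2.
Let Z : R := N * V `^ p^-1 *
  (2 * n.+1%:R * 4 * n%:R * 2 ^+ n.-1) `^ n%:R^-1 * ((8 * r) ^+ n) `^ (2 - p^-1).

Let Phi (u : R) (q : 'rV[R]_n * 'rV[R]_n) : R :=
  \1_A q.1 * \1_H q.2 * (k q.1 * G (q.1 + u ^+ n *: q.2)).

Let mG : measurable_fun setT G.
Proof. by apply: continuous_measurable_rV; exact: continuous_enorm_gradient. Qed.
Let mF : measurable_fun setT F. Proof. exact: continuous_measurable_rV. Qed.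
Let mA : measurable A. Proof. exact: measurable_shell. Qed.
Let mB : measurable B. Proof. exact: measurable_cube. Qed.
Let mH : measurable H. Proof. exact: measurable_cube. Qed.

Let Phi0 u q : 0 <= Phi u q.
Proof.
rewrite /Phi; apply: mulr_ge0; apply: mulr_ge0; rewrite ?indicE//.
exact: enorm_ge0.
Qed.

Let mPhi : measurable_fun setT
  (fun w : ('rV[R]_n * 'rV[R]_n) * measurableTypeR R => Phi (w.2 : R) w.1).
Proof.
have mc (D : set 'rV[R]_n) (i : 'rV[R]_n * 'rV[R]_n -> 'rV[R]_n) :
    measurable D -> measurable_fun setT i ->
    measurable_fun setT (fun w : ('rV[R]_n * 'rV[R]_n) * measurableTypeR R =>
      \1_D (i w.1) : R).
  move=> mD mi; apply: (measurableT_comp (measurable_indic mD)).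
  exact: (measurableT_comp mi measurable_fst).
rewrite /Phi; apply: measurable_funM.
  by apply: measurable_funM; apply: mc.
apply: measurable_funM.
  exact: (measurableT_comp mk (measurableT_comp measurable_fst measurable_fst)).
apply: (measurableT_comp mG); apply/measurable_fun_rVP => i.
rewrite (_ : (fun _ => _) = (fun w : ('rV[R]_n * 'rV[R]_n) * measurableTypeR R =>
    w.1.1 ord0 i + (w.2 : R) ^+ n * w.1.2 ord0 i)); last first.
  by apply/funext => w; rewrite !mxE.
apply: measurable_funD.
  apply: (measurableT_comp (measurable_coord i)).
  exact: (measurableT_comp measurable_fst measurable_fst).
apply: measurable_funM.
  by apply: measurable_funX; exact: measurable_snd.
apply: (measurableT_comp (measurable_coord i)).
exact: (measurableT_comp measurable_snd measurable_fst).
Qed.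

(** The [n]-th root of [t ^- n * t] for [t = u ^+ n] is the inverse of
    [u ^+ n.-1]. *)
Let int_Phi u : 0 < u <= 1 ->
  (\int[mu \x mu]_q (u ^+ n.-1 * Phi u q)%:E <= Z%:E)%E.
Proof.
move=> /andP[u0 u1].
have un0 : 0 <= u ^+ n.-1 by rewrite exprn_ge0// ltW.
have mPu : measurable_fun setT (Phi u).
  exact: (measurable_fun_pair1 (u : measurableTypeR R) mPhi).
under eq_integral do rewrite EFinM.
rewrite ge0_integralZl_EFin//; last 2 first.
- by move=> q _; rewrite lee_fin.
- exact/measurable_EFinP.
have := @averaging_estimate R n k G rho p N V r (u ^+ n) n2 mk k0 mG
  (fun y => enorm_ge0 _) hK KN gV N0 r0 (exprn_gt0 _ u0)
  (exprn_ile1 _ (ltW u0) u1) rho_n p_n.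
have un0E : (0 <= (u ^+ n.-1)%:E)%E by rewrite lee_fin.
move=> /(lee_wpmul2l un0E)/le_trans; apply.
rewrite -EFinM lee_fin le_eqVlt; apply/orP; left; apply/eqP.
have n0 : (0 < n)%N by exact: ltnW.
have -> : ((u ^+ n) ^- n * u ^+ n) `^ n%:R^-1 = (u ^+ n.-1)^-1.
  have v0 : 0 <= (u ^+ n)^-1 * u.
    by rewrite mulr_ge0 ?(ltW u0)// invr_ge0 exprn_ge0// ltW.
  rewrite -exprVn -exprMn -powR_mulrn//.
  rewrite -powRrM mulfV ?pnatr_eq0 -?lt0n// powRr1//.
  by rewrite -[in u ^+ n](prednK n0) exprSr invfM -mulrA mulVf ?mulr1// gt_eqF.
rewrite /Z; set e := u ^+ n.-1; set e1 := V `^ _; set e2 := (_ * 2 ^+ _) `^ _.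
set e3 := _ `^ _; have e0 : e != 0 by rewrite gt_eqF// exprn_gt0.
by field.
Qed.

(** With [z = y + h], the vector [h] lies in a cube of side [8 * r] and
    [le_integral_gradient] bounds the difference by an integral over [u] of the
    integrands [Phi u]. *)
Lemma annulus_double_integral :
  (\int[mu]_z \int[mu]_y (\1_B z * \1_A y * (k y * `|F y - F z|))%:E <=
   (c1 * r * Z)%:E)%E.
Proof.
have [p0 n0] : 0 < n%:R :> R /\ (0 < n)%N by rewrite ltr0n ltnW.
pose f (q : 'rV[R]_n * 'rV[R]_n) := \1_B q.1 * \1_A q.2 * (k q.2 * `|F q.2 - F q.1|).
have mf : measurable_fun setT (fun q => (f q)%:E).
  have mD (D : set 'rV[R]_n) : measurable D -> measurable_fun setT (\1_D : 'rV[R]_n -> R).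
    by move=> mD; exact: measurable_indic.
  apply/measurable_EFinP; apply: measurable_funM.
    apply: measurable_funM.
      exact: (measurableT_comp (mD _ mB) measurable_fst).
    exact: (measurableT_comp (mD _ mA) measurable_snd).
  apply: measurable_funM; first exact: (measurableT_comp mk measurable_snd).
  apply: measurableT_comp => //; apply: measurable_funB.
    exact: (measurableT_comp mF measurable_snd).
  exact: (measurableT_comp mF measurable_fst).
have f0 q : (0 <= (f q)%:E)%E.
  by rewrite lee_fin /f; apply: mulr_ge0; apply: mulr_ge0; rewrite ?indicE.
rewrite [leLHS](@fubini_tonelli _ _ _ _ _ mu mu _ mf f0).
pose I01 : set R := `[0, 1]%classic.
have mI01 : measurable (I01 : set (measurableTypeR R)) by exact: measurable_itv.
pose psi (u : R) q := \1_I01 u * ((c1 * r) * (u ^+ n.-1 * Phi u q)).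
have cr0 : 0 <= c1 * r by apply: mulr_ge0; [rewrite /c1 mulr_ge0// exprn_ge0|exact: ltW].
have mPsi : measurable_fun setT (fun w : ('rV[R]_n * 'rV[R]_n) * measurableTypeR R =>
    (psi (w.2 : R) w.1)%:E).
  apply/measurable_EFinP; apply: measurable_funM.
    exact: (measurableT_comp (measurable_indic mI01) measurable_snd).
  apply: measurable_funM => //; apply: measurable_funM; last exact: mPhi.
  by apply: measurable_funX; exact: measurable_snd.
have psi0 u q : 0 <= psi u q.
  rewrite /psi; have [uI|uI] := boolP (u \in I01); last first.
    by rewrite indicE (negbTE uI) mul0r.
  rewrite indicE uI mul1r mulr_ge0// mulr_ge0// exprn_ge0//.
  by move: uI; rewrite inE /I01/= in_itv/= => /andP[].
have Psi0 (w : ('rV[R]_n * 'rV[R]_n) * measurableTypeR R) :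
  (0 <= (psi (w.2 : R) w.1)%:E)%E by rewrite lee_fin.
have mXi : measurable_fun setT
    (fun q => \int[lebesgue_measure]_u (psi u q)%:E)%E.
  exact: (@measurable_fun_fubini_tonelli_F _ _ _ _ _ lebesgue_measure _ mPsi Psi0).
have Xi0 q : (0 <= \int[lebesgue_measure]_u (psi u q)%:E)%E.
  by apply: integral_ge0 => u _; rewrite lee_fin.
apply: (@le_trans _ _ (\int[mu \x mu]_q \int[lebesgue_measure]_u (psi u q)%:E)%E).
  rewrite (@fubini_tonelli1 _ _ _ _ _ mu mu _ mXi Xi0).
  apply: ge0_le_integral.
  - exact: measurableT.
  - by move=> y _; apply: integral_ge0 => z _; exact: (f0 (z, y)).
  - exact: (@measurable_fun_fubini_tonelli_G _ _ _ _ _ mu _ mf f0).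
  - exact: (@measurable_fun_fubini_tonelli_F _ _ _ _ _ mu _ mXi Xi0).
  move=> y _ /=.
  have mfy : measurable_fun setT (fun z => (f (z, y))%:E).
    exact: (measurable_fun_pair1 y mf).
  rewrite (integral_affine_rV y ltr01 mfy (fun z => f0 (z, y))) expr1n mul1e.
  apply: ge0_le_integral.
  - exact: measurableT.
  - by move=> h _; exact: (f0 (_, y)).
  - exact: (measurableT_comp mfy (measurable_affine_rV _ _)).
  - exact: (measurable_fun_pair2 y mXi).
  move=> h _; rewrite scale1r /f /=.
  have [yA|yA] := boolP (y \in A); last first.
    by rewrite [\1_A _]indicE (negbTE yA) mulr0 mul0r; exact: Xi0.
  have [yhB|yhB] := boolP (y + h \in B); last first.
    by rewrite [\1_B _]indicE (negbTE yhB) !mul0r; exact: Xi0.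
  have h4 i : `|h ord0 i| <= 4 * r /\ - (4 * r) <= h ord0 i < 4 * r.
    move: yhB; rewrite inE => /ccubeP/(_ i); rewrite !mxE => /andP[b1 b2].
    move: yA; rewrite inE => /andP[_ yr].
    have := le_trans (coord_le_enorm y i) yr; rewrite ler_norml => /andP[b3 b4].
    by move: r0 => ?; rewrite ler_norml; split; apply/andP; split; lra.
  have hH : h \in H by rewrite inE; apply/ccubeP => i; have [] := h4 i.
  rewrite [\1_A _]indicE [\1_B _]indicE yA yhB !mul1r EFinM.
  have := @le_integral_gradient R n F y h n0 F1; rewrite distrC.
  have kE : (0 <= (k y)%:E)%E by rewrite lee_fin.
  move=> /(lee_wpmul2l kE)/le_trans; apply.
  have mG1 : measurable_fun setT (fun u : measurableTypeR R =>
      G (y + (u : R) ^+ n *: h)).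
    apply: (measurableT_comp mG); apply/measurable_fun_rVP => i.
    rewrite (_ : (fun _ => _) = (fun u : measurableTypeR R =>
        y ord0 i + (u : R) ^+ n * h ord0 i)); last first.
      by apply/funext => u; rewrite !mxE.
    by apply: measurable_funD => //; apply: measurable_funM => //;
      exact: measurable_funX.
  have mgrad : measurable_fun setT (fun u : measurableTypeR R => (n%:R * (u : R) ^+ n.-1 *
      (enorm h * enorm (gradient F (y + (u : R) ^+ n *: h))))%R%:E).
    apply/measurable_EFinP; apply: measurable_funM.
      by apply: measurable_funM => //; exact: measurable_funX.
    exact: measurable_funM.
  have grad0 u : I01 u -> (0 <= (n%:R * u ^+ n.-1 *
      (enorm h * enorm (gradient F (y + u ^+ n *: h))))%R%:E)%E.
    rewrite /I01/= in_itv/= => /andP[u0 _].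
    by rewrite lee_fin !mulr_ge0 ?enorm_ge0 ?exprn_ge0.
  rewrite -ge0_integralZl_EFin//; last exact: measurable_funTS.
  rewrite integral_mkcond; apply: ge0_le_integral.
  - exact: measurableT.
  - move=> u _; rewrite patchE; case: ifPn => // uI.
    by rewrite mule_ge0// grad0// -inE.
  - apply/(measurable_restrictT _ _).1 => //; apply: measurable_funTS.
    exact: measurable_funeM.
  - exact: (measurable_fun_pair2 (y, h) mPsi).
  move=> u _; rewrite patchE /psi indicE; case: ifPn => uI; last by rewrite mul0r.
  rewrite -EFinM lee_fin mul1r /Phi /= [\1_A _]indicE [\1_H _]indicE yA hH !mul1r.
  have u0 : 0 <= u by move: uI; rewrite inE /I01/= in_itv/= => /andP[].
  rewrite -/(G _); set g := G _.
  have -> : k y * (n%:R * u ^+ n.-1 * (enorm h * g)) =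
    (n%:R * enorm h) * (u ^+ n.-1 * (k y * g)) by ring.
  apply: ler_wpM2r.
    by rewrite mulr_ge0 ?exprn_ge0// mulr_ge0// enorm_ge0.
  have := enorm_le (mulr_ge0 (ler0n _ 4) (ltW r0)) (fun i => (h4 i).1).
  move=> /(ler_wpM2l (ler0n R n)); rewrite /c1 => /le_trans; apply.
  by rewrite le_eqVlt; apply/orP; left; apply/eqP; ring.
have := @fubini_tonelli _ _ ('rV[R]_n * 'rV[R]_n)%type (measurableTypeR R) R (lebesgue_rV2 n) lebesgue_measure _ mPsi Psi0.
move=> /= ->.
have Z0 : 0 <= Z by rewrite /Z !mulr_ge0// powR_ge0.
apply: (@le_trans _ _ (\int[lebesgue_measure]_(u in I01) (c1 * r * Z)%:E)%E).
  rewrite [leRHS]integral_mkcond; apply: ge0_le_integral.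
  - exact: measurableT.
  - by move=> u _; apply: integral_ge0 => q _; rewrite lee_fin.
  - exact: (@measurable_fun_fubini_tonelli_G _ _ ('rV[R]_n * 'rV[R]_n)%type (measurableTypeR R) R (lebesgue_rV2 n) _ mPsi Psi0).
  - by apply/(measurable_restrictT _ _).1.
  move=> u _; rewrite patchE; case: ifPn => uI; last first.
    by rewrite integral0_eq// => q _; rewrite /psi indicE (negbTE uI) mul0r.
  under eq_integral do rewrite /psi indicE uI mul1r EFinM.
  have mPu : measurable_fun setT (Phi u).
    exact: (measurable_fun_pair1 (u : measurableTypeR R) mPhi).
  have [u0 u1] : 0 <= u /\ u <= 1.
    by move: uI; rewrite inE /I01/= in_itv/= => /andP[].
  rewrite ge0_integralZl_EFin//; last 2 first.
  - by move=> q _; rewrite lee_fin mulr_ge0// exprn_ge0.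
  - by apply/measurable_EFinP; exact: measurable_funM.
  rewrite [leRHS]EFinM; apply: lee_wpmul2l; first by rewrite lee_fin.
  move: u0; rewrite le_eqVlt => /predU1P[<-|u0]; last by apply: int_Phi; rewrite u0.
  rewrite integral0_eq ?lee_fin// => q _.
  by rewrite expr0n -subn1 subn_eq0 leqNgt n2/= mul0r.
rewrite integral_cst//.
have muI : lebesgue_measure (`[0, 1]%classic : set R) = 1%E.
  by rewrite lebesgue_measure_itv/= lte_fin ltr01 -EFinB subr0.
by rewrite -[leRHS]mule1 -muI.
Qed.
End annulus.

(** * The rough kernel and its cancellation *)

Section rough_kernel.
Context {R : realType} {n : nat}.
Local Notation mu := (@lebesgue_rV R n).
Variables (Om : 'rV[R]_n -> R) (rho : R).
Hypotheses (n0 : (0 < n)%N) (rho1 : 1 <= rho) (LOm : sphere_Lp rho Om).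

Definition rough_kernel (y : 'rV[R]_n) : R := radial_extension Om y / enorm y ^+ n.

Let k := radial_extension Om.
Let mOm : measurable_fun (sphere R n) Om. Proof. exact: LOm.1. Qed.
Let N := fine (sphere_Lnorm rho Om).

Lemma sphere_LnormE : sphere_Lnorm rho Om = N%:E.
Proof. by rewrite /N fineK// ge0_fin_numE ?LOm.2// Lnorm_ge0. Qed.

Let mk : measurable_fun setT k. Proof. exact: measurable_radial_extension. Qed.

Lemma homogeneous0_powR_norm :
  homogeneous0 (fun y => (`|radial_extension Om y| `^ rho)%:E).
Proof.
apply: (homogeneous0_radial_extension (phi := fun t => `|t| `^ rho)) => //.
exact: (@measurableT_comp _ _ _ _ _ _ (@powR R ^~ rho)).
Qed.

(** The mass of the unit ball is [n^-1] times the integral over the sphere. *)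
Lemma ball_mass_le_Lnorm :
  (ball_mass (fun y => (`|radial_extension Om y| `^ rho)%:E) <= (N `^ rho)%:E)%E.
Proof.
have rho0 : rho != 0 by rewrite gt_eqF// (lt_le_trans ltr01).
have mphi : measurable_fun setT (fun t : R => `|t| `^ rho).
  exact: (@measurableT_comp _ _ _ _ _ _ (@powR R ^~ rho)).
have e := @integral_sphere R n Om _ mOm mphi (fun t => powR_ge0 _ _).
have : (N `^ rho)%:E = (n%:R%:E *
    ball_mass (fun y => (`|radial_extension Om y| `^ rho)%:E))%E.
  rewrite -poweR_EFin -sphere_LnormE poweR_Lnorm// -e.
move=> ->; rewrite -[leLHS]mul1e; apply: lee_wpmul2r.
  by apply: integral_ge0 => y _; rewrite lee_fin powR_ge0.
by rewrite lee_fin ler1n.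
Qed.

Lemma lebesgue_shell_lty (s1 s2 : R) : (mu (shell s1 s2) < +oo)%E.
Proof.
have s0 : 0 < `|s2| + 1 by rewrite ltr_wpDl.
apply: (@le_lt_trans _ _ (mu (ccube (`|s2| + 1)))).
  apply: le_measure; rewrite ?inE.
  - exact: measurable_shell.
  - exact: measurable_cube.
  move=> y /andP[_ ys]; apply/ccubeP => i.
  have := le_trans (coord_le_enorm y i) ys; rewrite ler_norml => /andP[h1 h2].
  have := ler_norm s2; move=> h3; apply/andP; split; lra.
by rewrite lebesgue_ccube// ltry.
Qed.

(** The unit ball has finite volume, and [`|t| <= 1 + `|t| `^ rho]. *)
Lemma ball_mass_norm_lty :
  (ball_mass (fun y => (`|radial_extension Om y|)%:E) < +oo)%E.
Proof.
have mKr : measurable_fun setT (fun y => (`|k y| `^ rho)%:E).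
  by have [] := homogeneous0_powR_norm.
apply: (@le_lt_trans _ _ (\int[mu]_(y in shell 0 1) (1 + (`|k y| `^ rho)%:E))%E).
  apply: ge0_le_integral.
  - exact: measurable_shell.
  - by move=> y _; rewrite lee_fin.
  - apply/measurable_EFinP; apply: measurable_funTS.
    exact: measurableT_comp.
  - by apply: emeasurable_funD => //; exact: measurable_funTS.
  move=> y _; rewrite -EFinD lee_fin.
  case: (leP `|k y| 1) => ky; first by rewrite ler_wpDr// powR_ge0.
  by rewrite ler_wpDl// le1r_powR// ltW.
rewrite (@ge0_integralD _ _ _ mu _ (measurable_shell 0 1) (cst 1%E)
  (fun y => (`|k y| `^ rho)%:E)); last 4 first.
- by [].
- exact: measurable_cst.
- by move=> y _; rewrite lee_fin powR_ge0.
- exact: measurable_funTS.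
rewrite integral_cst ?mul1e; last exact: measurable_shell.
rewrite lte_add_pinfty//; first exact: lebesgue_shell_lty.
by apply: le_lt_trans ball_mass_le_Lnorm _; rewrite ltry.
Qed.

Let hom (phi : R -> R) : measurable_fun setT phi -> (forall t, 0 <= phi t) ->
  homogeneous0 (fun y => (phi (radial_extension Om y))%:E).
Proof. by move=> mphi phi0; exact: homogeneous0_radial_extension. Qed.

Let pos (t : R) := Num.max t 0.
Let neg (t : R) := Num.max (- t) 0.
Let mpos : measurable_fun setT pos. Proof. exact: measurable_funrpos. Qed.
Let mneg : measurable_fun setT neg. Proof. exact: measurable_funrneg. Qed.
Let pos0 t : 0 <= pos t. Proof. by rewrite le_max lexx orbT. Qed.
Let neg0 t : 0 <= neg t. Proof. by rewrite le_max lexx orbT. Qed.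

Let ball_mass_lty (phi : R -> R) : measurable_fun setT phi -> (forall t, 0 <= phi t) ->
  (forall t, phi t <= `|t|) -> (ball_mass (fun y => (phi (radial_extension Om y))%:E) < +oo)%E.
Proof.
move=> mphi phi0 phin; apply: le_lt_trans ball_mass_norm_lty.
apply: ge0_le_integral.
- exact: measurable_shell.
- by move=> y _; rewrite lee_fin.
- by apply/measurable_EFinP; apply: measurable_funTS; exact: measurableT_comp.
- apply/measurable_EFinP; apply: measurable_funTS.
  exact: measurableT_comp.
- by move=> y _; rewrite lee_fin.
Qed.

Let pos_le t : pos t <= `|t|.
Proof. by rewrite ge_max ler_norm normr_ge0. Qed.
Let neg_le t : neg t <= `|t|.
Proof. by rewrite ge_max -normrN ler_norm normr_ge0. Qed.

Hypothesis Om0 : (\int[sphere_measure R n]_(y in sphere R n) (Om y)%:E = 0)%E.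

Let eq_ball_mass : ball_mass (fun y => (pos (radial_extension Om y))%:E) =
  ball_mass (fun y => (neg (radial_extension Om y))%:E).
Proof.
have n0' : (0 < n%:R :> R) by rewrite ltr0n.
have : (\int[sphere_measure R n]_y (pos ((Om \_ (sphere R n)) y))%:E -
   \int[sphere_measure R n]_y (neg ((Om \_ (sphere R n)) y))%:E = 0)%E.
  move: Om0; rewrite integral_mkcond integralE => <-.
  congr (_ - _)%E; apply: eq_integral => y _.
    by rewrite funeposE !patchE; case: ifPn => _; rewrite /pos/= EFin_max.
  by rewrite funenegE !patchE; case: ifPn => _; rewrite /neg/= -?EFinN EFin_max ?oppr0.
rewrite !integral_sphere//.
have fp : ball_mass (fun y => (pos (radial_extension Om y))%:E) \is a fin_num.
  rewrite ge0_fin_numE; first exact: ball_mass_lty.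
  by apply: integral_ge0 => y _; rewrite lee_fin.
have fn : ball_mass (fun y => (neg (radial_extension Om y))%:E) \is a fin_num.
  rewrite ge0_fin_numE; first exact: ball_mass_lty.
  by apply: integral_ge0 => y _; rewrite lee_fin.
rewrite -(fineK fp) -(fineK fn) -!EFinM -EFinB => -[] /eqP.
by rewrite -mulrBr mulf_eq0 (gt_eqF n0')/= subr_eq0 => /eqP ->.
Qed.

Lemma measurable_rough_kernel : measurable_fun setT rough_kernel.
Proof.
apply: measurable_funM; first exact: mk.
rewrite (_ : (fun _ => _) = (fun y : 'rV[R]_n => enorm y `^ (- n%:R))).
  apply: (@measurableT_comp _ _ _ _ _ _ (@powR R ^~ (- n%:R))) => //.
  exact: measurable_enorm.
by apply/funext => y; rewrite powR_invn// enorm_ge0.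
Qed.

Lemma integral_shell_norm_le (r s : R) : 0 <= r -> 0 < s ->
  (\int[mu]_(y in shell r s) (`|radial_extension Om y|)%:E <=
   (s ^+ n)%:E * ball_mass (fun y => (`|radial_extension Om y|)%:E))%E.
Proof.
move=> r0 s0; have mn : measurable_fun setT (fun y => (`|radial_extension Om y|)%:E).
  by apply/measurable_EFinP; exact: measurableT_comp.
have hn : homogeneous0 (fun y => (`|radial_extension Om y|)%:E) by exact: hom.
rewrite -integral_shell0//; apply: ge0_subset_integral.
- exact: measurable_shell.
- exact: measurable_shell.
- exact: measurable_funTS.
- by move=> y _; rewrite lee_fin.
- by move=> y /andP[h1 h2]; rewrite /shell/= h2 andbT (le_lt_trans r0).
Qed.

Lemma integrable_rough_kernel (r s : R) : 0 < r ->
  mu.-integrable (shell r s) (EFin \o rough_kernel).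
Proof.
move=> r0; apply/integrableP; split.
  by apply/measurable_EFinP; apply: measurable_funTS; exact: measurable_rough_kernel.
pose t := Num.max s 1; have t0 : 0 < t by rewrite lt_max ltr01 orbT.
have rn0 : 0 < r ^- n by rewrite invr_gt0 exprn_gt0.
have mn : measurable_fun setT (fun y => (`|radial_extension Om y|)%:E).
  by apply/measurable_EFinP; exact: measurableT_comp.
apply: (@le_lt_trans _ _ (\int[mu]_(y in shell r t)
    ((r ^- n)%:E * (`|radial_extension Om y|)%:E))%E).
  have mE : measurable_fun setT (fun y => `|(rough_kernel y)%:E|%E).
    by apply/measurable_EFinP; apply: measurableT_comp => //; exact: measurable_rough_kernel.
  apply: (@le_trans _ _ (\int[mu]_(y in shell r t) `|(rough_kernel y)%:E|)%E).
    apply: ge0_subset_integral.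
    - exact: measurable_shell.
    - exact: measurable_shell.
    - exact: measurable_funTS.
    - by [].
    - by move=> y /andP[h1 h2]; rewrite /shell/= h1 le_max h2.
  apply: ge0_le_integral.
  - exact: measurable_shell.
  - by [].
  - exact: measurable_funTS.
  - by apply: measurable_funTS; exact: measurable_funeM.
  move=> y /andP[h1 h2]; rewrite -EFinM lee_fin /rough_kernel normrM mulrC.
  have y0 : 0 < enorm y by exact: lt_trans h1.
  apply: ler_wpM2r => //; rewrite gtr0_norm ?invr_gt0 ?exprn_gt0//.
  by rewrite lef_pV2 ?posrE ?exprn_gt0// lerXn2r ?nnegrE ?ltW.
rewrite ge0_integralZl_EFin//; last 3 first.
- exact: measurable_shell.
- exact: measurable_funTS.
- exact: ltW.
apply: lte_mul_pinfty; rewrite ?lee_fin ?ltW//.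
apply: le_lt_trans (integral_shell_norm_le (ltW r0) t0) _.
apply: lte_mul_pinfty; rewrite ?lee_fin ?exprn_ge0 ?ltW//.
exact: ball_mass_norm_lty.
Qed.

(** As [Om] has mean zero, its positive and negative parts have the same mass in
    the unit ball, hence the same integrals against [enorm y ^- n] on any shell. *)
Lemma integral_shell_rough_kernel (r s : R) : 0 < r ->
  (\int[mu]_(y in shell r s) (rough_kernel y)%:E = 0)%E.
Proof.
move=> r0; rewrite integralE.
have ep : (\int[mu]_(y in shell r s) ((fun y => (rough_kernel y)%:E) ^\+ y))%E =
    (\int[mu]_(y in shell r s) ((pos (k y))%:E * (enorm y ^- n)%:E))%E.
  apply: eq_integral => y _; rewrite funeposE -EFin_max -EFinM; congr _%:E.
  by rewrite /pos maxr_pMl ?mul0r// invr_ge0 exprn_ge0// enorm_ge0.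
have en : (\int[mu]_(y in shell r s) ((fun y => (rough_kernel y)%:E) ^\- y))%E =
    (\int[mu]_(y in shell r s) ((neg (k y))%:E * (enorm y ^- n)%:E))%E.
  apply: eq_integral => y _; rewrite funenegE -EFinN -EFin_max -EFinM; congr _%:E.
  by rewrite /neg maxr_pMl ?mul0r ?mulNr// invr_ge0 exprn_ge0// enorm_ge0.
rewrite ep en (@eq_integral_shell_weight R n _ _ r s n0 (hom mpos pos0)
  (hom mneg neg0) eq_ball_mass (ball_mass_lty mpos pos0 pos_le) r0).
rewrite subee// -en; apply: integrable_neg_fin_num; first exact: measurable_shell.
exact: integrable_rough_kernel.
Qed.

End rough_kernel.

(** * The contribution of one annulus *)

Section annulus_bound.
Context {R : realType} {n : nat}.
Local Notation mu := (@lebesgue_rV R n).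
Variables (Om : 'rV[R]_n -> R) (rho : R).
Hypotheses (n2 : (2 <= n)%N) (LOm : sphere_Lp rho Om)
  (Om0 : (\int[sphere_measure R n]_(y in sphere R n) (Om y)%:E = 0)%E).
Hypothesis rho_n : 1 < rho < n%:R.
Variables (F : 'rV[R]_n -> R) (M : R).
Hypotheses (cF : continuous F) (FM : forall y, `|F y| <= M).

Let n0 : (0 < n)%N. Proof. exact: ltnW. Qed.
Let rho1 : 1 <= rho. Proof. by apply: ltW; case/andP: rho_n. Qed.
Let k (y : 'rV[R]_n) : R := `|radial_extension Om y|.
Let K := @rough_kernel R n Om.
Let mF : measurable_fun setT F. Proof. exact: continuous_measurable_rV. Qed.
Let mK : measurable_fun setT K.
Proof. exact: (measurable_rough_kernel LOm). Qed.
Let mk : measurable_fun setT k.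
Proof. by apply: measurableT_comp => //; apply: measurable_radial_extension; exact: LOm.1. Qed.

Let k0 y : 0 <= k y. Proof. exact: normr_ge0. Qed.

Lemma integrable_rough_kernelM r s : 0 < r ->
  mu.-integrable (shell r s) (fun y => (K y * F y)%:E).
Proof.
move=> r0; have iK := integrable_rough_kernel n0 rho1 LOm s r0.
have M0 : 0 <= M by exact: le_trans (FM 0).
apply: (@le_integrable _ _ _ mu _ (measurable_shell r s) _ (fun y => (M * K y)%:E)).
- apply/measurable_EFinP; apply: measurable_funTS; exact: measurable_funM.
- move=> y _; rewrite lee_fin !normrM (ger0_norm M0) mulrC.
  by apply: ler_wpM2r.
- have := integrableZl (measurable_shell r s) M iK.
  by apply: eq_integrable => //; exact: measurable_shell.
Qed.

(** The kernel integrates to zero on the shell, so that [c] may be subtracted from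
    [F]; its denominator is at least [r ^+ n] there. *)
Lemma le_integral_oscillation (r s c : R) : 0 < r ->
  (`|\int[mu]_(y in shell r s) (K y * F y)%:E| <=
   (r ^- n)%:E * \int[mu]_(y in shell r s) (k y * `|F y - c|)%:E)%E.
Proof.
move=> r0; have mS := measurable_shell (R := R) (n := n) r s.
have iK := integrable_rough_kernel n0 rho1 LOm s r0.
have iKc : mu.-integrable (shell r s) (fun y => (c * K y)%:E).
  have := integrableZl mS c iK.
  by apply: eq_integrable.
have -> : (\int[mu]_(y in shell r s) (K y * F y)%:E =
    \int[mu]_(y in shell r s) ((K y * F y)%:E - (c * K y)%:E))%E.
  rewrite integralB_EFin//; last exact: integrable_rough_kernelM.
  rewrite [X in (_ - X)%E](_ : _ = 0%E) ?sube0//.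
  under eq_integral do rewrite EFinM.
  by rewrite integralZl// (integral_shell_rough_kernel n0 rho1 LOm Om0 s r0) mule0.
have mKF : measurable_fun setT (fun y => ((K y * F y)%:E - (c * K y)%:E)%E).
  by apply/measurable_EFinP; apply: measurable_funB; exact: measurable_funM.
have mkF : measurable_fun setT (fun y => (k y * `|F y - c|)%:E).
  apply/measurable_EFinP; apply: measurable_funM => //.
  by apply: measurableT_comp => //; exact: measurable_funB.
apply: le_trans (le_abse_integral mu mS _) _; first exact: measurable_funTS.
rewrite -ge0_integralZl_EFin//; last 3 first.
- by move=> y _; rewrite lee_fin mulr_ge0.
- exact: measurable_funTS.
- by rewrite invr_ge0 exprn_ge0// ltW.
apply: ge0_le_integral => //.
- by apply: measurableT_comp => //; exact: measurable_funTS.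
- by apply: measurable_funTS; exact: measurable_funeM.
move=> y /andP[y1 y2]; rewrite -EFinB abse_EFin -EFinM lee_fin.
have y0 : 0 < enorm y by exact: lt_trans y1.
rewrite [c * _]mulrC -mulrBr normrM mulrA ler_wpM2r//.
rewrite /K /rough_kernel normrM mulrC; apply: ler_wpM2r => //.
rewrite gtr0_norm ?invr_gt0 ?exprn_gt0// lef_pV2 ?posrE ?exprn_gt0//.
by rewrite lerXn2r ?nnegrE ?ltW.
Qed.

Variable p : R.
Hypothesis p_n : rho * n%:R / (rho * n%:R + rho - n%:R) <= p < n%:R.
Hypothesis F1 : continuously_differentiable F.

(** The factors come, in this order, from the parametrisation and the length of
    the segments, from [integral_shell_box], from the volume of the cube of side
    [8 * r] of the vectors [h], and from the average over the cube of side [4 * r]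
    of the points [z]. *)
Definition annulus_const : R := 4 * n%:R ^+ 2 *
  (2 * n.+1%:R * 4 * n%:R * 2 ^+ n.-1) `^ n%:R^-1 *
  (8 ^+ n) `^ (2 - p^-1) / 4 ^+ n.

(** The integral over the annulus does not change when the value of [F] at a
    point [z] is subtracted from it; averaging over [z] in a cube of comparable
    size leads to the double integral of the differences. *)
Lemma annulus_bound (r V : R) : 0 < r ->
  (\int[mu]_y (\1_(box 0 (6 * r)) y * enorm (gradient F y) `^ p)%:E <= V%:E)%E ->
  (`|\int[mu]_(y in shell r (2 * r)) (K y * F y)%:E| <=
   (annulus_const * r * fine (sphere_Lnorm rho Om) * (V / r ^+ n) `^ p^-1)%:E)%E.
Proof.
move=> r0 FV; set N := fine _; set X := (`|_|)%E.
have N0 : 0 <= N by rewrite fine_ge0// Lnorm_ge0.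
have V0 : 0 <= V.
  rewrite -lee_fin; apply: le_trans FV; apply: integral_ge0 => y _.
  by rewrite lee_fin mulr_ge0 ?powR_ge0// indicE.
have := annulus_double_integral n2 mk (fun y => normr_ge0 _) F1 cF
  (homogeneous0_powR_norm LOm) (ball_mass_le_Lnorm n0 rho1 LOm) FV N0 r0
  rho_n p_n.
set Z := (X in (_ * r * X)%:E) => dbl.
have [x Xx x0] : exists2 x, X = x%:E & 0 <= x.
  have fX : X \is a fin_num.
    rewrite /X abse_fin_num; apply: integrable_fin_num; first exact: measurable_shell.
    exact: integrable_rough_kernelM.
  by exists (fine X); rewrite ?fineK ?fine_ge0// abse_ge0.
rewrite Xx lee_fin.
pose B : set 'rV[R]_n := ccube (2 * r).
have mB : measurable B by exact: measurable_cube.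
have mA := measurable_shell (R := R) (n := n) r (2 * r).
have rn0 : 0 < r ^- n by rewrite invr_gt0 exprn_gt0.
have mf : measurable_fun setT (fun q : 'rV[R]_n * 'rV[R]_n =>
    (\1_B q.1 * \1_(shell r (2 * r)) q.2 * (k q.2 * `|F q.2 - F q.1|))%:E).
  apply/measurable_EFinP; apply: measurable_funM.
    apply: measurable_funM.
      exact: (measurableT_comp (measurable_indic mB) measurable_fst).
    exact: (measurableT_comp (measurable_indic mA) measurable_snd).
  apply: measurable_funM; first exact: (measurableT_comp mk measurable_snd).
  apply: measurableT_comp => //; apply: measurable_funB.
    exact: (measurableT_comp mF measurable_snd).
  exact: (measurableT_comp mF measurable_fst).
have f0 (q : 'rV[R]_n * 'rV[R]_n) :
    (0 <= (\1_B q.1 * \1_(shell r (2 * r)) q.2 * (k q.2 * `|F q.2 - F q.1|))%:E)%E.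
  by rewrite lee_fin; apply: mulr_ge0; apply: mulr_ge0; rewrite ?indicE.
have mf1 := @measurable_fun_fubini_tonelli_F _ _ _ _ _ mu _ mf f0.
have rnE : (0 <= (r ^- n)%:E)%E by rewrite lee_fin ltW.
have avg : (x%:E * (((4 * r) ^+ n)%:E) <= (r ^- n)%:E * (4 * n%:R ^+ 2 * r * Z)%:E)%E.
  apply: le_trans (lee_wpmul2l rnE dbl).
  have f10 (z : 'rV[R]_n) : setT z -> (0 <= fubini_F mu (fun q : 'rV[R]_n * 'rV[R]_n =>
      (\1_B q.1 * \1_(shell r (2 * r)) q.2 * (k q.2 * `|F q.2 - F q.1|))%:E) z)%E.
    by move=> _; apply: integral_ge0 => y _; exact: (f0 (z, y)).
  have := @ge0_integralZl _ _ _ mu _ measurableT _ mf1 _ f10 rnE.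
  rewrite {2}/fubini_F /= => <-.
  have -> : ((4 * r) ^+ n)%:E = mu B.
    by rewrite /B lebesgue_ccube ?mulr_gt0// mulrA -natrM.
  have -> : mu B = (\int[mu]_z (\1_B z)%:E)%E by rewrite integral_indic// setIT.
  rewrite -ge0_integralZl_EFin//; last first.
    by apply/measurable_EFinP; exact: measurable_indic.
  apply: ge0_le_integral.
  - exact: measurableT.
  - by move=> z _; rewrite -EFinM lee_fin mulr_ge0// indicE.
  - by apply: measurable_funeM; apply/measurable_EFinP; exact: measurable_indic.
  - exact: (measurable_funeM (r ^- n)%:E mf1).
  move=> z _; rewrite -EFinM indicE /fubini_F; have [zB|zB] := boolP (z \in B); last first.
    by rewrite mulr0 mule_ge0//; apply: integral_ge0 => y _; exact: (f0 (z, y)).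
  rewrite mulr1 -Xx; apply: le_trans (le_integral_oscillation (2 * r) (F z) r0) _.
  apply: lee_wpmul2l => //=; rewrite -integral_indicM//.
  apply: ge0_le_integral.
  - exact: measurableT.
  - by move=> y _; rewrite lee_fin; apply: mulr_ge0; [rewrite indicE|exact: mulr_ge0].
  - apply/measurable_EFinP; apply: measurable_funM; first exact: measurable_indic.
    apply: measurable_funM => //.
    by apply: measurableT_comp => //; exact: measurable_funB.
  - exact: (measurable_fun_pair2 z mf).
  by move=> y _; rewrite [\1_B z]indicE zB mul1r.
move: avg; rewrite -!EFinM lee_fin => avg.
have r4 : 0 < (4 * r) ^+ n by rewrite exprn_gt0// mulr_gt0.
rewrite -(ler_pM2r r4); apply: le_trans avg _.
have rn1 : 0 < r ^+ n by rewrite exprn_gt0.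
have rn1' := ltW rn1; have rnV : 0 <= (r ^+ n)^-1 by rewrite invr_ge0.
have E1 : (V / r ^+ n) `^ p^-1 = V `^ p^-1 * (r ^+ n) `^ (- p^-1).
  by rewrite powRM// -(powR_inv1 rn1') -powRrM mulN1r.
have E2 : ((8 * r) ^+ n) `^ (2 - p^-1) =
    (8 ^+ n) `^ (2 - p^-1) * ((r ^+ n) ^+ 2 * (r ^+ n) `^ (- p^-1)).
  have e8 : 0 <= 8 ^+ n :> R by rewrite exprn_ge0.
  rewrite exprMn powRM//; congr (_ * _).
  by rewrite powRD ?(powR_mulrn 2 rn1')// (gt_eqF rn1) implybT.
rewrite /Z E1 E2 /annulus_const exprMn le_eqVlt; apply/orP; left; apply/eqP.
set v := V `^ _; set e := (r ^+ n) `^ _; set e8 := _ `^ (2 - _).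
set cn := _ `^ n%:R^-1; have : r ^+ n != 0 by rewrite gt_eqF.
move: (r ^+ n) => q q0.
have : (4 : R) ^+ n != 0 by rewrite expf_neq0.
move: (4 ^+ n) => w w0.
by rewrite -/N; field; rewrite q0 w0.
Qed.

End annulus_bound.

(** * Shifted dyadic grids *)

Section dyadic_cubes.
Context {R : realType} {n : nat}.
Implicit Types (t x y : 'rV[R]_n) (k : int).

Definition dyadic_index t k x : 'rV[int]_n :=
  \row_i Num.floor (x ord0 i / 2 ^ k - (-1) ^ k * t ord0 i).

Definition dyadic_at t k x : 'rV[R]_n * R := dyadic_cube t k (dyadic_index t k x).

Lemma exp2z_gt0 k : 0 < (2 : R) ^ k. Proof. exact: exprz_gt0. Qed.

Lemma dyadic_at_side t k x : (dyadic_at t k x).2 = 2 ^ k. Proof. by []. Qed.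

Lemma cube_dyadicP t k m x :
  cube (dyadic_cube t k m) x <-> dyadic_index t k x = m.
Proof.
have k0 := exp2z_gt0 k.
have H i : (2 ^ k * ((m ord0 i)%:~R + (-1) ^ k * t ord0 i) <= x ord0 i <
     2 ^ k * ((m ord0 i)%:~R + (-1) ^ k * t ord0 i) + 2 ^ k) =
    ((m ord0 i)%:~R <= x ord0 i / 2 ^ k - (-1) ^ k * t ord0 i <
     (m ord0 i + 1)%:~R).
  rewrite lerBrDr ltrBlDr ler_pdivlMr// ltr_pdivrMr//; congr (_ && _).
    by rewrite mulrC.
  by rewrite intrD; congr (_ < _); ring.
split=> [xQ|e i]; last first.
  by rewrite /= !mxE H -e mxE; exact: (real_floor_itv (num_real _)).
apply/rowP => i; rewrite mxE; apply: floor_def; rewrite -H.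
by have := xQ i; rewrite /= !mxE.
Qed.

Lemma dyadic_at_self t k x : cube (dyadic_at t k x) x.
Proof. exact/cube_dyadicP. Qed.

Lemma dyadic_at_in t k x y :
  cube (dyadic_at t k x) y <-> dyadic_at t k y = dyadic_at t k x.
Proof.
split=> [/cube_dyadicP e|<-]; last exact: dyadic_at_self.
by rewrite /dyadic_at e.
Qed.

Lemma dyadic_at_grid t k x : dyadic_grid t (dyadic_at t k x).
Proof. by exists k => //; eexists. Qed.

Lemma exp2z_inj : injective (fun k : int => (2 : R) ^ k).
Proof. by apply: ieexprIz => //; rewrite gt_eqF// ltr1n. Qed.

Lemma sign_exprz k : exists s : bool, (-1 : R) ^ k = (-1) ^+ s.
Proof.
case: k => l; first by exists (odd l); rewrite signr_odd.
by exists (odd l.+1); rewrite NegzE -exprnN signr_odd -exprVn invrN1.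
Qed.

Lemma floor_half (a b : R) (j : int) : Num.floor a = Num.floor b ->
  Num.floor ((a + j%:~R) / 2) = Num.floor ((b + j%:~R) / 2).
Proof.
suff H (c : R) (l : int) : (l%:~R <= (c + j%:~R) / 2) =
    (l * 2 - j <= Num.floor c)%R.
  move=> ab; apply: floor_def.
  have /andP[h1 h2] := real_floor_itv (num_real ((b + j%:~R) / 2)).
  by rewrite H ab -H h1 ltNge H ab -H -ltNge.
by rewrite floor_ge_int ler_pdivlMr// -lerBlDr intrB intrM.
Qed.

Variable b : {ffun 'I_n -> bool}.
Let t : 'rV[R]_n := shift_of b.

(** The cubes of generation [k] are unions of cubes of generation [k - 1] because
    three times the shift is an integer vector. *)
Lemma dyadic_at_parent k x y : dyadic_at t k x = dyadic_at t k y ->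
  dyadic_at t (k + 1) x = dyadic_at t (k + 1) y.
Proof.
have [j ej] : exists j : 'I_n -> int, forall i, 3 * ((-1) ^ k * t ord0 i) = (j i)%:~R.
  have [s ->] := sign_exprz k.
  exists (fun i => if b i then (-1) ^+ s else 0) => i; rewrite mxE.
  case: (b i); last by rewrite !mulr0.
  by rewrite mulrCA mulfV// mulr1 rmorph_sign.
move=> e; have {}e : dyadic_index t k x = dyadic_index t k y.
  by apply/esym/cube_dyadicP; rewrite -/(dyadic_at t k x) e; exact: dyadic_at_self.
congr dyadic_cube; apply/rowP => i; rewrite mxE [in RHS]mxE.
move/rowP : e => /(_ i); rewrite mxE [in RHS]mxE => /floor_half ei.
have E z : z / 2 ^ (k + 1) - (-1) ^ (k + 1) * t ord0 i =
    (z / 2 ^ k - (-1) ^ k * t ord0 i + (j i)%:~R) / 2.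
  rewrite -ej !expfzDr// !expr1z invfM; field.
  by rewrite gt_eqF// exp2z_gt0.
by rewrite !E.
Qed.

Lemma dyadic_at_ancestor k l x y : (k <= l)%R -> dyadic_at t k x = dyadic_at t k y ->
  dyadic_at t l x = dyadic_at t l y.
Proof.
move=> kl; rewrite -(subrK k l) addrC.
have : 0 <= l - k by rewrite subr_ge0.
case: (l - k) => // d _ e; elim: d => [|d IH]; first by rewrite addr0.
have -> : k + Posz d.+1 = k + Posz d + 1 by rewrite -addrA -PoszD addn1.
exact: dyadic_at_parent.
Qed.

Lemma dyadic_at_subset k l x : (k <= l)%R ->
  cube (dyadic_at t k x) `<=` cube (dyadic_at t l x).
Proof. by move=> kl y /dyadic_at_in e; apply/dyadic_at_in; exact: dyadic_at_ancestor e. Qed.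

End dyadic_cubes.

Section one_third_trick.
Context {R : realType} {n : nat}.

(** An integer separating [a] from [c] is at distance at most [1 / 3] from both;
    it no longer separates them after a translation of either sign by [1 / 3], and
    no other integer does. *)
Lemma floor_third (a c : R) (s : bool) : a <= c -> c - a <= 3^-1 ->
  Num.floor a != Num.floor c ->
  Num.floor (a - (-1) ^+ s * 3^-1) = Num.floor (c - (-1) ^+ s * 3^-1).
Proof.
move=> ac ca ne; set j := Num.floor c.
have /andP[j1 _] := real_floor_itv (num_real c).
have aj : a < j%:~R.
  rewrite ltNge; apply: contra ne => ja; apply/eqP; apply: floor_def.
  have /andP[_] := real_floor_itv (num_real c); rewrite -/j => cj.
  by rewrite ja (le_lt_trans ac cj).
rewrite -/j in j1.
case: s; rewrite ?expr0 ?expr1 ?mulN1r ?opprK ?mul1r.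
  have -> : Num.floor (c + 3^-1) = j by apply: floor_def; rewrite intrD; lra.
  by apply: floor_def; rewrite intrD; lra.
have -> : Num.floor (c - 3^-1) = j - 1.
  by apply: floor_def; rewrite subrK intrB; lra.
by apply: floor_def; rewrite subrK intrB; lra.
Qed.

Lemma floor_between (a c d : R) : a <= d <= c -> Num.floor a = Num.floor c ->
  Num.floor d = Num.floor c.
Proof.
move=> /andP[ad dc] e; apply/eqP; rewrite eq_le (le_floor dc)/= -e.
exact: le_floor.
Qed.

(** Any box is contained in a cube of comparable size of one of the grids: in
    each coordinate, the unshifted or the shifted partition of the line into
    intervals of length [2 ^ k] has no endpoint in a given interval of length at
    most [2 ^ k / 3]. *)
Lemma box_in_dyadic (x : 'rV[R]_n) (s : R) (k : int) : 0 < s -> 6 * s <= 2 ^ k ->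
  exists b : {ffun 'I_n -> bool}, box x s `<=` cube (dyadic_at (shift_of b) k x).
Proof.
move=> s0 sk; have k0 := @exp2z_gt0 R k.
pose lo i := (x ord0 i - s) / 2 ^ k; pose hi i := (x ord0 i + s) / 2 ^ k.
exists [ffun i => Num.floor (lo i) != Num.floor (hi i)].
set b := [ffun i => _]; pose t : 'rV[R]_n := shift_of b.
have lohi i : lo i <= hi i by rewrite ler_pM2r ?invr_gt0// lerD2l; lra.
have third i : hi i - lo i <= 3^-1.
  rewrite /hi /lo -mulrBl ler_pdivrMr//; lra.
have key i : Num.floor (lo i - (-1) ^ k * t ord0 i) = Num.floor (hi i - (-1) ^ k * t ord0 i).
  rewrite /t mxE ffunE; case: ifPn => [ne|/negPn/eqP]; last by rewrite !mulr0 !subr0.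
  have [sg ->] := @sign_exprz R k.
  exact: floor_third.
have sub y : box x s y -> forall i,
    Num.floor (y ord0 i / 2 ^ k - (-1) ^ k * t ord0 i) =
    Num.floor (hi i - (-1) ^ k * t ord0 i).
  move=> yx i; apply: (floor_between _ (key i)).
  have := yx i; rewrite !mxE ler_distl => /andP[h1 h2].
  by rewrite !lerD2r !ler_pM2r ?invr_gt0// h1 h2.
move=> y yx; apply/cube_dyadicP; apply/rowP => i; rewrite !mxE.
have xx : box x s x by move=> l; rewrite subrr mxE normr0 ltW.
by have := sub y yx i; have := sub x xx i; rewrite !mxE => -> ->.
Qed.

End one_third_trick.

(** * Principal cubes and their sparseness *)

Section principal_cubes.
Context {R : realType} {n : nat}.
Local Notation mu := (@lebesgue_rV R n).
Variables (b : {ffun 'I_n -> bool}) (g : 'rV[R]_n -> R).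
Hypotheses (n0 : (0 < n)%N) (mg : measurable_fun setT g) (g0 : forall y, 0 <= g y).
Hypothesis goo : (\int[mu]_y (g y)%:E < +oo)%E.
Let t : 'rV[R]_n := shift_of b.

Definition mean (Q : 'rV[R]_n * R) : R :=
  fine (\int[mu]_(y in cube Q) (g y)%:E)%E / Q.2 ^+ n.

Let a : R := 2 ^+ n.+1.
Let a1 : 1 < a. Proof. by rewrite exprn_egt1// ltr1n. Qed.
Let a0 : 0 < a. Proof. exact: lt_trans a1. Qed.

(** Stopping cubes are the Calderon-Zygmund cubes of all the levels [a ^ j] at once.
    The mean grows at most by the factor [2 ^+ n] from a cube to one of its
    children, so that it is at most [a ^ (j + 1) / 2] on a stopping cube of level
    [j]. *)
Definition stopping (k : int) x := exists j : int, a ^ j < mean (dyadic_at t k x) /\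
  forall l : int, (k < l)%R -> mean (dyadic_at t l x) <= a ^ j.

Definition principal : set ('rV[R]_n * R) :=
  [set Q | exists k x, stopping k x /\ Q = dyadic_at t k x].

Let mgE : measurable_fun setT (EFin \o g). Proof. exact/measurable_EFinP. Qed.
Let g0E y : (0 <= (g y)%:E)%E. Proof. by rewrite lee_fin. Qed.

Lemma integral_cube_fin_num Q : (\int[mu]_(y in cube Q) (g y)%:E)%E \is a fin_num.
Proof.
rewrite ge0_fin_numE; last exact: integral_ge0.
apply: le_lt_trans goo; apply: ge0_subset_integral => //.
exact: measurable_cube.
Qed.

Lemma meanE k x : (\int[mu]_(y in cube (dyadic_at t k x)) (g y)%:E =
  (mean (dyadic_at t k x) * (2 ^ k) ^+ n)%:E)%E.
Proof.
rewrite /mean dyadic_at_side mulfVK ?fineK ?integral_cube_fin_num//.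
by rewrite expf_neq0// gt_eqF// exp2z_gt0.
Qed.

Lemma mean_ge0 k x : 0 <= mean (dyadic_at t k x).
Proof.
rewrite /mean divr_ge0// ?fine_ge0//; first exact: integral_ge0.
by rewrite exprn_ge0// ltW// exp2z_gt0.
Qed.

Lemma mean_parent k x : mean (dyadic_at t k x) <= 2 ^+ n * mean (dyadic_at t (k + 1) x).
Proof.
have k0 : 0 < (2 ^ k : R) ^+ n by rewrite exprn_gt0// exp2z_gt0.
rewrite -(ler_pM2r k0) -lee_fin -meanE mulrAC -mulrA.
have -> : 2 ^+ n * ((2 ^ k) ^+ n * mean (dyadic_at t (k + 1) x)) =
    mean (dyadic_at t (k + 1) x) * (2 ^ (k + 1)) ^+ n.
  by rewrite expfzDr// expr1z exprMn; ring.
rewrite -meanE; apply: ge0_subset_integral => //.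
- exact: measurable_cube.
- exact: measurable_cube.
- exact: measurable_funTS.
- by apply: dyadic_at_subset; rewrite lerDl.
Qed.

Lemma stopping_at k x y : dyadic_at t k x = dyadic_at t k y ->
  stopping k x -> stopping k y.
Proof.
move=> e [j [h1 h2]]; exists j; rewrite -e; split; first exact: h1.
move=> l kl; have <- := dyadic_at_ancestor (ltW kl) e; exact: h2.
Qed.

Lemma principal_grid : principal `<=` dyadic_grid t.
Proof. by move=> Q [k [x [_ ->]]]; exact: dyadic_at_grid. Qed.

Lemma principalP k x : principal (dyadic_at t k x) <-> stopping k x.
Proof.
split=> [[l [y [sy e]]]|s]; last by exists k, x.
have lk : k = l by apply: (@exp2z_inj R); exact: (congr1 snd e).
by rewrite lk in e *; exact: stopping_at sy.
Qed.

Let mcube Q : measurable (cube Q : set 'rV[R]_n). Proof. exact: measurable_cube. Qed.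

(** A property of points that only depends on the cube of generation [k]
    containing them defines a countable union of such cubes. *)
Lemma measurable_generation (P : 'rV[R]_n -> Prop) k :
  (forall x y, dyadic_at t k x = dyadic_at t k y -> P x -> P y) ->
  measurable [set x | P x].
Proof.
move=> hP.
rewrite (_ : [set x | P x] = \bigcup_(m in [set m | exists2 x, P x & dyadic_index t k x = m])
    cube (dyadic_cube t k m)).
  rewrite bigcup_mkcond; apply: countable_bigcupT_measurable => [|m].
    exact: countableP.
  by case: ifPn.
apply/seteqP; split=> [x Px|x [m [y Py ym]] /cube_dyadicP xm].
  by exists (dyadic_index t k x); [exists x|exact/cube_dyadicP].
by apply: hP Py; rewrite /dyadic_at ym xm.
Qed.

Lemma lebesgue_dyadic_at k x : mu (cube (dyadic_at t k x)) = ((2 ^ k) ^+ n)%:E.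
Proof. exact: (lebesgue_rV_cube _ (exp2z_gt0 k)). Qed.

(** The weak type bound for the dyadic maximal function localised to a cube: the
    maximal cubes of mean larger than [lam] are disjoint. *)
Lemma weak_type k x0 (lam : R) : 0 < lam ->
  (lam%:E * mu [set x | cube (dyadic_at t k x0) x /\
     exists i : nat, (lam < mean (dyadic_at t (k - i.+1%:Z) x))%R] <=
  \int[mu]_(y in cube (dyadic_at t k x0)) (g y)%:E)%E.
Proof.
move=> lam0; set P := cube (dyadic_at t k x0); set U := [set x | _].
pose V (i : nat) : set 'rV[R]_n := [set x | P x /\
  lam < mean (dyadic_at t (k - i.+1%:Z) x) /\
  forall j, (j < i)%N -> mean (dyadic_at t (k - j.+1%:Z) x) <= lam].
pose dec (c : nat) : nat * 'rV[int]_n := odflt (0%N, 0) (unpickle c).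
pose Fc (c : nat) : set 'rV[R]_n :=
  [set x | pickle (dec c) = c /\ V (dec c).1 x /\
    dyadic_index t (k - (dec c).1.+1%:Z) x = (dec c).2].
have lvl i j : (j <= i)%N -> k - i.+1%:Z <= k - j.+1%:Z.
  by move=> ji; rewrite lerD2l lerN2.
have VQ i x y : dyadic_at t (k - i.+1%:Z) x = dyadic_at t (k - i.+1%:Z) y ->
    V i x -> V i y.
  move=> e [Px [h1 h2]]; split; [|split].
  - have kk : (k - i.+1%:Z <= k)%R by rewrite gerBl.
    apply/dyadic_at_in; have <- := dyadic_at_ancestor kk e.
    exact/dyadic_at_in.
  - by rewrite -e.
  - move=> j ji; have <- := dyadic_at_ancestor (lvl _ _ (ltnW ji)) e.
    exact: h2.
have FcE c : Fc c = set0 \/ exists x, Fc c = cube (dyadic_at t (k - (dec c).1.+1%:Z) x) /\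
    lam < mean (dyadic_at t (k - (dec c).1.+1%:Z) x).
  have [[x [xc [Vx xm]]]|/set0P/negP/negPn/eqP ->] := pselect (Fc c !=set0); last by left.
  right; exists x; split; last by have [_ []] := Vx.
  apply/seteqP; split=> [y [_ [_ ym]]|y /dyadic_at_in yx].
    by apply/cube_dyadicP; rewrite ym xm.
  split; first exact: xc.
  split; first exact: VQ (esym yx) Vx.
  rewrite -xm; apply/cube_dyadicP.
  by have := dyadic_at_self t (k - (dec c).1.+1%:Z) y; rewrite yx.
have mFc c : measurable (Fc c).
  by have [->|[x [-> _]]] := FcE c; [exact: measurable0|exact: mcube].
have UF : U `<=` \bigcup_c Fc c.
  move=> x [Px ex].
  have ex' : exists i, `[< lam < mean (dyadic_at t (k - i.+1%:Z) x) >].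
    by have [i hi] := ex; exists i; exact/asboolP.
  case: (ex_minnP ex') => i /asboolP hi imin.
  exists (pickle (i, dyadic_index t (k - i.+1%:Z) x)) => //.
  have dE : dec (pickle (i, dyadic_index t (k - i.+1%:Z) x)) =
    (i, dyadic_index t (k - i.+1%:Z) x) by rewrite /dec pickleK.
  split; first by rewrite dE.
  rewrite dE; split; last by [].
  split; first exact: Px.
  split; first exact: hi.
  move=> j ji; rewrite leNgt; apply/negP => hj.
  by have := imin j; rewrite leqNgt ji => /(_ (asboolT hj)).
have FP c : Fc c `<=` P by move=> x [_ [[]]].
have tF : trivIset setT Fc.
  move=> c c' _ _ [x [[xc [Vx xm]] [xc' [Vx' xm']]]].
  have ii : (dec c).1 = (dec c').1.
    apply/eqP; rewrite eqn_leq; apply/andP; split; rewrite leqNgt; apply/negP => lt.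
      have [_ [_ /(_ _ lt)]] := Vx; have [_ [+ _]] := Vx'.
      by move=> /lt_le_trans h /h; rewrite ltxx.
    have [_ [_ /(_ _ lt)]] := Vx'; have [_ [+ _]] := Vx.
    by move=> /lt_le_trans h /h; rewrite ltxx.
  rewrite -xc -xc'; congr pickle; apply/eqP; rewrite -pair_eqE /pair_eq/= ii eqxx/=.
  by rewrite -xm -xm' ii.
have mUF : measurable (\bigcup_c Fc c) by exact: bigcup_measurable.
have lamE : (0 <= lam%:E)%E by rewrite lee_fin ltW.
have mU : measurable U.
  rewrite (_ : U = \bigcup_i (P `&`
      [set x | lam < mean (dyadic_at t (k - i.+1%:Z) x)])); last first.
    apply/seteqP; split=> [x [Px [i hi]]|x [i _ [Px hi]]]; first by exists i.
    by split; [exact: Px|exists i].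
  apply: bigcup_measurable => i _; apply: measurableI; first exact: mcube.
  apply: (@measurable_generation (fun x => lam < mean (dyadic_at t (k - i.+1%:Z) x))
    (k - i.+1%:Z)) => x y ->; exact.
apply: (@le_trans _ _ (lam%:E * mu (\bigcup_c Fc c))%E).
  by apply: lee_wpmul2l => //; apply: le_measure; rewrite ?inE.
apply: (@le_trans _ _ (\int[mu]_(y in \bigcup_c Fc c) (g y)%:E)%E); last first.
  apply: ge0_subset_integral.
  - exact: mUF.
  - exact: mcube.
  - exact: measurable_funTS.
  - by move=> y _; exact: g0E.
  - by move=> x [c _ /FP].
rewrite ge0_integral_bigcup//.
rewrite measure_semi_bigcup// -nneseriesZl//.
apply: lee_nneseries => c _; first by rewrite mule_ge0.
have [->|[x [-> lm]]] := FcE c; first by rewrite measure0 mule0 integral_set0.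
rewrite meanE [X in (_ * X)%E]lebesgue_dyadic_at -EFinM lee_fin ler_wpM2r ?(ltW lm)//.
by rewrite exprn_ge0// ltW// exp2z_gt0.
exact: measurable_funTS.
Qed.

(** The set attached to a principal cube is what remains after the removal of the
    smaller stopping cubes. These have means above the next level, which is at
    least twice the mean of the cube itself, so that by the weak type inequality
    they cover at most half of it. *)
Lemma principal_sparse : sparse principal.
Proof.
have lt2 (l k : int) : ((2 : R) ^ l < 2 ^ k) = (l < k) by rewrite ltr_eXz2l// ltr1n.
pose E (Q : 'rV[R]_n * R) : set 'rV[R]_n := [set x | cube Q x /\
  forall l : int, 2 ^ l < Q.2 -> ~ stopping l x].
exists E; split; last first.
  move=> _ _ [k [x0 [s0 ->]]] [k' [x0' [s0' ->]]] [x [[xP hP] [xP' hP']]].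
  move: xP xP' => /dyadic_at_in e /dyadic_at_in e'; rewrite -e -e'.
  have sk : stopping k x by apply: stopping_at s0; rewrite e.
  have sk' : stopping k' x by apply: stopping_at s0'; rewrite e'.
  case: (ltgtP k k') => [kk|kk|->//].
  - by case: (hP' k) => //; rewrite dyadic_at_side lt2.
  - by case: (hP k') => //; rewrite dyadic_at_side lt2.
move=> _ [k [x0 [[j [vj above]] ->]]]; set P := dyadic_at t k x0.
have aj0 : 0 < a ^ j by exact: exprz_gt0.
have lam0 : 0 < a ^ (j + 1) by exact: exprz_gt0.
have k0 : 0 < (2 ^ k : R) ^+ n by rewrite exprn_gt0// exp2z_gt0.
pose U := [set x | cube P x /\
  exists i : nat, a ^ (j + 1) < mean (dyadic_at t (k - i.+1%:Z) x)].
have mE : measurable (E P).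
  rewrite (_ : E P = cube P `\` \bigcup_(l in [set l : int | 2 ^ l < P.2])
      [set x | stopping l x]).
    apply: measurableD; first exact: mcube.
    rewrite bigcup_mkcond; apply: countable_bigcupT_measurable => [|l].
      exact: countableP.
    case: ifPn => // _; apply: (@measurable_generation (stopping l) l) => x y.
    exact: stopping_at.
  apply/seteqP; split=> x [xP hx]; split; [exact: xP| |exact: xP|].
    by move=> [l /= lP sx]; exact: (hx l lP sx).
  by move=> l lP sx; apply: hx; exists l.
have mU : measurable U.
  rewrite (_ : U = \bigcup_i (cube P `&`
      [set x | a ^ (j + 1) < mean (dyadic_at t (k - i.+1%:Z) x)])); last first.
    apply/seteqP; split=> [x [Px [i hi]]|x [i _ [Px hi]]]; first by exists i.
    by split; [exact: Px|exists i].
  apply: bigcup_measurable => i _; apply: measurableI; first exact: mcube.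
  apply: (@measurable_generation
    (fun x => a ^ (j + 1) < mean (dyadic_at t (k - i.+1%:Z) x))
    (k - i.+1%:Z)) => x y ->; exact.
have EU : cube P `\` U `<=` E P.
  move=> x [xP xU]; split; first exact: xP.
  move=> l; rewrite dyadic_at_side lt2 => lk [j' [h1 h2]]; apply: xU.
  split; first exact: xP.
  have jj : j + 1 <= j'.
    have := h2 k lk; move/dyadic_at_in : xP => -> /(lt_le_trans vj).
    by rewrite ltr_eXz2l//; rewrite lezD1.
  have [i il] : exists i : nat, l = k - i.+1%:Z.
    have : 0 <= k - l - 1 by rewrite -addrA -opprD subr_ge0 lezD1.
    case E0 : (k - l - 1) => [i|//] _; exists i.
    by rewrite -addn1 PoszD -E0; ring.
  exists i; rewrite -il; apply: le_lt_trans h1.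
  by rewrite ler_eXz2l.
have muP : mu (cube P) = ((2 ^ k) ^+ n)%:E by exact: lebesgue_dyadic_at.
have UP : U `<=` cube P by move=> x [].
have fU : mu U \is a fin_num.
  rewrite ge0_fin_numE//; apply: (@le_lt_trans _ _ (mu (cube P))).
    by apply: le_measure; rewrite ?inE.
  by rewrite muP ltry.
have fPU : mu (cube P `\` U) \is a fin_num.
  rewrite ge0_fin_numE//; apply: (@le_lt_trans _ _ (mu (cube P))).
    apply: le_measure; rewrite ?inE.
    - by apply: measurableD => //; exact: mcube.
    - exact: mcube.
    - by move=> x [].
  by rewrite muP ltry.
have muU : (2%:E * mu U <= mu (cube P))%E.
  have := @weak_type k x0 _ lam0; rewrite -/P -/U meanE muP -(fineK fU) -!EFinM !lee_fin.
  move=> wt.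
  have vP : mean P <= 2 ^+ n * a ^ j.
    apply: le_trans (mean_parent k x0) _; apply: ler_wpM2l; first by rewrite exprn_ge0.
    by apply: above; rewrite ltrDl.
  have c0 : 0 < 2 ^+ n * a ^ j by rewrite mulr_gt0// exprn_gt0.
  rewrite -(ler_pM2l c0); apply: le_trans (le_trans wt (ler_wpM2r (ltW k0) vP)).
  rewrite le_eqVlt; apply/orP; left; apply/eqP.
  rewrite expfzDr ?gt_eqF// expr1z.
  have -> : a = 2 ^+ n * 2 by rewrite /a exprSr.
  by ring.
have split_P : (mu (cube P) = mu U + mu (cube P `\` U))%E.
  rewrite -[in LHS](setDUK UP) measureU//; last by rewrite setDIK.
  by apply: measurableD => //; exact: mcube.
split; first exact: mE.
  by move=> x [].
apply: (@le_trans _ _ (2%:E * mu (cube P `\` U))%E); last first.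
  apply: lee_wpmul2l; first by rewrite lee_fin.
  apply: le_measure; rewrite ?inE.
  - by apply: measurableD => //; exact: mcube.
  - exact: mE.
  - exact: EU.
move: muU; rewrite split_P -(fineK fU) -(fineK fPU) -!EFinM -!EFinD !lee_fin.
by move=> ?; lra.
Qed.

End principal_cubes.

(** * Domination of a sum over scales by principal cubes *)

Lemma exists_level {R : realType} (a M : R) : 2 <= a -> 0 < M ->
  exists j : int, a ^ j < M <= a ^ (j + 1).
Proof.
move=> a2 M0; have a1 : 1 < a by apply: lt_le_trans a2; lra.
have a0 : 0 < a by lra.
pose N := maxn (Num.bound M) (Num.bound M^-1).
have a2N i : (2 : R) ^+ i <= a ^+ i.
  by apply: lerXn2r; rewrite ?nnegrE ?(ltW a0).
have MN : M <= a ^+ N.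
  apply: le_trans (a2N N); apply/ltW/upper_nthrootP; exact: leq_maxl.
have NM : a ^ (- N%:Z) < M.
  rewrite -exprnN -[ltRHS]invrK ltf_pV2 ?posrE ?exprn_gt0 ?invr_gt0//.
  apply: lt_le_trans (a2N N); apply: upper_nthrootP; exact: leq_maxr.
have ex : exists i : nat, a ^ (i%:Z - N%:Z) < M by exists 0%N; rewrite sub0r.
have bd i : a ^ (i%:Z - N%:Z) < M -> (i <= N.*2)%N.
  move=> /lt_le_trans/(_ MN); rewrite -[a ^+ N]/(a ^ N%:Z) ltr_eXz2l//.
  by rewrite ltrBlDr -PoszD ltz_nat addnn => /ltnW.
case: (ex_maxnP ex bd) => i hi imax; exists (i%:Z - N%:Z); rewrite hi/= leNgt.
apply/negP => h; have := imax i.+1; rewrite ltnn => /(_ _)/negP; apply => //.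
by move: h; rewrite -addn1 PoszD addrAC.
Qed.

Section sparse_domination.
Context {R : realType} {n : nat}.
Local Notation mu := (@lebesgue_rV R n).
Variables (b : {ffun 'I_n -> bool}) (g : 'rV[R]_n -> R) (p : R).
Hypotheses (n0 : (0 < n)%N) (mg : measurable_fun setT g) (g0 : forall y, 0 <= g y).
Hypothesis goo : (\int[mu]_y (g y)%:E < +oo)%E.
Hypothesis p1 : 1 <= p.
Let t : 'rV[R]_n := shift_of b.
Let a : R := 2 ^+ n.+1.
Let v (k : int) x : R := mean g (dyadic_at t k x).

Let a2 : 2 <= a.
Proof. by rewrite /a exprS ler_peMr// exprn_ege1// ler1n. Qed.
Let a1 : 1 < a. Proof. by rewrite exprn_egt1// ltr1n. Qed.
Let a0 : 0 < a. Proof. exact: lt_trans a1. Qed.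
Let v0 k x : 0 <= v k x. Proof. exact: mean_ge0. Qed.

(** The integral of [g] over all of space is finite, whereas the volume of the
    cubes tends to infinity. *)
Lemma mean_small x (k : int) (lam : R) : 0 < lam ->
  exists L : nat, forall d : nat, (L <= d)%N -> v (k + d%:Z) x <= lam.
Proof.
move=> lam0; pose I := fine (\int[mu]_y (g y)%:E)%E.
have I0 : (0 <= \int[mu]_y (g y)%:E)%E by apply: integral_ge0 => y _; rewrite lee_fin.
have IE : (\int[mu]_y (g y)%:E)%E = I%:E by rewrite /I fineK// ge0_fin_numE.
exists (absz k + Num.bound (I / lam))%N => d Ld.
have kd0 : 0 < (2 ^ (k + d%:Z) : R) ^+ n by rewrite exprn_gt0// exp2z_gt0.
rewrite -(ler_pM2r kd0) -lee_fin /v -meanE//.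
apply: (@le_trans _ _ I%:E).
  rewrite -IE; apply: ge0_subset_integral.
  - exact: measurable_cube.
  - exact: measurableT.
  - exact/measurable_EFinP.
  - by move=> y _; rewrite lee_fin.
  - by [].
rewrite lee_fin mulrC -ler_pdivrMr//.
apply: (@le_trans _ _ (2 ^+ Num.bound (I / lam))).
  by apply/ltW; apply: upper_nthrootP.
have kdB : (Num.bound (I / lam))%:Z <= k + d%:Z by lia.
apply: (@le_trans _ _ (2 ^ (k + d%:Z))).
  by rewrite -[leLHS]/(2 ^ (Num.bound (I / lam))%:Z) ler_eXz2l// ltr1n.
rewrite -[leLHS]expr1; apply: ler_weXn2l => //.
rewrite -[leLHS]/((2 : R) ^ (0 : int)) ler_eXz2l ?ltr1n//.
by apply: le_trans kdB.
Qed.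

(** Choose the level just below the mean, and the largest cube around [x] whose mean
    exceeds it. *)
Lemma stopping_above k x : 0 < v k x -> exists d : nat,
  stopping b g (k + d%:Z) x /\ v k x <= a * v (k + d%:Z) x.
Proof.
move=> vk; have [j /andP[h1 h2]] := exists_level a2 vk.
have aj0 : 0 < a ^ j by exact: exprz_gt0.
have [L hL] := mean_small x k aj0.
have ex : exists d : nat, a ^ j < v (k + d%:Z) x by exists 0%N; rewrite addr0.
have bd d : a ^ j < v (k + d%:Z) x -> (d <= L)%N.
  move=> h; rewrite leqNgt; apply/negP => /ltnW/hL; rewrite leNgt => /negP; exact.
case: (ex_maxnP ex bd) => d hd dmax; exists d; split.
  exists j; split; first exact: hd.
  move=> l kl; rewrite leNgt; apply/negP => hl.
  have [i il] : exists i : nat, l = k + i%:Z.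
    have : 0 <= l - k by rewrite subr_ge0; apply: ltW; apply: le_lt_trans kl; rewrite lerDl.
    by case E : (l - k) => [i|//] _; exists i; rewrite -E addrC subrK.
  rewrite il in hl kl; have := dmax _ hl.
  by move: kl; rewrite ltrD2l ltz_nat ltnNge => /negP.
apply: (le_trans h2); rewrite expfzDr ?gt_eqF// expr1z mulrC ler_pM2l//.
exact: ltW.
Qed.

Let u k x : R := v k x `^ p^-1.

Lemma stopping_above_powR k x : 0 < v k x -> exists d : nat,
  stopping b g (k + d%:Z) x /\ u k x <= a * u (k + d%:Z) x.
Proof.
move=> vk; have [d [sd vd]] := stopping_above vk; exists d; split => //.
have p0 : 0 < p by exact: lt_le_trans p1.
apply: (@le_trans _ _ ((a * v (k + d%:Z) x) `^ p^-1)).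
  apply: ge0_ler_powR; rewrite ?nnegrE ?invr_ge0 ?(ltW p0)//.
  by apply: mulr_ge0; [exact: ltW|exact: v0].
rewrite powRM ?(ltW a0)//; apply: ler_wpM2r; first exact: powR_ge0.
by apply: ler1_powR; [exact: ltW|rewrite invf_le1].
Qed.

Lemma sum_exp2_le (m s : nat) : \sum_(i < m | (i <= s)%N) (2 : R) ^+ i <= 2 ^+ s.+1.
Proof.
have geo N : \sum_(0 <= i < N) (2 : R) ^+ i <= 2 ^+ N.
  elim: N => [|N IH]; first by rewrite big_nil expr0.
  by rewrite big_nat_recr//= exprS mulr_natl mulr2n lerD2r.
rewrite -(big_mkord (fun i => i <= s)%N (fun i => (2 : R) ^+ i)).
case: (leqP m s.+1) => ms.
  apply: (@le_trans _ _ (\sum_(0 <= i < m) (2 : R) ^+ i)).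
    by rewrite big_mkcond; apply: ler_sum => i _; case: ifP => // _; exact: exprn_ge0.
  apply: le_trans (geo m) _.
  by rewrite -[leLHS]/(2 ^ m%:Z) -[leRHS]/(2 ^ s.+1%:Z) ler_eXz2l// ltr1n.
apply: le_trans (geo s.+1); rewrite (@big_nat_widen _ _ _ 0 s.+1 m)//.
exact: ltnW.
Qed.

(** The sum over all scales is dominated by the sum over the stopping scales: the
    mean at a given scale is at most [a] times the mean at some larger stopping
    scale, and the side lengths below a given scale add up geometrically. *)
Lemma sum_scales_le x (k0 : int) (m : nat) : exists L : nat,
  \sum_(i < m) 2 ^ (k0 + i%:Z) * u (k0 + i%:Z) x <=
  2 * a * \sum_(s < L | `[< stopping b g (k0 + s%:Z) x >])
    (2 ^ (k0 + s%:Z) * u (k0 + s%:Z) x).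
Proof.
have p0 : 0 < p by exact: lt_le_trans p1.
have [sg sgP] : exists sg : nat -> nat, forall i, 0 < v (k0 + i%:Z) x ->
    [/\ (i <= sg i)%N, stopping b g (k0 + (sg i)%:Z) x &
      u (k0 + i%:Z) x <= a * u (k0 + (sg i)%:Z) x].
  have H i : exists s : nat, 0 < v (k0 + i%:Z) x ->
      [/\ (i <= s)%N, stopping b g (k0 + s%:Z) x &
        u (k0 + i%:Z) x <= a * u (k0 + s%:Z) x].
    case: (ltP 0 (v (k0 + i%:Z) x)) => vi; last by exists 0%N.
    have [d [sd ud]] := stopping_above_powR vi.
    exists (i + d)%N => _; rewrite PoszD addrA; split => //; exact: leq_addr.
  by have [sg sgP] := choice H; exists sg.
pose L := (\max_(i < m) sg i).+1; exists L.
have u0 k : 0 <= u k x by exact: powR_ge0.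
have two0 k : 0 <= (2 : R) ^ k by exact: ltW (exp2z_gt0 k).
pose S s := `[< stopping b g (k0 + s%:Z) x >].
apply: (@le_trans _ _ (\sum_(i < m) \sum_(s < L | S s)
    if (i <= s)%N then 2 ^ (k0 + i%:Z) * (a * u (k0 + s%:Z) x) else 0)).
  apply: ler_sum => i _; case: (ltP 0 (v (k0 + i%:Z) x)) => vi; last first.
    rewrite [u _ _](_ : _ = 0).
      rewrite mulr0 sumr_ge0// => s _; case: ifP => // _.
      by rewrite mulr_ge0// mulr_ge0// ltW.
    by rewrite /u (_ : v _ _ = 0) ?powR0 ?invr_neq0 ?gt_eqF//; apply/eqP; rewrite eq_le vi v0.
  have [isg ssg usg] := sgP i vi.
  have sgL : (sg i < L)%N by rewrite ltnS; exact: (leq_bigmax i).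
  rewrite (bigD1 (Ordinal sgL))/=; last exact/asboolP.
  rewrite isg ler_wpDr ?ler_wpM2l// sumr_ge0// => s _; case: ifP => // _.
  by rewrite mulr_ge0// mulr_ge0// ltW.
rewrite exchange_big/= mulr_sumr; apply: ler_sum => s _.
rewrite -big_mkcond/= -mulr_suml.
rewrite (eq_bigr (fun i : 'I_m => 2 ^ k0 * 2 ^+ i)); last first.
  by move=> i _; rewrite expfzDr.
rewrite -mulr_sumr.
apply: (@le_trans _ _ (2 ^ k0 * 2 ^+ s.+1 * (a * u (k0 + s%:Z) x))).
  apply: ler_wpM2r; first by rewrite mulr_ge0// ltW.
  by apply: ler_wpM2l => //; exact: sum_exp2_le.
rewrite expfzDr// exprS -exprnP le_eqVlt; apply/orP; left; apply/eqP; ring.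
Qed.

Lemma sum_le_principal x (k0 : int) (m : nat) :
  ((\sum_(i < m) 2 ^ (k0 + i%:Z) * u (k0 + i%:Z) x)%:E <=
  (2 * a)%:E * \esum_(Q in principal b g)
    ((Q.2)%:E * (mean g Q `^ p^-1)%:E * (\1_(cube Q) x)%:E))%E.
Proof.
have [L hL] := sum_scales_le x k0 m.
apply: (@le_trans _ _ ((2 * a)%:E *
  (\sum_(s < L | `[< stopping b g (k0 + s%:Z) x >])
    (2 ^ (k0 + s%:Z) * u (k0 + s%:Z) x))%:E)%E); first by rewrite -EFinM lee_fin.
apply: lee_wpmul2l; first by rewrite lee_fin mulr_ge0// ltW.
pose Qs s := dyadic_at t (k0 + s%:Z) x.
pose r := [seq s <- iota 0 L | `[< stopping b g (k0 + s%:Z) x >]].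
have Qinj : injective Qs.
  move=> i j /(congr1 snd) /(@exp2z_inj R) /addrI [] //.
apply: esum_ge; exists [set` [seq Qs s | s <- r]].
  split; first exact: finite_seq.
  move=> Q /= /mapP[s]; rewrite mem_filter => /andP[/asboolP st _] ->.
  by apply/principalP.
rewrite -fsbig_seq; last by rewrite map_inj_uniq// filter_uniq// iota_uniq.
rewrite big_map big_filter.
rewrite -sumEFin -(big_mkord (fun s => `[< stopping b g (k0 + s%:Z) x >])
  (fun s => (2 ^ (k0 + s%:Z) * u (k0 + s%:Z) x)%:E)).
rewrite /index_iota subn0; apply: lee_sum => s _.
by rewrite indicE mem_set ?mule1 ?EFinM//; exact: dyadic_at_self.
Qed.

End sparse_domination.

(** * Reflections *)

Section reflection.
Context {R : realType}.
Local Open Scope ereal_scope.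

Lemma integral_opp_line (phi : R -> \bar R) : measurable_fun setT phi ->
  (forall x, 0 <= phi x) ->
  \int[lebesgue_measure]_x phi x = \int[lebesgue_measure]_x phi (- x)%R.
Proof.
move=> mphi phi0.
have mN : measurable_fun setT (-%R : measurableTypeR R -> measurableTypeR R).
  exact: oppr_measurable.
pose pm : {measure set (measurableTypeR R) -> \bar R} :=
  measure_function_pushforward__canonical__measure_function_Measure
    (@lebesgue_measure R) mN.
rewrite (eq_measure_integral [the measure _ _ of pm]); last first.
  move=> A mA _.
  apply: lebesgue_measure_unique => // _ [[u v] _ <-].
  have eT : (-%R : R -> measurableTypeR R) @^-1` `]u, v] = `[(- v)%R, (- u)%R[%classic.
    by apply/seteqP; split=> x /=; rewrite !in_itv/= => /andP[ux xv];
      apply/andP; split; lra.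
  transitivity (lebesgue_measure ((-%R : R -> measurableTypeR R) @^-1` `]u, v])); last by [].
  by rewrite eT !lebesgue_measure_itv/= !lte_fin ltrN2; case: ifP => // _;
    rewrite -!EFinD opprK addrC.
by rewrite ge0_integral_pushforward.
Qed.

Lemma integral_opp_rV n (phi : 'rV[R]_n -> \bar R) : measurable_fun setT phi ->
  (forall x, 0 <= phi x) ->
  \int[lebesgue_rV n]_x phi x = \int[lebesgue_rV n]_x phi (- x)%R.
Proof.
elim: n phi => [|n IH] phi mphi phi0.
  by apply: eq_integral => x _; congr phi; apply/rowP; case.
have mopp m : measurable_fun setT (fun x : 'rV[R]_m => - x)%R.
  apply/measurable_fun_rVP => i.
  rewrite (_ : (fun _ => _) = (fun x : 'rV[R]_m => - x ord0 i)%R); last first.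
    by apply/funext => x; rewrite mxE.
  by apply: measurableT_comp => //; exact: measurable_coord.
have mphi' (x : R) : measurable_fun setT (fun v => phi (cons_rV (x, v))).
  apply: measurableT_comp => //.
  exact: (measurable_fun_pair2 _ (@measurable_cons_rV R n)).
rewrite !integral_lebesgue_rVS//; last exact: measurableT_comp mphi (mopp _).
rewrite integral_opp_line; last 2 first.
- apply: (@measurable_fun_fubini_tonelli_F _ _ _ _ _ (lebesgue_rV n)
    (phi \o @cons_rV R n)) => [|x]; last exact: phi0.
  by apply: measurableT_comp => //; exact: measurable_cons_rV.
- by move=> x /=; apply: integral_ge0 => v _.
apply: eq_integral => x _ /=; rewrite IH//.
apply: eq_integral => v _; congr phi.
by apply/rowP => i; case: (unliftP ord0 i) => [j|] ->;
  rewrite !mxE/= ?liftK ?unlift_none// !mxE.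
Qed.

Lemma integral_reflect_rV n (phi : 'rV[R]_n -> \bar R) (x : 'rV[R]_n) :
  measurable_fun setT phi -> (forall x, 0 <= phi x) ->
  \int[lebesgue_rV n]_y phi y = \int[lebesgue_rV n]_y phi (x - y)%R.
Proof.
move=> mphi phi0; rewrite (integral_affine_rV x ltr01 mphi phi0) expr1n mul1e.
rewrite integral_opp_rV//; last exact: measurableT_comp mphi (measurable_affine_rV x 1).
by apply: eq_integral => y _; rewrite scale1r.
Qed.

End reflection.

(** * Smooth functions with compact support *)

Section smooth_compactly_supported.
Context {R : realType} {n : nat}.
Variable f : 'rV[R]_n -> R.
Hypothesis sf : smooth_compact_support f.

Lemma smooth_continuous : continuous f.
Proof. exact: (sf.1 [::]).1. Qed.

Lemma smooth_continuously_differentiable : continuously_differentiable f.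
Proof.
split=> [i x|i]; first exact: ((sf.1 [::]).2 i x).
exact: (sf.1 [:: i]).1.
Qed.

Let K := closure [set x | f x != 0].

Let f_out x : ~ K x -> f x = 0.
Proof.
by move=> Kx; apply: contra_notP Kx => /eqP fx; exact: subset_closure.
Qed.

Let grad_out x : ~ K x -> gradient f x = 0.
Proof.
move=> Kx; apply/rowP => i; rewrite !mxE.
have nK : \forall y \near x, f y = 0.
  have : open (~` K) by rewrite openC; exact: closed_closure.
  by rewrite openE => /(_ x Kx); apply: filterS => y; exact: f_out.
rewrite /partial -(derive_cst (0 : R) x (delta_mx ord0 i)).
exact: near_eq_derive nK.
Qed.

Let K_bounded : exists2 B : R, 0 <= B & forall x i, K x -> `|x ord0 i| <= B.
Proof.
have [M [_ hM]] := compact_bounded sf.2.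
exists (`|M| + 1) => [|x i Kx]; first by rewrite addr_ge0.
have : `|x| <= `|M| + 1 by apply: hM Kx; rewrite ltr_pwDr// ler_norm.
apply: le_trans; rewrite [leRHS](_ : _ = mx_norm x)// mx_normrE.
exact: (le_bigmax_cond _ (fun ij : 'I_1 * 'I_n => `|x ij.1 ij.2|) (j := (ord0, i))).
Qed.

Lemma support_bounded : exists2 B : R, 0 < B &
  forall x, B < enorm x -> f x = 0 /\ gradient f x = 0.
Proof.
have [B B0 hB] := K_bounded; exists (n%:R * B + 1) => [|x Bx].
  by rewrite ltr_pwDr// mulr_ge0.
suff Kx : ~ K x by split; [exact: f_out|exact: grad_out].
move=> Kx; have := enorm_le B0 (fun i => hB x i Kx).
by move: Bx; lra.
Qed.

Let bounded_of (h : 'rV[R]_n -> R) : continuous h -> (forall x, ~ K x -> h x = 0) ->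
  exists2 M : R, 0 <= M & forall x, `|h x| <= M.
Proof.
move=> ch hout.
have : compact (h @` K) by apply: continuous_compact sf.2; exact: continuous_subspaceT.
move=> /compact_bounded [M [_ hM]]; exists (`|M| + 1) => [|x]; first by rewrite addr_ge0.
have [Kx|/hout ->] := pselect (K x); last by rewrite normr0 addr_ge0.
by apply: hM; [rewrite ltr_pwDr// ler_norm|exists x].
Qed.

Lemma smooth_bounded : exists2 M : R, 0 <= M & forall x, `|f x| <= M.
Proof. by apply: bounded_of f_out; exact: smooth_continuous. Qed.

Lemma gradient_bounded : exists2 L : R, 0 <= L & forall x, enorm (gradient f x) <= L.
Proof.
have [|x Kx|L L0 hL] := @bounded_of (fun x => enorm (gradient f x)).
- exact: continuous_enorm_gradient smooth_continuously_differentiable.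
- by rewrite grad_out// enorm0.
by exists L => // x; apply: le_trans (hL x); exact: ler_norm.
Qed.

Lemma measurable_gradient_powR (p : R) :
  measurable_fun setT (fun y => `|enorm (gradient f y)| `^ p).
Proof.
apply: (@measurableT_comp _ _ _ _ _ _ (@powR R ^~ p)) => //.
apply: measurableT_comp => //; apply: continuous_measurable_rV.
exact: continuous_enorm_gradient smooth_continuously_differentiable.
Qed.

Lemma integral_gradient_powR_lty (p : R) : 0 < p ->
  (\int[lebesgue_rV n]_y (`|enorm (gradient f y)| `^ p)%:E < +oo)%E.
Proof.
move=> p0; have [B B0 hB] := support_bounded; have [L L0 hL] := gradient_bounded.
apply: (@le_lt_trans _ _ (\int[lebesgue_rV n]_(y in ccube (B + 1)) (L `^ p)%:E)%E).
  rewrite [leRHS]integral_mkcond; apply: ge0_le_integral.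
  - exact: measurableT.
  - by move=> y _; rewrite lee_fin powR_ge0.
  - by apply/measurable_EFinP; exact: measurable_gradient_powR.
  - by apply/(measurable_restrictT _ _).1; [exact: measurable_cube|].
  move=> y _; rewrite patchE; case: ifPn => yB.
    rewrite lee_fin; apply: ge0_ler_powR; rewrite ?nnegrE ?(ltW p0)//.
    by rewrite ger0_norm ?enorm_ge0.
  rewrite (hB y _).2 ?enorm0 ?normr0 ?powR0 ?gt_eqF//.
  rewrite ltNge; apply/negP => yB'; move/negP : yB; apply; rewrite inE.
  apply/ccubeP => i; have := le_trans (coord_le_enorm y i) yB'.
  by rewrite ler_norml => /andP[h1 h2]; apply/andP; split; lra.
rewrite integral_cst; last exact: measurable_cube.
apply: lte_mul_pinfty; rewrite ?lee_fin ?powR_ge0//.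
by apply: (@le_lt_trans _ _ (lebesgue_rV n (ccube (B + 1)))) => //; rewrite lebesgue_ccube ?ltry// addr_gt0.
Qed.

Variable x : 'rV[R]_n.
Let F y := f (x - y).

Let is_derive_reflect y h : is_derive y h F (- \sum_i h ord0 i * partial i f (x - y)).
Proof.
have e : (fun s : R => s^-1 *: ((F \o shift y) (s *: h) - F y)) =
    (fun s => s^-1 *: ((f \o shift (x - y)) (s *: (- h)) - f (x - y))).
  apply/funext => s; congr (_ *: (f _ - _)).
  by rewrite /= scalerN opprD addrCA.
have [d1 d2] := is_derive_gradient (x - y) (- h) smooth_continuously_differentiable.
have -> : - (\sum_i h ord0 i * partial i f (x - y)) =
    \sum_i (- h) ord0 i * partial i f (x - y).
  by rewrite -sumrN; apply: eq_bigr => i _; rewrite mxE mulNr.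
by apply: DeriveDef; rewrite /derivable /derive e.
Qed.

Let partial_reflect i y : partial i F y = - partial i f (x - y).
Proof.
have [_] := is_derive_reflect y (delta_mx ord0 i); rewrite /partial => ->.
rewrite (bigD1 i)//= big1 ?addr0 ?mxE ?eqxx ?mul1r// => j ji.
by rewrite mxE eqxx (negbTE ji)/= mul0r.
Qed.

Let continuous_precomp_reflect (h : 'rV[R]_n -> R) :
  continuous h -> continuous (fun y : 'rV[R]_n => h (x - y)).
Proof.
move=> ch y; apply/(@cvgrPdist_lt _ _ _ (nbhs y) (nbhs_filter y)) => e e0.
have [d d0 hd] := continuous_rV_eps (x - y) ch e0.
apply/nbhs_ballP; exists d => //= z [_ yz]; rewrite distrC; apply: hd => i.
by have := yz ord0 i; rewrite /ball/= !mxE opprD opprK addrACA subrr add0r addrC.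
Qed.

Lemma continuous_reflect : continuous F.
Proof.
exact: continuous_precomp_reflect smooth_continuous.
Qed.

Lemma continuously_differentiable_reflect : continuously_differentiable F.
Proof.
split=> [i y|i]; first by have [] := is_derive_reflect y (delta_mx ord0 i).
rewrite (_ : partial i F = (fun y => - partial i f (x - y))); last first.
  by apply/funext => y; exact: partial_reflect.
have cf : continuous (partial i f) by exact: (sf.1 [:: i]).1.
move=> y; have := continuous_precomp_reflect cf (x0 := y).
exact: (@cvgN _ _ _ (nbhs y) (nbhs_filter y)).
Qed.

Lemma enorm_gradient_reflect y :
  enorm (gradient F y) = enorm (gradient f (x - y)).
Proof.
rewrite -[RHS]enormN; congr enorm; apply/rowP => i.
by rewrite !mxE; exact: partial_reflect.
Qed.

End smooth_compactly_supported.

(** * Truncations and the principal value *)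

Lemma lipschitz_gradient {R : realType} {n : nat} (F : 'rV[R]_n -> R) (L : R) :
  continuously_differentiable F -> (forall y, enorm (gradient F y) <= L) ->
  forall y h, `|F (y + h) - F y| <= L * enorm h.
Proof.
move=> dF FL y h.
have dh z : derivable F z h by have [] := is_derive_gradient z h dF.
have [s _] := mvt_line y 1 dh; rewrite scale1r mul1r => ->.
have [_ ->] := is_derive_gradient (y + s *: h) h dF.
rewrite mulrC; apply: le_trans (ler_wpM2l (enorm_ge0 h) (FL (y + s *: h))).
apply: le_trans (cauchy_schwarz h _).
rewrite le_eqVlt; apply/orP; left; apply/eqP; congr `|_|.
by apply: eq_bigr => i _; rewrite mxE.
Qed.

Section truncations.
Context {R : realType} {n : nat}.
Local Notation mu := (@lebesgue_rV R n).
Variables (Om : 'rV[R]_n -> R) (rho : R).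
Hypotheses (n2 : (2 <= n)%N) (LOm : sphere_Lp rho Om)
  (Om0 : (\int[sphere_measure R n]_(y in sphere R n) (Om y)%:E = 0)%E).
Hypothesis rho_n : 1 < rho < n%:R.
Variable f : 'rV[R]_n -> R.
Hypothesis sf : smooth_compact_support f.
Variable x : 'rV[R]_n.

Let F y := f (x - y).

Definition shell_part (r s : R) : \bar R :=
  (\int[mu]_(y in shell r s) (rough_kernel Om y * F y)%:E)%E.

Let n0 : (0 < n)%N. Proof. exact: ltnW. Qed.
Let rho1 : 1 <= rho. Proof. by apply: ltW; case/andP: rho_n. Qed.
Let cF : continuous F. Proof. exact: continuous_reflect. Qed.
Let FM : exists M : R, forall y, `|F y| <= M.
Proof. by have [M _ hM] := smooth_bounded sf; exists M => y; exact: hM. Qed.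

Let mKF D : measurable_fun D (fun y => (rough_kernel Om y * F y)%:E).
Proof.
apply: measurable_funTS; apply/measurable_EFinP; apply: measurable_funM.
  exact: (measurable_rough_kernel LOm).
exact: continuous_measurable_rV.
Qed.

Lemma shell_part_fin_num r s : 0 < r -> shell_part r s \is a fin_num.
Proof.
move=> r0; have [M hM] := FM.
by apply: integrable_fin_num; [exact: measurable_shell|
  exact: (integrable_rough_kernelM n2 LOm rho_n cF hM)].
Qed.

Lemma shell_part_split r s u : r <= s -> s <= u ->
  shell_part r u = (shell_part r s + shell_part s u)%E.
Proof.
move=> rs su; rewrite /shell_part -integral_setU.
- congr integral; apply/seteqP; split=> y; rewrite /shell/=.
    by move=> /andP[h1 h2]; case: (leP (enorm y) s) => h; [left|right]; apply/andP; split.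
  move=> [/andP[h1 h2]|/andP[h1 h2]]; apply/andP; split => //.
    exact: le_trans su.
  exact: le_lt_trans h1.
- exact: measurable_shell.
- exact: measurable_shell.
- exact: mKF.
- apply/disj_set2P; rewrite -subset0 => y [] /andP[_ ys] /andP[+ _].
  by rewrite ltNge ys.
Qed.

(** [F] vanishes outside a ball. *)
Lemma truncated_eventually : exists2 B : R, 0 < B &
  forall e s, 0 < e -> e <= s -> B <= s -> truncated Om f e x = shell_part e s.
Proof.
have [B B0 hB] := support_bounded sf.
exists (B + enorm x) => [|e s e0 es Bs]; first by rewrite ltr_pwDl// enorm_ge0.
have Fs y : s < enorm y -> F y = 0.
  move=> sy; apply: (hB _ _).1; have := enormD (x - y) (- x).
  rewrite enormN addrAC subrr add0r enormN; lra.
rewrite /truncated.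
rewrite (_ : [set y | _] = shell e s `|` [set y | s < enorm y]); last first.
  apply/seteqP; split=> y /=.
    by move=> h; case: (leP (enorm y) s) => h'; [left; apply/andP|right].
  by move=> [/andP[]//|]; exact: le_lt_trans.
have mout : measurable [set y : 'rV[R]_n | s < enorm y].
  rewrite (_ : [set y | _] = setT `&` (@enorm R n) @^-1` `]s, +oo[%classic).
    by apply: (@measurable_enorm R n) => //; exact: measurable_itv.
  by apply/seteqP; split => y /=; rewrite in_itv/= andbT => // -[].
have E y : (0 < enorm y) ->
    (Om (edir y) / enorm y ^+ n * f (x - y))%:E = (rough_kernel Om y * F y)%:E.
  by move=> y0; rewrite /rough_kernel radial_extensionE.
rewrite (@eq_integral _ _ _ mu _ (fun y => (rough_kernel Om y * F y)%:E)); last first.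
  move=> y; rewrite inE => -[/andP[h _]|h]; apply: E; first exact: lt_trans h.
  exact: lt_trans (lt_le_trans e0 es) h.
rewrite integral_setU.
- rewrite [X in (_ + X)%E](_ : _ = 0%E) ?adde0//.
  by apply: integral0_eq => y /= sy; rewrite Fs// mulr0.
- exact: measurable_shell.
- exact: mout.
- exact: mKF.
- apply/disj_set2P; rewrite -subset0 => y [] /andP[_ ys] /=.
  by rewrite ltNge ys.
Qed.

Lemma shell_part_dyadic_sum (e : R) (N : nat) : 0 < e ->
  shell_part e (2 ^+ N * e) =
  (\sum_(i < N) shell_part (2 ^+ i * e) (2 * (2 ^+ i * e)))%E.
Proof.
move=> e0; elim: N => [|N IH].
  rewrite expr0 mul1r big_ord0 /shell_part (_ : shell e e = set0) ?integral_set0//.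
  by rewrite -subset0 => y /andP[h1 h2]; move: (lt_le_trans h1 h2); rewrite ltxx.
have h : 1 <= (2 : R) ^+ N by rewrite exprn_ege1// ler1n.
rewrite (@shell_part_split _ (2 ^+ N * e)).
- by rewrite IH big_ord_recr/= exprS mulrA.
- by rewrite ler_peMl// ltW.
- by rewrite exprS -mulrA ler_peMl ?ler1n// mulr_ge0 ?(ltW e0)// (le_trans ler01).
Qed.

(** The cancellation of [Om] replaces [F] by [F - F 0], which is of size at most
    [enorm y] up to a constant: each dyadic shell contributes at most a multiple of
    its radius, and the radii form a geometric series. *)
Lemma shell_part_small : exists2 C : R, 0 <= C &
  forall r s, 0 < r -> r <= s -> (`|shell_part r s| <= (C * s)%:E)%E.
Proof.
have [M hM] := FM; have [L L0 hL] := gradient_bounded sf.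
have FL y : `|F y - F 0| <= L * enorm y.
  rewrite -[X in F X]add0r; apply: lipschitz_gradient => [|z].
    exact: continuously_differentiable_reflect.
  by rewrite (enorm_gradient_reflect sf).
pose bm := ball_mass (fun y => (`|radial_extension Om y|)%:E).
have bm0 : (0 <= bm)%E by apply: integral_ge0 => y _; rewrite lee_fin.
have bmE : bm = (fine bm)%:E.
  by rewrite fineK// ge0_fin_numE//; exact: ball_mass_norm_lty n0 rho1 LOm.
pose C := 2 ^+ n * L * fine bm.
have C0 : 0 <= C by rewrite !mulr_ge0 ?fine_ge0 ?exprn_ge0.
have one r s : 0 < r -> r <= s -> s <= 2 * r -> (`|shell_part r s| <= (C * s)%:E)%E.
  move=> r0 rs sr; have s0 : 0 < s by exact: lt_le_trans rs.
  apply: le_trans (le_integral_oscillation n2 LOm Om0 rho_n cF hM s (F 0) r0) _.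
  apply: (@le_trans _ _ ((r ^- n)%:E * ((L * s)%:E *
      \int[mu]_(y in shell r s) (`|radial_extension Om y|)%:E))%E).
    apply: lee_wpmul2l; first by rewrite lee_fin invr_ge0 exprn_ge0 ?ltW.
    have mk : measurable_fun setT (fun y => `|radial_extension Om y|).
      by apply: measurableT_comp => //; apply: measurable_radial_extension; exact: LOm.1.
    rewrite -ge0_integralZl_EFin.
    - apply: ge0_le_integral.
      + exact: measurable_shell.
      + by move=> y _; rewrite lee_fin mulr_ge0.
      + apply: measurable_funTS; apply/measurable_EFinP; apply: measurable_funM => //.
        apply: measurableT_comp => //; apply: measurable_funB => //.
        exact: continuous_measurable_rV.
      + apply: measurable_funTS; apply/measurable_EFinP.
        by apply: measurable_funM => //; exact: measurable_cst.
      + move=> y /andP[_ ys]; rewrite lee_fin mulrC; apply: ler_wpM2r => //.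
        by apply: le_trans (FL y) _; exact: ler_wpM2l.
    - exact: measurable_shell.
    - by move=> y _; rewrite lee_fin.
    - by apply: measurable_funTS; apply/measurable_EFinP.
    - by rewrite mulr_ge0 ?(ltW s0).
  apply: (@le_trans _ _ ((r ^- n)%:E * ((L * s)%:E * ((s ^+ n)%:E * bm)))%E).
    apply: lee_wpmul2l; first by rewrite lee_fin invr_ge0 exprn_ge0 ?ltW.
    apply: lee_wpmul2l; first by rewrite lee_fin mulr_ge0 ?(ltW s0).
    by apply: (integral_shell_norm_le LOm) => //; exact: ltW.
  rewrite bmE -!EFinM lee_fin /C.
  have : s ^+ n <= 2 ^+ n * r ^+ n by rewrite -exprMn lerXn2r// nnegrE ?mulr_ge0 ?ltW.
  rewrite -ler_pdivrMr ?exprn_gt0// => h.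
  have h2 : 0 <= L * s * fine bm by rewrite !mulr_ge0 ?fine_ge0 ?(ltW s0).
  have := ler_wpM2r h2 h; congr (_ <= _); ring.
exists (2 * C) => [|r s r0 rs]; first by rewrite mulr_ge0.
have [N] : exists N : nat, s <= 2 ^+ N * r.
  exists (Num.bound (s / r)); rewrite -ler_pdivrMr//.
  by apply/ltW/upper_nthrootP.
elim: N s rs => [|N IH] s rs sN; have s0 : 0 <= s by apply: le_trans rs; exact: ltW.
  apply: (le_trans (one _ _ r0 rs _)); first by move: sN; rewrite expr0; lra.
  by rewrite lee_fin ler_wpM2r// ler_peMl// ler1n.
case: (leP s (2 * r)) => sr.
  apply: (le_trans (one _ _ r0 rs sr)).
  by rewrite lee_fin ler_wpM2r// ler_peMl// ler1n.
have rs2 : r <= s / 2 by lra.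
rewrite (shell_part_split rs2); last by lra.
apply: le_trans (lee_abs_add _ _) _.
apply: le_trans (leeD (IH _ rs2 _) (one _ _ _ _ _)) _.
- by move: sN; rewrite exprS; lra.
- exact: lt_le_trans rs2.
- lra.
- lra.
- by rewrite -EFinD lee_fin; lra.
Qed.

(** The truncations at [e < r] differ by [shell_part e r], which is of order [r]
    uniformly in [e]. *)
Lemma cvg_truncated : exists l : R, truncated Om f e x @[e --> 0^'+] --> l%:E.
Proof.
have [B B0 hB] := truncated_eventually; have [C C0 hC] := shell_part_small.
have tE e : 0 < e -> e <= B -> truncated Om f e x = (fine (shell_part e B))%:E.
  by move=> e0 eB; rewrite (hB e B)// fineK// shell_part_fin_num.
pose T e := fine (truncated Om f e x).
have /cauchy_cvgP/cvg_ex[l Tl] : cauchy (T e @[e --> 0^'+]).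
  apply: cauchy_exP => d d0.
  pose r := Num.min B (d / (C + 1)).
  have C1 : 0 < C + 1 by rewrite ltr_wpDl.
  have r0 : 0 < r by rewrite lt_min B0 divr_gt0.
  have rB : r <= B by rewrite ge_min lexx.
  have rd : C * r < d.
    have : r <= d / (C + 1) by rewrite ge_min lexx orbT.
    rewrite ler_pdivlMr// mulrDr mulr1 mulrC => h; lra.
  exists (T r); suff : \forall e \near 0^'+, ball (T r) d (T e) by [].
  near=> e.
  have e0 : 0 < e by near: e; exact: nbhs_right_gt.
  have er : e <= r by near: e; exact: nbhs_right_le.
  rewrite /ball/= /T !tE// ?(le_trans er)//= distrC.
  rewrite (shell_part_split er rB) fineD ?shell_part_fin_num// addrK.
  apply: le_lt_trans rd; rewrite -lee_fin; apply: le_trans (hC e r e0 er).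
  by rewrite -[X in (_ <= `|X|)%E]fineK ?shell_part_fin_num.
exists l; apply: cvg_EFin Tl; near=> e.
have e0 : 0 < e by near: e; exact: nbhs_right_gt.
have eB : e <= B by near: e; exact: nbhs_right_le.
by rewrite tE.
Unshelve. all: by end_near. Qed.

Lemma rough_pv_exists_smooth : rough_pv_exists Om f x.
Proof. by have [l tl] := cvg_truncated; apply/cvg_ex; exists l%:E. Qed.

Lemma rough_op_le_max : (`|rough_op Om f x| <= rough_max_op Om f x)%E.
Proof.
have /cvg_abse := rough_pv_exists_smooth.
apply: cvge_le; near=> e; apply: ereal_sup_ubound.
by exists e => //=; near: e; exact: nbhs_right_gt.
Unshelve. all: by end_near. Qed.

End truncations.

(** * Sparse domination *)

Section domination.
Context {R : realType} {n : nat}.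
Local Notation mu := (@lebesgue_rV R n).
Variables (Om : 'rV[R]_n -> R) (rho p : R).
Hypotheses (n2 : (2 <= n)%N) (LOm : sphere_Lp rho Om)
  (Om0 : (\int[sphere_measure R n]_(y in sphere R n) (Om y)%:E = 0)%E).
Hypothesis rho_n : 1 < rho < n%:R.
Hypothesis p_n : rho * n%:R / (rho * n%:R + rho - n%:R) <= p < n%:R.
Variable f : 'rV[R]_n -> R.
Hypothesis sf : smooth_compact_support f.

Let g (y : 'rV[R]_n) : R := `|enorm (gradient f y)| `^ p.
Let N := fine (sphere_Lnorm rho Om).

Definition domination_const : R :=
  @annulus_const R n p * (72 ^+ n) `^ p^-1 * (2 * 2 ^+ n.+1).

Let n0 : (0 < n)%N. Proof. exact: ltnW. Qed.

Let p1 : 1 <= p.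
Proof.
have /andP[r1 rn] := rho_n; case/andP: p_n => h _; apply: le_trans h.
have n1 : 1 <= n%:R :> R by rewrite ler1n.
have d0 : 0 < rho * n%:R + rho - n%:R.
  have : 0 < (rho - 1) * n%:R by rewrite mulr_gt0 ?subr_gt0 ?ltr0n.
  lra.
by rewrite ler_pdivlMr// mul1r; lra.
Qed.

Let p0 : 0 < p. Proof. exact: lt_le_trans p1. Qed.
Let mg : measurable_fun setT g. Proof. exact: measurable_gradient_powR. Qed.
Let g0 y : 0 <= g y. Proof. exact: powR_ge0. Qed.
Let goo : (\int[mu]_y (g y)%:E < +oo)%E.
Proof. exact: integral_gradient_powR_lty. Qed.

Let A0 : 0 <= @annulus_const R n p.
Proof.
by rewrite /annulus_const !mulr_ge0 ?invr_ge0 ?exprn_ge0 ?powR_ge0.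
Qed.

(** [annulus_bound] requires a cube that contains the box of radius [6 * r] around
    [x], and [box_in_dyadic] provides one of side [2 ^ k] as soon as
    [6 * (6 * r) <= 2 ^ k]; the interval from [36 * r] to [72 * r] contains a power
    of two. *)
Lemma shell_part_le_mean x r k : 0 < r -> 36 * r <= 2 ^ k -> 2 ^ k <= 72 * r ->
  exists b, (`|shell_part Om f x r (2 * r)| <=
    (@annulus_const R n p * (72 ^+ n) `^ p^-1 * N *
     (2 ^ k * mean g (dyadic_at (shift_of b) k x) `^ p^-1))%:E)%E.
Proof.
move=> r0 rk kr; have k0 := @exp2z_gt0 R k.
have [b bQ] : exists b : {ffun 'I_n -> bool},
    box x (6 * r) `<=` cube (dyadic_at (shift_of b) k x).
  by apply: box_in_dyadic; lra.
exists b; set Q := dyadic_at _ _ _ in bQ *.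
have [M _ hM] := smooth_bounded sf.
have mE : (\int[mu]_(y in cube Q) (g y)%:E = (mean g Q * (2 ^ k) ^+ n)%:E)%E.
  exact: meanE.
have v0 : 0 <= mean g Q by exact: mean_ge0.
have bound : (\int[mu]_y (\1_(box 0 (6 * r)) y *
    enorm (gradient (fun z => f (x - z)) y) `^ p)%:E <=
    (mean g Q * (2 ^ k) ^+ n)%:E)%E.
  rewrite -mE (_ : (\int[mu]_y _)%E =
      (\int[mu]_y (\1_(box x (6 * r)) (x - y)%R * g (x - y)%R)%:E)%E); last first.
    apply: eq_integral => y _; rewrite (enorm_gradient_reflect sf) /g.
    rewrite ger0_norm ?enorm_ge0//; congr (_ * _)%:E; rewrite !indicE.
    congr ((nat_of_bool _)%:R); apply/idP/idP; rewrite !inE => h i; have := h i;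
      by rewrite !mxE ?subr0 addrAC subrr add0r normrN.
  rewrite -(@integral_reflect_rV _ _ (fun y => (\1_(box x (6 * r)) y * g y)%:E)).
  - rewrite integral_indicM; last exact: measurable_box.
    apply: ge0_subset_integral.
    + exact: measurable_box.
    + exact: measurable_cube.
    + by apply: measurable_funTS; apply/measurable_EFinP.
    + by move=> y _; rewrite lee_fin.
    + exact: bQ.
  - apply/measurable_EFinP; apply: measurable_funM; last exact: mg.
    by apply: measurable_indic; exact: measurable_box.
  - by move=> y; rewrite lee_fin mulr_ge0.
have := annulus_bound n2 LOm Om0 rho_n (continuous_reflect sf (x := x))
  (fun y => hM (x - y)) p_n (continuously_differentiable_reflect sf x) r0 bound.
move=> /le_trans; apply; rewrite lee_fin -/N.
have N0 : 0 <= N by rewrite fine_ge0// Lnorm_ge0.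
have step : (mean g Q * (2 ^ k) ^+ n / r ^+ n) `^ p^-1 <=
    (72 ^+ n) `^ p^-1 * mean g Q `^ p^-1.
  rewrite -powRM ?exprn_ge0//; apply: ge0_ler_powR.
  - by rewrite invr_ge0 ltW.
  - rewrite nnegrE; apply: divr_ge0; last by rewrite exprn_ge0 ?(ltW r0).
    by apply: mulr_ge0 => //; rewrite exprn_ge0 ?(ltW k0).
  - by rewrite nnegrE mulr_ge0 ?exprn_ge0.
  rewrite -mulrA mulrC; apply: ler_wpM2r => //.
  rewrite ler_pdivrMr ?exprn_gt0// -exprMn.
  by apply: lerXn2r; rewrite ?nnegrE ?mulr_ge0 ?(ltW k0) ?(ltW r0).
apply: (@le_trans _ _ (@annulus_const R n p * 2 ^ k * N *
    ((72 ^+ n) `^ p^-1 * mean g Q `^ p^-1))).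
  apply: ler_pM => //; last 1 first.
  - by apply: ler_wpM2r => //; apply: ler_wpM2l => //; lra.
  - by rewrite !mulr_ge0 ?(ltW r0).
  - exact: powR_ge0.
rewrite le_eqVlt; apply/orP; left; apply/eqP; ring.
Qed.

(** The annuli have radii [2 ^+ i * e] and are matched with the generations
    [k + i], for one [k]. The grid depends on the annulus: each term is bounded by
    its sum over all grids. *)
Lemma truncated_le_principal x e : 0 < e ->
  (`|truncated Om f e x| <= (domination_const * N)%:E *
    \sum_(b : {ffun 'I_n -> bool}) \esum_(Q in principal b g)
      ((Q.2)%:E * (mean g Q `^ p^-1)%:E * (\1_(cube Q) x)%:E))%E.
Proof.
move=> e0; have N0 : 0 <= N by rewrite fine_ge0// Lnorm_ge0.
have [B B0 hB] := truncated_eventually LOm sf x.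
pose m := Num.bound (B / e).
have mB : B <= 2 ^+ m * e by rewrite -ler_pdivrMr//; apply/ltW/upper_nthrootP.
have em : e <= 2 ^+ m * e by rewrite ler_peMl ?(ltW e0)// exprn_ege1// ler1n.
rewrite (hB _ _ e0 em mB) (shell_part_dyadic_sum LOm sf)//.
have [j /andP[h1 h2]] : exists j : int, 2 ^ j < 36 * e <= 2 ^ (j + 1).
  by apply: exists_level; rewrite ?mulr_gt0.
pose k i : int := j + 1 + i%:Z.
have kE (i : nat) : 2 ^ k i = 2 ^+ i * 2 ^ (j + 1) :> R.
  by rewrite /k expfzDr ?pnatr_eq0// mulrC.
have h3 : 2 ^ (j + 1) <= 72 * e by rewrite expfzDr ?pnatr_eq0// expr1z; lra.
pose u b (i : nat) : R := 2 ^ k i * mean g (dyadic_at (shift_of b) (k i) x) `^ p^-1.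
pose c := @annulus_const R n p * (72 ^+ n) `^ p^-1 * N.
have c0 : 0 <= c by rewrite !mulr_ge0 ?powR_ge0.
have u0 b i : 0 <= u b i by rewrite mulr_ge0 ?powR_ge0 ?(ltW (@exp2z_gt0 R _)).
apply: le_trans (lee_abs_sum _ _ _) _.
apply: (@le_trans _ _ (\sum_(i < m) (c * \sum_b u b i)%:E)%E).
  apply: lee_sum => i _.
  have i0 : 0 < (2 : R) ^+ i by rewrite exprn_gt0.
  have [|||b hb] := @shell_part_le_mean x (2 ^+ i * e) (k i).
  - exact: mulr_gt0.
  - by rewrite kE mulrCA ler_pM2l.
  - by rewrite kE mulrCA ler_pM2l.
  apply: (le_trans hb); rewrite lee_fin; apply: ler_wpM2l => //.
  by rewrite (bigD1 b)//= lerDl sumr_ge0.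
rewrite sumEFin -mulr_sumr exchange_big/= EFinM.
have E0 b : (0 <= \esum_(Q in principal b g)
    ((Q.2)%:E * (mean g Q `^ p^-1)%:E * (\1_(cube Q) x)%:E))%E.
  apply: esum_ge0 => Q [l [y [_ ->]]]; rewrite -!EFinM lee_fin !mulr_ge0 ?powR_ge0//.
  by rewrite dyadic_at_side ltW// exp2z_gt0.
apply: (@le_trans _ _ (c%:E * ((2 * 2 ^+ n.+1)%:E *
  \sum_(b : {ffun 'I_n -> bool}) \esum_(Q in principal b g)
      ((Q.2)%:E * (mean g Q `^ p^-1)%:E * (\1_(cube Q) x)%:E)))%E).
  apply: lee_wpmul2l; first by rewrite lee_fin.
  rewrite -sumEFin ge0_sume_distrr; last by move=> b _; exact: E0.
  apply: lee_sum => b _; exact: sum_le_principal.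
rewrite muleA -EFinM; apply: lee_wpmul2r; first by apply: sume_ge0 => b _.
rewrite lee_fin le_eqVlt; apply/orP; left; apply/eqP.
by rewrite /c /domination_const; ring.
Qed.

Lemma sparse_frac_op_principal b x :
  sparse_frac_op (principal b g) p (fun y => enorm (gradient f y)) x =
  (\esum_(Q in principal b g)
    ((Q.2)%:E * (mean g Q `^ p^-1)%:E * (\1_(cube Q) x)%:E))%E.
Proof.
apply: eq_esum => Q [k [y [_ ->]]]; set P := dyadic_at _ _ _.
congr (_ * _ * _)%E; rewrite /average.
have q0 : ((2 : R) ^ k) ^+ n != 0 by rewrite gt_eqF// exprn_gt0// exp2z_gt0.
have -> : (\int[mu]_(z in cube P) (g z)%:E = (mean g P * (2 ^ k) ^+ n)%:E)%E.
  exact: meanE.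
rewrite (_ : mu (cube P) = ((2 ^ k) ^+ n)%:E); last exact: lebesgue_dyadic_at.
by rewrite inver (negbTE q0) -EFinM mulfK// poweR_EFin.
Qed.

Lemma rough_max_op_le x :
  (rough_max_op Om f x <= domination_const%:E * sphere_Lnorm rho Om *
    \sum_(b : {ffun 'I_n -> bool})
      sparse_frac_op (principal b g) p (fun y => enorm (gradient f y)) x)%E.
Proof.
apply: ub_ereal_sup => _ [e /= e0 <-]; apply: le_trans (truncated_le_principal x e0) _.
rewrite [in leRHS](sphere_LnormE LOm) -EFinM.
by under [in leRHS]eq_bigr do rewrite sparse_frac_op_principal.
Qed.

Lemma principal_gradient_sparse b : sparse (principal b g).
Proof. exact: principal_sparse. Qed.

End domination.

Theorem theorem3p1 (R : realType) (n : nat) (rho p : R) :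
  (2 <= n)%N ->
  1 < rho < n%:R ->
  rho * n%:R / (rho * n%:R + rho - n%:R) <= p < n%:R ->
  exists c : R,
  forall Om : 'rV[R]_n -> R,
  sphere_Lp rho Om ->
  (\int[sphere_measure R n]_(y in sphere R n) (Om y)%:E = 0)%E ->
  forall f : 'rV[R]_n -> R, smooth_compact_support f ->
  exists S : {ffun 'I_n -> bool} -> set ('rV[R]_n * R),
    (forall b, S b `<=` dyadic_grid (shift_of b) /\ sparse (S b)) /\
    forall x : 'rV[R]_n,
      let bound := (c%:E * sphere_Lnorm rho Om *
        \sum_(b : {ffun 'I_n -> bool})
          sparse_frac_op (S b) p (fun y => enorm (gradient f y)) x)%E in
      (rough_max_op Om f x <= bound)%E /\
      (rough_pv_exists Om f x /\ (`|rough_op Om f x| <= bound)%E).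
Proof.
move=> n2 rho_n p_n; exists (@domination_const R n p) => Om LOm Om0 f sf.
exists (fun b => principal b (fun y => `|enorm (gradient f y)| `^ p)); split=> [b|x bound].
  split; first exact: principal_grid.
  exact: (principal_gradient_sparse n2 rho_n p_n sf b).
have le_bound : (rough_max_op Om f x <= bound)%E by exact: rough_max_op_le.
split=> //; split; first exact: (rough_pv_exists_smooth n2 LOm Om0 rho_n sf (x := x)).
exact: (le_trans (rough_op_le_max n2 LOm Om0 rho_n sf x) le_bound).
Qed.
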